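(* Let $G$ be a graph with $n\ge 8$ vertices, and write $n=5t+r$ with $t$ a positive integer and $r\in\{0,1,2,3,4\}$. Then $\phi(G)\le 10^t$ if $r=0$; $\phi(G)\le 15\cdot 10^{t-1}$ if $r=1$; $\phi(G)\le 225\cdot 10^{t-2}$ if $r=2$; $\phi(G)\le 36\cdot 10^{t-1}$ if $r=3$; $\phi(G)\le 6\cdot 10^{t}$ if $r=4$. Equality holds if and only if $G\cong tK_5^*$ (for $r=0$), $G\cong K_6^*\cup(t-1)K_5^*$ (for $r=1$), $G\cong 2K_6^*\cup(t-2)K_5^*$ (for $r=2$), $G\cong 2K_4^*\cup(t-1)K_5^*$ (for $r=3$), $G\cong K_4^*\cup tK_5^*$ (for $r=4$), where each occurrence of $K_m^*$ may independently be any graph of the stated form.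
   Context: A subset $F$ of vertices of a graph $G$ is a dissociation set if $G[F]$ has maximum degree at most $1$; a maximal dissociation set is one not properly contained in another dissociation set; $\phi(G)$ is the number of maximal dissociation sets of $G$. $K_m^*$ denotes any graph obtained from the complete graph $K_m$ by deleting $i$ pairwise non-adjacent edges (a matching of size $i$) for some $0\le i\le m/2$. $\ell H$ denotes the disjoint union of $\ell$ copies of $H$ and $\cup$ denotes disjoint union. *)

(* Defs.v *)
From mathcomp Require Import all_boot.
Set Implicit Arguments. Unset Strict Implicit. Unset Printing Implicit Defensive.

(* A simple graph on a finite vertex type T is a symmetric irreflexive relation e. *)

Definition dissociation (T : finType) (e : rel T) (F : {set T}) : bool :=
  [forall x in F, #|[set y in F | e x y]| <= 1].

Definition maximal_dissociation (T : finType) (e : rel T) (F : {set T}) : bool :=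
  maxset (dissociation e) F.

Definition phi (T : finType) (e : rel T) : nat :=
  #|[set F : {set T} | maximal_dissociation e F]|.

(* The subgraph induced on B is a K_m^* with m = #|B|: it is obtained from the
   complete graph on B by deleting the edges of a matching M. *)
Definition is_Kstar_on (T : finType) (e : rel T) (B : {set T}) : Prop :=
  exists M : rel T,
    [/\ (forall x y, M x y -> [&& x \in B, y \in B & x != y]),
        (forall x y, M x y -> M y x),
        (forall x y z, M x y -> M x z -> y = z) &
        (forall x y, x \in B -> y \in B -> e x y = (x != y) && ~~ M x y)].

Definition union_of_Kstars (T : finType) (e : rel T)
    (sizes_ok : {set {set T}} -> bool) : Prop :=
  exists P : {set {set T}},
    [/\ partition P [set: T],
        (forall B1 B2 x y, B1 \in P -> B2 \in P -> x \in B1 -> y \in B2 ->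
            e x y -> B1 = B2),
        (forall B, B \in P -> is_Kstar_on e B) &
        sizes_ok P].

Definition nblocks (T : finType) (P : {set {set T}}) (k : nat) : nat :=
  #|[set B in P | #|B| == k]|.

(* r = 0 : t K5*;  r = 1 : K6* u (t-1) K5*;  r = 2 : 2 K6* u (t-2) K5*;
   r = 3 : 2 K4* u (t-1) K5*;  r = 4 : K4* u t K5*.  (Number of K5* blocks is
   forced by the total vertex count n = 5t + r.) *)
Definition extremal_shape (r : nat) (T : finType) (P : {set {set T}}) : bool :=
  let a := nblocks P 4 in let b := nblocks P 6 in
  [&& [forall B in P, #|B| \in [:: 4; 5; 6]] &
      match r with
      | 0 => (a == 0) && (b == 0)
      | 1 => (a == 0) && (b == 1)
      | 2 => (a == 0) && (b == 2)
      | 3 => (a == 2) && (b == 0)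
      | _ => (a == 1) && (b == 0)
      end].

Definition phi_bound (t r : nat) : nat :=
  match r with
  | 0 => 10 ^ t
  | 1 => 15 * 10 ^ (t - 1)
  | 2 => 225 * 10 ^ (t - 2)
  | 3 => 36 * 10 ^ (t - 1)
  | _ => 6 * 10 ^ t
  end.

(* Main.v *)
Require Import Defs.
From mathcomp Require Import all_boot zify.
Set Implicit Arguments. Unset Strict Implicit. Unset Printing Implicit Defensive.

(* Strong induction on the number n of vertices, on the dichotomy: phi is strictly below
   the bound f n, or the graph is one of the listed unions.

   If S is a union of components of a maximal dissociation set F of G, then F minus S is a
   maximal dissociation set of G - N[S]; so every list of patterns S, one of which occurs in
   each F, gives phi(G) <= sum over S of f(n - |N[S]|).  If G splits into two parts without
   edges between them, phi is multiplicative and f a * f b <= f(a + b), with equality exactly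
   for the residues that occur in the extremal graphs; hence proper unions of components are
   settled by induction.  Otherwise, let v have maximum degree d.
   - If d >= 4, use phi(G) <= phi(G - v) + #{F containing v}.  A set F in which v is isolated
     contains an outer neighbour of every neighbour of v, so there is none when some
     neighbour w has N[w] included in N[v].  For d = 4 this settles everything but the cases
     where the neighbours of v have few outer neighbours: a cut vertex, a graph G - v
     that would have to be extremal, and configurations close to the octahedron.
   - If d <= 3, take the patterns meeting the closed neighbourhood of a vertex of degree at
     most 2, or, in a cubic graph, of a vertex in a diamond, in a triangle, or in neither. *)

(** The critical residues are n = 1 and n = 2 modulo 5, where fb n is only 3/2 of fb (n - 1). If v
    has degree four and each neighbour has one outer neighbour, branching at v yields fb (n - 1) +
    fb (n - 5) + 4 fb (n - 6), which is 310 against fb 6 = 300 and 465 against fb 7 = 450. The loss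
    is recovered from the sets in which v is isolated: they must contain outer neighbours of the
    neighbours of v, and sets with one or two prescribed vertices are counted separately. Near the
    extremal graphs a count can only reproduce the bound; there the second alternative of the
    induction hypothesis is used, which gives the exact structure of a graph with one vertex less.
    Extending the bound below eight vertices lets the induction start at the empty graph: on 1, 2, 3
    or 7 vertices no listed union exists, and the strict inequality is what is proved. The factor 20
    clears the denominators 2, 4 and 5 of the extended values. All graphs are vertex subsets of one
    fixed graph, so deleting vertices changes no type. *)

(* 20 times the bound of the theorem, extended by the same formula to n < 8, where it takes
   the values 1, 3/2, 9/4, 18/5, 6, 10, 15, 45/2 for n = 0, ..., 7. *)
Definition fb (n : nat) : nat :=
  nth 0 [:: 20; 30; 45; 72; 120] (n %% 5) * 10 ^ (n %/ 5).

(** * Arithmetic of the bound *)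

Lemma fb_shift t k : fb (t * 5 + k) = fb k * 10 ^ t.
Proof. by rewrite /fb modnMDl divnMDl // expnD mulnAC mulnA. Qed.

Lemma fb_gt0 n : 0 < fb n.
Proof.
rewrite /fb muln_gt0 expn_gt0 /= andbT.
by have := ltn_pmod n (isT : 0 < 5); case: (n %% 5) => [|[|[|[|[|]]]]].
Qed.

Lemma residue5 m : exists t r, r < 5 /\ m = t * 5 + r.
Proof. by exists (m %/ 5), (m %% 5); rewrite ltn_pmod // -divn_eq. Qed.

Lemma fb_add5 k : fb (k + 5) = 10 * fb k.
Proof. by rewrite addnC (fb_shift 1 k) expn1 mulnC. Qed.

Lemma fbE : (fb 0 = 20) * (fb 1 = 30) * (fb 2 = 45) * (fb 3 = 72) *
  (fb 4 = 120) * (fb 5 = 200) * (fb 6 = 300) * (fb 7 = 450) * (fb 8 = 720) *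
  (fb 9 = 10 * 120) * (fb 10 = 10 * 200) * (fb 11 = 10 * 300).
Proof.
by do ![split]; rewrite // -1?(fb_add5 4) -1?(fb_add5 5) -1?(fb_add5 6).
Qed.

(* Reduces an inequality between values fb (m + k), for concrete k, to the five residues of m. *)
Ltac fb_arith m :=
  let t := fresh "t" in let r := fresh "r" in
  let w := fresh "w" in let w0 := fresh "w0" in
  destruct (residue5 m) as [t [r [? ->]]];
  assert (w0 := expn_gt0 10 t); change (is_true (0 < 10 ^ t)) in w0;
  destruct r as [|[|[|[|[|r]]]]]; [ | | | | | by []];
  rewrite -?addnA ?fb_shift;
  set w := 10 ^ t in w0 *; clearbody w;
  rewrite ?addSn ?add0n !fbE; lia.

(** The ratios of consecutive values are 3/2, 3/2, 8/5, 5/3, 5/3, periodically; the least one occurs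
    at the steps to the residues 1 and 2. *)
Lemma fb_leS m : 3 * fb m <= 2 * fb (m + 1).
Proof.  fb_arith m. Qed.

Lemma fb_leq m n : m <= n -> fb m <= fb n.
Proof.
move=> /subnK <-; elim: (n - m) => // k IH; apply: leq_trans IH _.
by have := fb_leS (k + m); rewrite addSn addn1; lia.
Qed.

Lemma fb_mulr k m : 1 < k -> k.+1 * fb m <= k * fb m.+1.
Proof. move=> k1; have := fb_leS m; rewrite addn1 => h.
have : k * (3 * fb m) <= k * (2 * fb m.+1) by rewrite leq_mul2l h orbT.
have : 2 * fb m <= k * fb m by rewrite leq_mul2r k1 orbT.
lia. Qed.

(** Since (k + 1) / k is at most 3/2 for k at least 2, the product k * fb (n - k) does not grow with
    k. Hence the estimate (d + 1) * fb (n - d - 1) for a vertex of degree d is worst at the smallest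
    d under consideration. *)
Lemma fb_mul_sub j k n : 1 < j <= k -> k <= n -> k * fb (n - k) <= j * fb (n - j).
Proof.
move=> /andP[j1 /subnK <-]; elim: (k - j) => // i IH le_n.
apply: leq_trans (IH _); last by apply: ltnW.
have -> : n - (i + j) = (n - (i.+1 + j)).+1 by lia.
rewrite addSn; apply: fb_mulr; lia.
Qed.

(** The exponents of [phi_bound] are truncated subtractions. At n = 7 the formula would read 225 *
    10 ^ 0 instead of 45 / 2; from n = 8 on the exponents are genuine. *)
Lemma fb_phi_bound n : 8 <= n -> fb n = 20 * phi_bound (n %/ 5) (n %% 5).
Proof.
move=> n8; have [t [r [r5 En]]] := residue5 n; rewrite En in n8 *.
rewrite divnMDl // modnMDl (divn_small r5) (modn_small r5) addn0 fb_shift.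
have E k : 10 ^ (k + 1) = 10 * 10 ^ k by rewrite addn1 expnS.
have E2 k : 10 ^ (k + 2) = 100 * 10 ^ k by rewrite addn2 !expnS mulnA.
case: r r5 n8 {En} => [|[|[|[|[|r]]]]] // _ n8; rewrite fbE /phi_bound.
- have [k ->] : exists k, t = k + 1 by exists (t - 1); lia.
  by rewrite addnK E; lia.
- have [k ->] : exists k, t = k + 2 by exists (t - 2); lia.
  by rewrite addnK E2; lia.
- have [k ->] : exists k, t = k + 1 by exists (t - 1); lia.
  by rewrite addnK E; lia.
- by rewrite mulnA.
Qed.

Lemma card_cover_seq (X : finType) (I : eqType) (A : {set X}) (L : seq I) (P : I -> pred X) :
  (forall x, x \in A -> has (P^~ x) L) -> #|A| <= \sum_(i <- L) #|[set x in A | P i x]|.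
Proof.
elim: L A => [|i L IH] A cov.
  by rewrite big_nil leqn0 cards_eq0; apply/set0Pn => -[x /cov].
rewrite big_cons -(cardsID [set x | P i x] A) leq_add //.
  by apply: subset_leq_card; apply/subsetP => x; rewrite !inE.
apply: leq_trans (IH _ _) _.
  by move=> x; rewrite !inE => /andP[nPi /cov]; rewrite /= (negPf nPi).
apply: leq_sum => l _; apply: subset_leq_card; apply/subsetP => x; rewrite !inE.
by case/andP=> /andP[_ ->] ->.
Qed.

Section MaximalDissociationSets.

Variables (T : finType) (e : rel T).
Hypotheses (e_sym : symmetric e) (e_irr : irreflexive e).
Implicit Types (A B C S Q F G H : {set T}) (x y z v w : T) (s : seq T).
Implicit Type P : {set {set T}}.

(** * Maximal dissociation sets of induced subgraphs *)

(* The lock keeps [inE] from unfolding membership in [Max A]. *)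
Definition Max A := locked [set F | maxset (fun X => (X \subset A) && dissociation e X) F].
Definition phiS A := #|Max A|.
Definition nb A x := [set y in A | e x y].
Definition clnb A S := [set y in A | (y \in S) || [exists x in S, e x y]].
(* S is a union of connected components of the subgraph induced on F. *)
Definition part F S := (S \subset F) && [forall x in S, forall y in F, e x y ==> (y \in S)].
Definition cnt A Q := #|[set F in Max A | Q \subset F]|.

Lemma dissP F :
  reflect (forall x y z, x \in F -> y \in F -> z \in F -> e x y -> e x z -> y = z)
          (dissociation e F).
Proof.
apply: (iffP forall_inP) => [dF x y z xF yF zF exy exz | dF x xF].
  by apply: (card_le1_eqP (dF x xF)); rewrite inE ?yF ?zF.
apply/card_le1_eqP => y z; rewrite !inE => /andP[yF exy] /andP[zF exz]; exact: (dF x).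
Qed.

Lemma diss_sub F F' : F \subset F' -> dissociation e F' -> dissociation e F.
Proof. by move/subsetP=> s /dissP d; apply/dissP => x y z /s ? /s ? /s ?; apply: d. Qed.

Lemma MaxE A F :
  (F \in Max A) = maxset (fun X => (X \subset A) && dissociation e X) F.
Proof. by rewrite /Max -lock inE. Qed.

Lemma MaxP A F :
  reflect [/\ F \subset A, dissociation e F &
              forall x, x \in A -> x \notin F -> ~~ dissociation e (x |: F)]
          (F \in Max A).
Proof.
rewrite MaxE; apply: (iffP maxsetP) => [[/andP[sFA dF] mF] | [sFA dF mF]].
  split=> // x xA; apply: contra => d.
  suff <- : x |: F = F by rewrite setU11.
  by apply: mF; rewrite ?subsetUr // d subUset sub1set xA sFA.
split=> [|F' /andP[sF'A dF'] sFF']; first by rewrite sFA.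
apply/eqP; rewrite eqEsubset sFF' andbT; apply/subsetP => x xF'.
apply: contraLR (dF') => xF; apply: contra (mF x (subsetP sF'A _ xF') xF).
by apply: diss_sub; rewrite subUset sub1set xF'.
Qed.

Lemma ndissU1 F x : dissociation e F -> x \notin F -> ~~ dissociation e (x |: F) ->
  (exists y z, [/\ y \in F, z \in F, y != z, e x y & e x z]) \/
  (exists y z, [/\ y \in F, z \in F, e x y & e y z]).
Proof.
move=> /dissP dF xF nd.
case: (boolP [exists y in F, exists z in F, [&& y != z, e x y & e x z]]) => [|n1].
  by case/exists_inP=> y yF /exists_inP[z zF /and3P[]]; left; exists y, z.
case: (boolP [exists y in F, exists z in F, e x y && e y z]) => [|n2].
  by case/exists_inP=> y yF /exists_inP[z zF /andP[]]; right; exists y, z.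
case/negP: nd; apply/dissP => a b c; rewrite !inE.
have h1 y z : y \in F -> z \in F -> e x y -> e x z -> y = z.
  move=> yF zF exy exz; apply/eqP; apply: contraR n1 => ne.
  by apply/exists_inP; exists y => //; apply/exists_inP; exists z; rewrite ?ne ?exy.
have h2 y z : y \in F -> z \in F -> e x y -> e y z -> False.
  move=> yF zF exy eyz; case/negP: n2.
  by apply/exists_inP; exists y => //; apply/exists_inP; exists z; rewrite ?exy.
case/predU1P=> [->|aF]; case/predU1P=> [->|bF]; case/predU1P=> [->|cF];
  rewrite ?e_irr //; [exact: h1|move=> eax eac|move=> eab eax|exact: dF].
- by case: (h2 a c) => //; rewrite e_sym.
- by case: (h2 a b) => //; rewrite e_sym.
Qed.

Lemma partP F S :
  reflect (S \subset F /\ forall x y, x \in S -> y \in F -> e x y -> y \in S) (part F S).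
Proof.
apply: (iffP andP) => -[sSF h]; split=> //.
  by move=> x y xS yF; apply/implyP; have /forall_inP/(_ y yF) := forall_inP h x xS.
by apply/forall_inP=> x xS; apply/forall_inP=> y yF; apply/implyP; apply: h.
Qed.

Lemma clnbP A S y :
  reflect (y \in A /\ (y \in S \/ exists2 x, x \in S & e x y)) (y \in clnb A S).
Proof.
rewrite inE; apply: (iffP andP) => -[yA].
  by case/orP=> [|/exists_inP[x]]; split=> //; [left|right; exists x].
by case=> [->|[x xS exy]] //; split=> //; apply/orP; right; apply/exists_inP; exists x.
Qed.

(* The injection is F |-> F :\: S. *)
Lemma part_count A S Q :
  #|[set F in Max A | part F S && (Q \subset F)]| <= cnt (A :\: clnb A S) (Q :\: S).
Proof.
rewrite -(card_in_imset (f := fun F => F :\: S)); last first.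
  move=> F F'; rewrite !inE => /and3P[_ /partP[sF _] _] /and3P[_ /partP[sF' _] _] E.
  by rewrite -(setID F S) -(setID F' S) E (setIidPr sF) (setIidPr sF').
apply: subset_leq_card; apply/subsetP => _ /imsetP[F /[!inE] /and3P[/MaxP[sFA dF mF] pF sQ] ->].
rewrite setSD // andbT; have /partP[sSF clS] := pF.
apply/MaxP; split.
- apply/subsetP => y /setDP[yF yS]; rewrite inE (subsetP sFA) // andbT.
  by apply/clnbP => -[_ [|[x xS exy]]]; [apply/negP|case/negP: yS; apply: clS exy].
- by apply: diss_sub dF; apply: subsetDl.
(* Maximality: x has no neighbour in [S] and [S] has none in [F :\: S], so if x could be added to
   [F :\: S] it could also be added to [F]. *)
move=> x /setDP[xA xN] xFS.
have xS : x \notin S by apply: contra xN => xS; apply/clnbP; split=> //; left.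
have nxS y : y \in S -> ~~ e x y.
  by move=> yS; apply: contra xN => exy; apply/clnbP; split=> //; right; exists y; rewrite // e_sym.
have xF : x \notin F by apply: contra xFS => xF; rewrite inE xS.
apply: contra (mF x xA xF) => /dissP d; move/dissP: dF => dF.
have inD y : y \in F -> y \notin S -> y \in x |: F :\: S by rewrite !inE => -> ->; rewrite orbT.
have clS' a b : a \in F -> b \in S -> e a b -> a \in S.
  by move=> aF bS eab; apply: (clS b) => //; rewrite e_sym.
apply/dissP => a b c; rewrite 3!in_setU1.
have out y : y == x -> (y \in x |: F :\: S) by move/eqP->; rewrite setU11.
have [aS|aS] := boolP (a \in S).
  have aF := subsetP sSF _ aS; rewrite aF orbT => _.
  have nx y : e a y -> (y == x) = false.
    by move=> eay; apply/eqP => E; have := nxS _ aS; rewrite -E e_sym eay.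
  by move=> bF cF eab eac; move: bF cF; rewrite !nx //=; move=> ? ?; apply: dF eac.
move=> ha; have aD : a \in x |: F :\: S by case/orP: ha => [/out|/inD->].
have nS y : e a y -> y \notin S.
  move=> eay; apply/negP => yS; case/orP: ha => [/eqP E|aF].
    by have := nxS _ yS; rewrite -E eay.
  by rewrite (clS' a y) in aS.
have inU y : e a y -> (y == x) || (y \in F) -> y \in x |: F :\: S.
  by move=> eay /orP[/out //|yF]; apply: inD (nS _ eay).
by move=> hb hc eab eac; apply: (d a) => //; apply: inU.
Qed.

Lemma cnt_le A Q : cnt A Q <= phiS A.
Proof. by apply: subset_leq_card; apply/subsetP => F; rewrite !inE => /andP[]. Qed.

Lemma cnt_leS A Q Q' : Q' \subset Q -> cnt A Q <= cnt A Q'.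
Proof.
move=> s; apply: subset_leq_card; apply/subsetP => F; rewrite !inE => /andP[->] /=.
exact: subset_trans.
Qed.

Lemma part_phi A S : #|[set F in Max A | part F S]| <= phiS (A :\: clnb A S).
Proof.
apply: leq_trans (cnt_le _ (set0 :\: S)); apply: leq_trans (part_count _ _ _).
by apply: subset_leq_card; apply/subsetP => F; rewrite !inE sub0set andbT.
Qed.

Lemma cover_seq A (L : seq {set T}) :
  (forall F, F \in Max A -> has (part F) L) ->
  phiS A <= \sum_(S <- L) phiS (A :\: clnb A S).
Proof.
move=> cov; apply: leq_trans (card_cover_seq (P := fun S F => part F S) cov) _.
by apply: leq_sum => S _; apply: part_phi.
Qed.

Lemma phiS_diss A : dissociation e A -> phiS A = 1.
Proof.
move=> dA; apply/eqP/cards1P; exists A; apply/setP => F; rewrite in_set1.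
apply/MaxP/eqP => [[sFA dF mF]|->]; last by split=> // x ->.
apply/eqP; rewrite eqEsubset sFA; apply/subsetP => x xA.
apply: contraT => xF; case/negP: (mF x xA xF).
by apply: diss_sub dA; rewrite subUset sub1set xA.
Qed.

Lemma diss_le2 A : #|A| <= 2 -> dissociation e A.
Proof.
move=> A2; apply/forall_inP => x xA; apply: leq_trans (_ : #|A :\ x| <= 1).
  apply: subset_leq_card; apply/subsetP => y; rewrite !inE => /andP[-> exy].
  by rewrite andbT; apply: contraTneq exy => ->; rewrite e_irr.
by move: (cardsD1 x A); rewrite xA; lia.
Qed.

Lemma phiS_le2 A : #|A| <= 2 -> phiS A = 1.
Proof. by move/diss_le2/phiS_diss. Qed.

Lemma Max_ex A F : F \subset A -> dissociation e F -> exists2 F', F' \in Max A & F \subset F'.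
Proof.
move=> sFA dF.
case: (@maxset_exists _ (fun X => (X \subset A) && dissociation e X) F) => [|F' mF' sFF'].
  by rewrite sFA.
by exists F'; rewrite // MaxE.
Qed.

Definition separated B C := forall x y, x \in B -> y \in C -> ~~ e x y.

(** The maximal sets of the union are the unions of a maximal set of each side; intersecting with
    [B] and [C] recovers the pair. *)
Lemma phiS_mul B C : [disjoint B & C] -> separated B C -> phiS (B :|: C) = phiS B * phiS C.
Proof.
move=> dis sep; rewrite /phiS -cardsX.
have disD x : x \in C -> x \notin B.
  by move=> xC; apply/negP => xB; have /pred0P/(_ x)/= := dis; rewrite xB xC.
have split_diss F G : F \subset B -> G \subset C -> dissociation e F -> dissociation e G ->
    dissociation e (F :|: G).
  move=> /subsetP sF /subsetP sG /dissP dF /dissP dG.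
  have nFG x y : x \in F -> y \in G -> e x y = false.
    by move=> /sF xB /sG yC; apply/negbTE/sep.
  have nGF x y : x \in F -> y \in G -> e y x = false by rewrite e_sym; apply: nFG.
  apply/dissP => x y z; rewrite !inE.
  by case/orP=> hx /orP[]hy /orP[]hz; rewrite ?(nFG _ _ hx hy) ?(nFG _ _ hx hz)
    ?(nGF _ _ hy hx) ?(nGF _ _ hz hx) //; [apply: dF|apply: dG].
have UIl F G : F \subset B -> G \subset C -> (F :|: G) :&: B = F.
  move=> sF sG; rewrite setIUl (setIidPl sF).
  suff /setP-> : G :&: B =i set0 by rewrite setU0.
  by move=> x; rewrite !inE; apply/andP => -[/(subsetP sG)/disD/negP].
have UIr F G : F \subset B -> G \subset C -> (F :|: G) :&: C = G.
  move=> sF sG; rewrite setIUl (setIidPl sG).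
  suff /setP-> : F :&: C =i set0 by rewrite set0U.
  move=> x; rewrite !inE; apply/andP => -[xF xC].
  by have := disD x xC; rewrite (subsetP sF).
rewrite -(card_in_imset (f := fun p : {set T} * {set T} => p.1 :|: p.2)); last first.
  move=> [F G] [F' G'] /setXP[/MaxP[sF _ _] /MaxP[sG _ _]] /setXP[/MaxP[sF' _ _] /MaxP[sG' _ _]] /= E.
  have := congr1 (fun X => (X :&: B, X :&: C)) E.
  by rewrite /= !UIl ?UIr.
apply: eq_card => F; apply/idP/imsetP => [/MaxP[sF dF mF]|[[G H] /setXP[/= GM HM] ->]].
  have EF : F = F :&: B :|: F :&: C by rewrite -setIUr (setIidPl sF).
  exists (F :&: B, F :&: C) => //; apply/setXP; split; apply/MaxP; split.
  1,4: exact: subsetIr.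
  1,3: by apply: diss_sub dF; apply: subsetIl.
  - move=> x xB; rewrite !inE xB andbT => xF.
    have xA : x \in B :|: C by rewrite inE xB.
    apply: contra (mF x xA xF) => d; rewrite EF setUA.
    apply: split_diss => //; rewrite ?subsetIr ?subUset ?sub1set ?xB ?subsetIr //.
    by apply: diss_sub dF; apply: subsetIl.
  - move=> x xC; rewrite !inE xC andbT => xF.
    have xA : x \in B :|: C by rewrite inE xC orbT.
    apply: contra (mF x xA xF) => d; rewrite EF setUCA.
    apply: split_diss => //; rewrite ?subsetIr ?subUset ?sub1set ?xC ?subsetIr //.
    by apply: diss_sub dF; apply: subsetIl.
case/MaxP: GM => sG dG mG; case/MaxP: HM => sH dH mH.
apply/MaxP; split; [exact: setUSS|exact: split_diss|].
move=> x; rewrite !inE negb_or => /orP[xB|xC] /andP[xG xH].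
  by apply: contra (mG x xB xG); apply: diss_sub; apply: setUS; apply: subsetUl.
by apply: contra (mH x xC xH); apply: diss_sub; apply: setUS; apply: subsetUr.
Qed.

(* If v is not in F then F blocks it: some neighbour of v has a partner z in F, or two
   neighbours of v are isolated in F. *)
Lemma wood A v F : F \in Max A -> v \in A ->
  [\/ part F [set v] /\ (forall w, w \in nb A v -> exists2 x, x \in F & (x != v) && e w x),
      exists2 w, w \in nb A v & part F [set v; w],
      v \notin F /\ exists w z, [/\ w \in nb A v, z \in nb A w, z != v & part F [set w; z]] |
      v \notin F /\ exists w w', [/\ w \in nb A v, w' \in nb A v, w != w', ~~ e w w' & part F [set w; w']]].
Proof.
move=> /MaxP[sFA /[dup] dF /dissP dF' mF] vA.
have pairP a b : a \in F -> b \in F -> e a b -> part F [set a; b].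
  move=> aF bF eab; apply/partP; split; first by rewrite subUset !sub1set aF bF.
  move=> x y /set2P[]-> yF exy; rewrite !inE.
    by rewrite (dF' a y b) ?eqxx ?orbT.
  by rewrite (dF' b y a) ?eqxx // e_sym.
have [vF|vF] := boolP (v \in F).
  have [/exists_inP[w wF evw]|n] := boolP [exists w in F, e v w].
    by constructor 2; exists w; [rewrite inE evw (subsetP sFA)|apply: pairP].
  have iso y : y \in F -> ~~ e v y by move=> yF; apply: contra n => evy; apply/exists_inP; exists y.
  constructor 1; split.
    apply/partP; rewrite sub1set; split=> // x y /set1P-> yF.
    by rewrite (negPf (iso _ yF)).
  move=> w; rewrite inE => /andP[wA evw].
  have wF : w \notin F by apply: contraTN evw => /iso.
  (* Since w cannot be added to F, it has two neighbours in F, one of them not v, or a neighbour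
     with a partner in F, which is not v because v is isolated. *)
  have [[y [z [yF zF ne ewy ewz]]]|[y [z [yF zF ewy eyz]]]] := ndissU1 dF wF (mF w wA wF).
    have [E|nv] := eqVneq y v; last by exists y; rewrite // nv.
    by exists z; rewrite // ewz -E eq_sym ne.
  exists y; rewrite // ewy andbT; apply/eqP => E.
  by have := iso z zF; rewrite -E eyz.
have vz z : z \in F -> z != v by move=> zF; apply: contraNneq vF => <-.
have [/existsP[w /existsP[z /and4P[wF zF evw ewz]]]|n] :=
    boolP [exists w, exists z, [&& w \in F, z \in F, e v w & e w z]].
  constructor 3; split=> //; exists w, z; split; rewrite ?inE ?evw ?ewz ?(subsetP sFA) ?vz //.
  exact: pairP.
have iso w z : w \in F -> z \in F -> e v w -> e w z -> False.
  by move=> *; case/negP: n; apply/existsP; exists w; apply/existsP; exists z; apply/and4P.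
have [[y [z [yF zF ne evy evz]]]|[y [z [yF zF evy eyz]]]] := ndissU1 dF vF (mF v vA vF); last first.
  by case: (iso y z).
constructor 4; split=> //; exists y, z; split; rewrite ?inE ?evy ?evz ?(subsetP sFA) //.
  by apply/negP => /(iso _ _ yF zF evy).
apply/partP; rewrite subUset !sub1set yF zF; split=> // a b /set2P[]-> bF.
  by move/(iso _ _ yF bF evy).
by move/(iso _ _ zF bF evz).
Qed.

(** * Unions of K4*, K5* and K6* *)

Lemma nb_nonnb B x : x \in B -> #|[set y in B | (y != x) && ~~ e x y]| + (#|nb B x|).+1 = #|B|.
Proof.
move=> xB; rewrite (cardsD1 x B) xB -(cardsID (nb B x) (B :\ x)) add1n addnS addnC; congr (_ + _).+1.
  by apply: eq_card => y; rewrite !inE; case: eqP => [->|]; rewrite ?e_irr ?andbF //= andbA andbb.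
by apply: eq_card => y; rewrite !inE; case: (y \in B); case: (y == x); case: (e x y).
Qed.

(** Deleting a matching means that the complement on [B] has maximum degree at most one, that is,
    each vertex misses at most one other. *)
Lemma KstarP B : is_Kstar_on e B <-> (forall x, x \in B -> #|B| <= #|nb B x| + 2).
Proof.
split=> [[M [MB Ms Mu eM]] x xB|h].
  rewrite -(nb_nonnb xB); suff : #|[set y in B | (y != x) && ~~ e x y]| <= 1 by lia.
  apply/card_le1_eqP => y z; rewrite !inE.
  move=> /and3P[yB xy exy] /and3P[zB xz exz]; apply: (Mu x z y).
  by move: exz; rewrite eM // eq_sym xz /= negbK.
    by move: exy; rewrite eM // eq_sym xy /= negbK.
exists (fun x y => [&& x \in B, y \in B, x != y & ~~ e x y]); split.
- by move=> x y /and4P[-> -> ->].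
- by move=> x y /and4P[-> -> ne n]; rewrite eq_sym ne e_sym n.
- move=> x y z /and4P[xB yB xy exy] /and4P[_ zB xz exz].
  have : #|[set y in B | (y != x) && ~~ e x y]| <= 1 by have := nb_nonnb xB; have := h x xB; lia.
  by move/card_le1_eqP; apply; rewrite !inE ?yB ?zB eq_sym ?xy ?xz.
- move=> x y xB yB; rewrite xB yB /=; case: eqP => [->|_]; rewrite ?e_irr //=.
  by rewrite negbK.
Qed.

(** Suppose F has three vertices and take x in F. It misses at most one vertex of B and is adjacent
    to at most one vertex of F, so it has in F a neighbour y and a non-neighbour z. If z and y are
    adjacent, then y has two neighbours in F; otherwise z misses both x and y. *)
Lemma Kstar_diss B F : (forall x, x \in B -> #|B| <= #|nb B x| + 2) ->
  F \subset B -> dissociation e F -> #|F| <= 2.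
Proof.
move=> h /subsetP sFB dF; rewrite leqNgt; apply/negP => F3.
have [x xF] : exists x, x \in F by apply/card_gt0P; lia.
have Fx := cardsD1 x F; rewrite xF in Fx.
have K1 z : z \in F -> #|[set y in B | (y != z) && ~~ e z y]| <= 1.
  by move=> /sFB zB; have := nb_nonnb zB; have := h z zB; lia.
have [y yF exy] : exists2 y, y \in F & e x y.
  case: (boolP [exists y in F, e x y]) => [/exists_inP//|/exists_inPn n]; exfalso.
  suff : #|F :\ x| <= 1 by lia.
  apply: leq_trans (K1 x xF); apply: subset_leq_card; apply/subsetP => y.
  by rewrite !inE => /andP[-> yF]; rewrite sFB // n.
have [z zF /andP[zx exz]] : exists2 z, z \in F & (z != x) && ~~ e x z.
  case: (boolP [exists z in F, (z != x) && ~~ e x z]) => [/exists_inP//|/exists_inPn n]; exfalso.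
  suff : #|F :\ x| <= 1 by lia.
  apply: leq_trans (forall_inP dF x xF); apply: subset_leq_card; apply/subsetP => z.
  by rewrite !inE => /andP[zx zF]; have := n z zF; rewrite zF zx /= negbK.
have [ezy|nzy] := boolP (e z y).
  by case/eqP: zx; apply: (dissP F dF y); rewrite // e_sym.
have /card_le1_eqP E := K1 z zF.
have xy : y = x.
  apply: E; rewrite !inE ?sFB //= ?(eq_sym x) ?zx ?(e_sym z) ?exz ?andbT //.
  by rewrite e_sym nzy andbT; apply: contraNneq exz => <-.
by rewrite xy e_irr in exy.
Qed.

(** Pairs are always dissociation sets and nothing larger is one here, so the maximal sets are the
    pairs: 6, 10 and 15 of them for the orders 4, 5 and 6. *)
Lemma phiS_Kstar B : 1 < #|B| -> is_Kstar_on e B -> phiS B = 'C(#|B|, 2).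
Proof.
move=> B2 /KstarP h; rewrite -cards_draws; apply: eq_card => F; rewrite inE.
apply/MaxP/andP => [[sF dF mF]|[sF /eqP F2]].
  split=> //; rewrite eqn_leq (Kstar_diss h) //= leqNgt; apply/negP => F1.
  have [x xB xF] : exists2 x, x \in B & x \notin F.
    by apply/subsetPn; apply/negP => /subset_leq_card; lia.
  by have /negP := mF x xB xF; apply; apply: diss_le2; rewrite // cardsU1 xF; lia.
split=> //; first by apply: diss_le2; rewrite ?F2.
move=> x xB xF; apply/negP => /(Kstar_diss h).
by rewrite subUset sub1set xB sF cardsU1 xF F2 => /(_ isT).
Qed.

(* A is a disjoint union of a copies of K4*, b copies of K6* and any number of K5*. *)
Definition kparts A a b : Prop := exists P,
  [/\ partition P A,
      (forall B1 B2 x y, B1 \in P -> B2 \in P -> x \in B1 -> y \in B2 -> e x y -> B1 = B2),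
      (forall B, B \in P -> is_Kstar_on e B /\ (#|B| \in [:: 4; 5; 6])),
      nblocks P 4 = a & nblocks P 6 = b].

Lemma nblocksD1 P B k : B \in P -> nblocks P k = (#|B| == k) + nblocks (P :\ B) k.
Proof.
move=> BP; rewrite /nblocks (cardsD1 B) inE BP; congr (_ + _).
by apply: eq_card => C; rewrite !inE andbA.
Qed.

(** One block is split off at a time; [c] counts the K5* blocks. *)
Lemma kparts_count A a b : kparts A a b ->
  exists c, #|A| = 4 * a + 5 * c + 6 * b /\ phiS A = 6 ^ a * 10 ^ c * 15 ^ b.
Proof.
case=> P; move: {2}#|P| (erefl #|P|) => n; elim: n P A a b => [|n IH] P A a b Pn [pP cr ks <- <-].
  move/eqP: Pn; rewrite cards_eq0 => /eqP P0; exists 0.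
  have A0 : A = set0 by rewrite -(cover_partition pP) P0 /cover big_set0.
  have nb0 k : nblocks P k = 0.
    by apply/eqP; rewrite cards_eq0 -subset0; apply/subsetP => B; rewrite !inE P0 inE.
  by rewrite !nb0 A0 phiS_le2 ?cards0.
have [B BP] : exists B, B \in P by apply/card_gt0P; rewrite Pn.
have sBA : B \subset A by rewrite -(cover_partition pP); apply: bigcup_sup.
have [KB sz] := ks B BP.
have sep : separated B (A :\: B).
  move=> x y xB /setDP[yA yB]; apply/negP => exy; case/negP: yB.
  have yc : y \in cover P by rewrite (cover_partition pP).
  have yp : y \in pblock P y by rewrite mem_pblock.
  by rewrite (cr B (pblock P y) x y) ?pblock_mem.
have EA : A = B :|: (A :\: B) by rewrite -{1}(setID A B) (setIidPr sBA).
have dis : [disjoint B & A :\: B] by rewrite disjoint_sym disjoints_subset setDE subsetIr.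
have := IH (P :\ B) (A :\: B) (nblocks (P :\ B) 4) (nblocks (P :\ B) 6).
case.
- by move: Pn; rewrite (cardsD1 B) BP => -[].
- split=> //; first exact: partitionD1.
  + by move=> B1 B2 x y /setD1P[_ B1P] /setD1P[_ B2P]; apply: cr.
  + by move=> C /setD1P[_ /ks].
move=> c [c1 c2]; rewrite (nblocksD1 4 BP) (nblocksD1 6 BP).
have sA := cardsD A B; rewrite (setIidPr sBA) in sA; have sBA' := subset_leq_card sBA.
have := phiS_mul dis sep; rewrite -EA => ->; rewrite c2.
have -> : #|A| = #|B| + #|A :\: B| by lia.
rewrite c1 phiS_Kstar //; last by move: sz; rewrite !inE; lia.
set a' := nblocks _ 4; set b' := nblocks _ 6.
move: sz; rewrite !inE => /or3P[]/eqP->; [exists c|exists c.+1|exists c];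
  (split; [lia|rewrite /= ?add0n ?add1n ?expnS !binE /=; lia]).
Qed.

Lemma kparts0 : kparts set0 0 0.
Proof.
exists set0; split; rewrite ?partition_set0 ?eqxx //; try by move=> *; rewrite inE in H.
- by move=> B1 B2 x y; rewrite inE.
- by move=> B; rewrite inE.
1,2: by apply/eqP; rewrite cards_eq0 -subset0; apply/subsetP => B; rewrite !inE.
Qed.

Lemma kparts1 B : is_Kstar_on e B -> #|B| \in [:: 4; 5; 6] -> kparts B (#|B| == 4) (#|B| == 6).
Proof.
move=> KB sz; exists [set B]; split.
- rewrite /partition /cover big_set1 eqxx trivIset1 inE /=.
  by apply: contraTneq sz => <-; rewrite cards0.
- by move=> B1 B2 x y /set1P-> /set1P->.
- by move=> C /set1P->.
all: rewrite (nblocksD1 _ (set11 B)) setDv -[RHS]addn0; congr (_ + _).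
all: by apply/eqP; rewrite cards_eq0 -subset0; apply/subsetP => C; rewrite !inE.
Qed.

Lemma kpartsU A B a b a' b' : [disjoint A & B] -> separated A B ->
  kparts A a b -> kparts B a' b' -> kparts (A :|: B) (a + a') (b + b').
Proof.
move=> dis sep [P [pP crP ksP <- <-]] [Q [pQ crQ ksQ <- <-]].
have sP C : C \in P -> C \subset A by move=> CP; rewrite -(cover_partition pP); apply: bigcup_sup.
have sQ C : C \in Q -> C \subset B by move=> CQ; rewrite -(cover_partition pQ); apply: bigcup_sup.
have dPQ C D : C \in P -> D \in Q -> [disjoint C & D].
  by move=> CP DQ; apply: disjointWl (sP C CP) _; apply: disjointWr (sQ D DQ) _.
have P0 : set0 \notin P by case/and3P: pP.
(* A block of both partitions would be disjoint from itself, hence empty. *)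
have disPQ : [disjoint P & Q].
  apply/pred0P => C /=; apply/negP => /andP[CP CQ].
  by have := dPQ C C CP CQ; rewrite -setI_eq0 setIid => /eqP E; rewrite -E CP in P0.
exists (P :|: Q); split.
- apply/and3P; split.
  + have := cover_partition pP; have := cover_partition pQ.
    by rewrite /cover bigcup_setU => -> ->.
  + apply/trivIsetP => C D; rewrite !inE.
    have /trivIsetP tP : trivIset P by case/and3P: pP.
    have /trivIsetP tQ : trivIset Q by case/and3P: pQ.
    case/orP=> hC; case/orP=> hD ne; [exact: tP|exact: dPQ| |exact: tQ].
    by rewrite disjoint_sym dPQ.
  + by rewrite inE negb_or P0; case/and3P: pQ.
- have cross C D x y : C \in P -> D \in Q -> x \in C -> y \in D -> e x y -> False.
    by move=> /sP/subsetP sC /sQ/subsetP sD /sC xA /sD yB; apply/negP/sep.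
  move=> C D x y; rewrite !inE => /orP[hC|hC] /orP[hD|hD] xC yD exy.
  + exact: crP exy.
  + by case: (cross C D x y).
  + by case: (cross D C y x) => //; rewrite e_sym.
  + exact: crQ exy.
- by move=> C; rewrite inE => /orP[/ksP|/ksQ].
all: rewrite /nblocks -cardsUI [X in _ + X](_ : _ = 0).
1,3: by rewrite addn0; apply: eq_card => C; rewrite !inE andb_orl.
all: apply/eqP; rewrite cards_eq0 -subset0; apply/subsetP => C; rewrite !inE.
all: by have /pred0P/(_ C)/= := disPQ; case: (C \in P); case: (C \in Q); rewrite ?andbF.
Qed.

(** For the orders 1, 2, 3 and 7 the prescribed blocks have more vertices than [A], so the predicate
    fails there. *)
Definition ext A : Prop :=
  match #|A| %% 5 with
  | 0 => kparts A 0 0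
  | 1 => kparts A 0 1
  | 2 => kparts A 0 2
  | 3 => kparts A 2 0
  | _ => kparts A 1 0
  end.

Lemma ext_eq A : ext A -> 20 * phiS A = fb #|A|.
Proof.
rewrite /ext; move: (ltn_pmod #|A| (isT : 0 < 5)).
(* Here [k] and [m] are the number of vertices and the value of [phi] of the blocks other than
   K5*. *)
have key c k m : #|A| = c * 5 + k -> phiS A = m * 10 ^ c -> fb k = 20 * m -> 20 * phiS A = fb #|A|.
  by move=> -> -> E; rewrite fb_shift E; lia.
case: (#|A| %% 5) => [|[|[|[|[|]]]]] // _ /kparts_count[c [E1 E2]].
- by apply: (key c 0 1); rewrite ?E2 ?fbE //; lia.
- by apply: (key c 6 15); rewrite ?E2 ?fbE //; lia.
- by apply: (key c 12 225); rewrite ?E2 ?(fb_shift 2 2) //; lia.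
- by apply: (key c 8 36); rewrite ?E2 ?fbE //; lia.
- by apply: (key c 4 6); rewrite ?E2 ?fbE //; lia.
Qed.

Definition bounded A : Prop := 20 * phiS A < fb #|A| \/ ext A.

Lemma bounded_le A : bounded A -> 20 * phiS A <= fb #|A|.
Proof. by case=> [/ltnW|/ext_eq->]. Qed.

Lemma fb_mul a b : fb a * fb b <= 20 * fb (a + b).
Proof.
have [t [r [r5 ->]]] := residue5 a; have [u [s [s5 ->]]] := residue5 b.
rewrite addnACA -mulnDl !fb_shift expnD.
have h : fb r * fb s <= 20 * fb (r + s).
  by do 5?[case: r r5 => [|r] //= r5]; do 5?[case: s s5 => [|s] //= s5]; rewrite !fbE.
by rewrite mulnACA [20 * _]mulnA leq_mul2r h orbT.
Qed.

Lemma bounded_split A C : C \subset A -> separated C (A :\: C) ->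
  bounded C -> bounded (A :\: C) -> bounded A.
Proof.
move=> sCA sep bC bD; have EA : A = C :|: (A :\: C) by rewrite -{1}(setID A C) (setIidPr sCA).
have dis : [disjoint C & A :\: C] by rewrite disjoint_sym disjoints_subset setDE subsetIr.
have sA : #|A| = #|C| + #|A :\: C|.
  by have := cardsD A C; rewrite (setIidPr sCA); have := subset_leq_card sCA; lia.
have EP : phiS A = phiS C * phiS (A :\: C) by rewrite -(phiS_mul dis sep) -EA.
have leC := bounded_le bC; have leD := bounded_le bD.
have mul := fb_mul #|C| #|A :\: C|; have g1 := fb_gt0 #|C|; have g2 := fb_gt0 #|A :\: C|.
have strict : 20 * phiS C * (20 * phiS (A :\: C)) < 20 * fb #|A| -> bounded A.
  by move=> h; left; rewrite EP; nia.
case: bC => [ltC|extC].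
  by apply: strict; rewrite sA; apply: leq_trans mul; apply: leq_ltn_trans (leq_mul (leqnn _) leD) _; rewrite ltn_pmul2r.
case: bD => [ltD|extD].
  by apply: strict; rewrite sA; apply: leq_trans mul; apply: leq_ltn_trans (leq_mul leC (leqnn _)) _; rewrite ltn_pmul2l.
have kU a b a' b' := @kpartsU C (A :\: C) a b a' b' dis sep; rewrite -EA in kU.
have := ext_eq extC; have := ext_eq extD => e1 e2.
have [t [r [r5 Er]]] := residue5 #|C|; have [u [s [s5 Es]]] := residue5 #|A :\: C|.
have ErA : #|A| = (t + u) * 5 + (r + s) by rewrite sA Er Es; lia.
have cmp : fb r * fb s < 20 * fb (r + s) -> bounded A.
  move=> h; apply: strict; rewrite e1 e2 sA Er Es addnACA -mulnDl !fb_shift expnD.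
  by rewrite mulnACA [20 * _]mulnA ltn_pmul2r ?muln_gt0 ?expn_gt0.
have conc : match (r + s) %% 5 with
    | 0 => kparts A 0 0 | 1 => kparts A 0 1 | 2 => kparts A 0 2
    | 3 => kparts A 2 0 | _ => kparts A 1 0 end -> bounded A.
  by move=> h; right; rewrite /ext ErA modnMDl.
move: extC extD; rewrite /ext Er Es !modnMDl.
(* Of the 25 pairs of residues, equality fb r * fb s = 20 * fb (r + s) occurs only if one of them is
   0 and for (1, 1) and (4, 4). In these cases joining the two extremal unions gives the extremal
   union of residue r + s. *)
case: r r5 {Er ErA} cmp conc => [|[|[|[|[|]]]]] // _;
  case: s s5 {Es} => [|[|[|[|[|]]]]] // _ cmp conc /= kC kD;
  solve [by apply: cmp; rewrite !fbE | apply: conc; exact: kU kC kD].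
Qed.

(** * Branching at a vertex *)

Definition below A := forall B, #|B| < #|A| -> bounded B.

Lemma below_le A B j : below A -> #|B| <= j -> j < #|A| -> 20 * phiS B <= fb j.
Proof.
move=> IH Bj jA; apply: leq_trans (fb_leq Bj); apply: bounded_le => //.
by apply: IH; apply: leq_ltn_trans jA.
Qed.

Lemma below_subset A H : below A -> H \subset A -> below H.
Proof. by move=> IH /subset_leq_card HA B BH; apply: IH; apply: leq_trans HA. Qed.

Lemma clnb_sub A S : clnb A S \subset A.
Proof. by apply/subsetP => x /clnbP[]. Qed.

Lemma card_Dclnb A S : #|A :\: clnb A S| = #|A| - #|clnb A S|.
Proof. by rewrite cardsD (setIidPr (clnb_sub A S)). Qed.

Lemma below_clnb A S k : below A -> 0 < k <= #|clnb A S| -> 20 * phiS (A :\: clnb A S) <= fb (#|A| - k).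
Proof.
move=> IH /andP[k0 kS]; have sA := subset_leq_card (clnb_sub A S).
by apply: (below_le IH); rewrite ?card_Dclnb; lia.
Qed.

Lemma cover_bound A (L : seq ({set T} * nat)) : below A ->
  (forall F, F \in Max A -> has (fun p => part F p.1) L) ->
  all (fun p => 0 < p.2 <= #|clnb A p.1|) L ->
  20 * phiS A <= \sum_(p <- L) fb (#|A| - p.2).
Proof.
move=> IH cov /allP h; have cov' F : F \in Max A -> has (part F) (map fst L).
  by move=> /cov; rewrite has_map.
apply: leq_trans (leq_mul (leqnn 20) (cover_seq cov')) _; rewrite big_map big_distrr /= big_seq [leqRHS]big_seq.
by apply: leq_sum => p pL; apply: (below_clnb IH (h p pL)).
Qed.

(** A maximal set that avoids v is still maximal after v is deleted. *)
Lemma phiS_branch A v : v \in A -> phiS A <= phiS (A :\ v) + cnt A [set v].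
Proof.
move=> vA; rewrite /phiS -(cardsID [set F : {set T} | v \in F] (Max A)) addnC leq_add //.
  apply: subset_leq_card; apply/subsetP => F /setDP[/MaxP[sF dF mF]]; rewrite inE => vF.
  apply/MaxP; split=> // [|x /setD1P[_ xA]]; last exact: mF.
  by rewrite subsetD1 sF.
by apply: subset_leq_card; apply/subsetP => F; rewrite !inE sub1set.
Qed.

Definition iso A v := #|[set F in Max A | part F [set v]]|.
Definition out A v w := #|nb A w :\: (v |: nb A v)|.

Lemma card_clnb1 A v : v \in A -> #|clnb A [set v]| = (#|nb A v|).+1.
Proof.
move=> vA; have -> : clnb A [set v] = v |: nb A v.
  apply/setP => x; rewrite !inE; apply/andP/idP => [[-> /orP[->//|]]|].
    by case/exists_inP=> y /set1P-> ->; rewrite orbT.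
  case/predU1P=> [->|/andP[-> evx]]; first by rewrite vA eqxx.
  by split=> //; apply/orP; right; apply/exists_inP; exists v; rewrite ?set11.
by rewrite cardsU1 inE e_irr andbF.
Qed.

Lemma clnb2E A v w x : (x \in clnb A [set v; w]) = (x \in A) && [|| x == v, x == w, e v x | e w x].
Proof.
rewrite !inE; congr (_ && _); rewrite -orbA; do 2!congr (_ || _).
apply/exists_inP/orP => [[y /set2P[]-> exy]|[evx|ewx]].
- by left.
- by right.
- by exists v; rewrite ?set21.
- by exists w; rewrite ?set22.
Qed.

Lemma card_clnb2 A v w : v \in A -> w \in nb A v -> #|clnb A [set v; w]| = (#|nb A v|).+1 + out A v w.
Proof.
move=> vA; rewrite inE => /andP[wA evw]; rewrite -(cardsID (v |: nb A v)); congr (_ + _).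
  rewrite (setIidPr _); first by rewrite cardsU1 inE e_irr andbF.
  apply/subsetP => x; rewrite clnb2E !inE => /predU1P[->|/andP[-> ->]]; rewrite ?vA ?eqxx ?orbT //.
rewrite /out; apply: eq_card => x; rewrite !in_setD clnb2E !inE.
have [->|_] /= := eqVneq x v; first by [].
case: (x \in A); rewrite //= ?andbF //.
have [->|_] /= := eqVneq x w; first by rewrite evw.
by case: (e v x).
Qed.

Lemma iso_le A v : iso A v <= phiS (A :\: clnb A [set v]).
Proof. exact: part_phi. Qed.

Lemma iso_forced A v w F : F \in Max A -> v \in A -> part F [set v] -> w \in nb A v ->
  exists2 x, x \in F & x \in nb A w :\: (v |: nb A v).
Proof.
move=> FM vA pF wN; have /partP[sF cF] := pF; have /MaxP[sFA dF _] := FM.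
have vF : v \in F by rewrite -sub1set.
have nv x : x \in F -> ~~ e v x.
  move=> xF; apply/negP => evx; have := cF v x (set11 v) xF evx.
  by rewrite inE => /eqP E; rewrite E e_irr in evx.
case: (wood FM vA) => [[_ /(_ w wN)[x xF /andP[xv ewx]]]|[w' w'N /partP[]]|[]|[]].
- exists x => //; rewrite !inE negb_or xv (negPf (nv x xF)) andbF ewx andbT.
  exact: (subsetP sFA).
- rewrite subUset !sub1set => /andP[_ w'F]; have := nv w' w'F.
  by move: w'N; rewrite inE => /andP[_ ->].
- by rewrite vF.
- by rewrite vF.
Qed.

Lemma iso0 A v w : v \in A -> w \in nb A v -> out A v w = 0 -> iso A v = 0.
Proof.
move=> vA wN /eqP; rewrite cards_eq0 => /eqP out0; apply/eqP; rewrite cards_eq0 -subset0.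
apply/subsetP => F; rewrite inE => /andP[FM pF].
by have [x _] := iso_forced FM vA pF wN; rewrite out0 inE.
Qed.

(** A vertex forced into every set with v isolated stays prescribed after N[v] is removed, which
    brings [cnt_mem1_lt] and [cnt_mem2_lt] into play. *)
Lemma iso_cnt A v Q : (forall F, F \in Max A -> part F [set v] -> Q \subset F) ->
  iso A v <= cnt (A :\: clnb A [set v]) (Q :\ v).
Proof.
move=> h; apply: leq_trans (part_count A [set v] Q); apply: subset_leq_card.
by apply/subsetP => F; rewrite !inE => /andP[FM pF]; rewrite FM pF h.
Qed.

Lemma cnt_sum A v : v \in A ->
  cnt A [set v] <= iso A v + \sum_(w in nb A v) phiS (A :\: clnb A [set v; w]).
Proof.
move=> vA; pose L := [set v] :: [seq [set v; w] | w <- enum (nb A v)].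
have := @card_cover_seq _ _ [set F in Max A | [set v] \subset F] L (fun S F => part F S).
rewrite /L big_cons big_map big_enum /= => h; apply: leq_trans (h _) _.
  move=> F; rewrite inE sub1set => /andP[FM vF] /=.
  case: (wood FM vA) => [[pF _]|[w wN pF]|[]|[]].
  - by rewrite pF.
  - by apply/orP; right; rewrite has_map; apply/hasP; exists w; rewrite ?mem_enum.
  - by rewrite vF.
  - by rewrite vF.
apply: leq_add; first by apply: subset_leq_card; apply/subsetP => F; rewrite !inE => /andP[/andP[-> _]].
apply: leq_sum => w _; apply: leq_trans (part_phi A [set v; w]).
by apply: subset_leq_card; apply/subsetP => F; rewrite !inE => /andP[/andP[-> _]].
Qed.

Lemma cnt_bound A v : below A -> v \in A ->
  20 * cnt A [set v] <=
    20 * iso A v + \sum_(w in nb A v) fb (#|A| - (#|nb A v|.+1 + out A v w)).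
Proof.
move=> IH vA; apply: leq_trans (leq_mul (leqnn 20) (cnt_sum vA)) _.
rewrite mulnDr big_distrr leq_add2l; apply: leq_sum => w wN.
by rewrite -card_clnb2 //; apply: below_clnb; rewrite // card_clnb2 //= leqnn.
Qed.

Lemma sum_out A v : v \in A -> let d := #|nb A v| in
  let U := [set w in nb A v | out A v w == 0] in
  let W := [set w in nb A v | out A v w == 1] in
  #|U| + #|W| <= d /\
  \sum_(w in nb A v) fb (#|A| - (d.+1 + out A v w)) <=
    #|U| * fb (#|A| - (d + 1)) + #|W| * fb (#|A| - (d + 2)) + (d - #|U| - #|W|) * fb (#|A| - (d + 3)).
Proof.
move=> vA d U W; set N := nb A v; set n := #|A|.
have UN : U \subset N by apply/subsetP => w; rewrite inE => /andP[].
have WN : W \subset N :\: U.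
  by apply/subsetP => w; rewrite !inE => /andP[-> /eqP->].
have cU := cardsD N U; rewrite (setIidPr UN) in cU.
have cW := cardsD (N :\: U) W; rewrite (setIidPr WN) in cW.
have := subset_leq_card UN; have := subset_leq_card WN => l1 l2; split; first by rewrite /d -/N; lia.
rewrite (big_setID U) /= (setIidPr UN) (big_setID (A := N :\: U) W) /= (setIidPr WN).
rewrite -addnA; apply: leq_add; first by rewrite -sum_nat_const; apply: leq_sum => w; rewrite inE => /andP[_ /eqP->]; apply: fb_leq; rewrite /d; lia.
apply: leq_add; first by rewrite -sum_nat_const; apply: leq_sum => w; rewrite inE => /andP[_ /eqP->]; apply: fb_leq; rewrite /d; lia.
have -> : d - #|U| - #|W| = #|(N :\: U) :\: W| by rewrite cW cU.
rewrite -sum_nat_const; apply: leq_sum => w; rewrite !inE => /andP[o1 /andP[o0 wN]].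
by apply: fb_leq; rewrite wN /= in o0 o1; rewrite /d; lia.
Qed.

Lemma nb_card_lt A v : v \in A -> #|nb A v| < #|A|.
Proof. by move=> vA; rewrite -(nb_nonnb vA) leq_addl. Qed.

Lemma out_card A v w : v \in A -> w \in nb A v -> #|nb A v|.+1 + out A v w <= #|A|.
Proof. by move=> vA wN; rewrite -card_clnb2 // subset_leq_card // clnb_sub. Qed.

Lemma iso_bound A v : below A -> v \in A -> 20 * iso A v <= fb (#|A| - #|nb A v|.+1).
Proof.
move=> IH vA; apply: leq_trans (leq_mul (leqnn 20) (iso_le A v)) _.
by apply: (below_clnb IH); rewrite card_clnb1 ?leqnn.
Qed.

Lemma sum_out_le A v j : (forall w, w \in nb A v -> j <= out A v w) ->
  \sum_(w in nb A v) fb (#|A| - (#|nb A v|.+1 + out A v w)) <=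
    #|nb A v| * fb (#|A| - (#|nb A v|.+1 + j)).
Proof.
by move=> h; rewrite -sum_nat_const; apply: leq_sum => w /h hw; apply: fb_leq; lia.
Qed.

(** * Sets with one or two prescribed vertices *)

Lemma cnt_crude A v : below A -> v \in A ->
  20 * cnt A [set v] <= #|nb A v|.+1 * fb (#|A| - #|nb A v|.+1).
Proof.
move=> IH vA; apply: leq_trans (cnt_bound IH vA) _.
rewrite mulSn leq_add ?iso_bound //.
by apply: leq_trans (sum_out_le (j := 0) _) _; rewrite ?addn0.
Qed.

(** If some neighbour has no outer neighbour, no F has v isolated; otherwise v together with any
    neighbour dominates at least one vertex more than N[v]. Either way the crude count improves. *)
Lemma cnt_refined A v : below A -> v \in A -> let d := #|nb A v| in
  0 < d -> 20 * cnt A [set v] <= d * fb (#|A| - d.+1) \/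
  d.+2 <= #|A| /\ 20 * cnt A [set v] <= fb (#|A| - d.+1) + d * fb (#|A| - d.+2).
Proof.
move=> IH vA d d0; have bnd := cnt_bound IH vA.
have [/exists_inP[w wN /eqP o0]|/exists_inPn h] := boolP [exists w in nb A v, out A v w == 0].
  left; apply: leq_trans bnd _; rewrite (iso0 vA wN o0) muln0 add0n.
  by apply: leq_trans (sum_out_le (j := 0) _) _; rewrite ?addn0.
have h1 w : w \in nb A v -> 1 <= out A v w by move/h; rewrite lt0n.
right; split.
  have [w wN] : exists w, w \in nb A v by apply/card_gt0P.
  by have := out_card vA wN; have := h1 w wN; rewrite -/d; lia.
apply: leq_trans bnd _; rewrite leq_add ?iso_bound //.
by apply: leq_trans (sum_out_le h1) _; rewrite addn1.
Qed.

(** The factor 8/9 is dictated by degree four: if exactly three neighbours of v have a single outer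
    neighbour, then fb (n - 1) + 8/9 fb (n - 5) + 3 fb (n - 6) + fb (n - 7) equals fb n for n = 2
    modulo 5, and the strictness obtained here decides. *)
Lemma cnt_mem1_lt A z : below A -> z \in A -> 9 * (20 * cnt A [set z]) < 8 * fb #|A|.
Proof.
move=> IH zA; have crude := cnt_crude IH zA; have := cnt_refined IH zA.
have := nb_card_lt zA; move: crude; set X := 20 * _; set n := #|A|.
move: #|nb A z| => d; case: d => [|[|d]] crude dn ref.
- have [m En] : exists m, n = m + 1 by exists (n - 1); lia.
  move: crude; rewrite mul1n En addnK => c1.
  suff : 9 * fb m < 8 * fb (m + 1) by lia.
  by fb_arith m.
- case: (ref isT) => [c1|[n3 c1]].
    have [m En] : exists m, n = m + 2 by exists (n - 2); lia.
    move: c1; rewrite mul1n En addnK => c1.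
    suff : 9 * fb m < 8 * fb (m + 2) by lia.
    by fb_arith m.
  have [m En] : exists m, n = m + 3 by exists (n - 3); lia.
  move: c1; rewrite mul1n En addnK (_ : m + 3 - 2 = m + 1) => [c1|]; last by lia.
  suff : 9 * (fb (m + 1) + fb m) < 8 * fb (m + 3) by lia.
  by fb_arith m.
- have := @fb_mul_sub 3 d.+3 n isT dn => c1.
  have [m En] : exists m, n = m + 3 by exists (n - 3); lia.
  rewrite En addnK -En in c1.
  suff : 9 * (3 * fb m) < 8 * fb (m + 3) by rewrite -En; lia.
  by fb_arith m.
Qed.

Lemma fb_cnt_mem2 n : (n %% 5 == 1) || (n %% 5 == 2) -> 2 < n ->
  8 * fb (n - 2) + 9 * fb (n - 3) < 9 * fb (n - 1).
Proof.
move=> r12 n3; have [u [r [r12' ->]]] : exists u r, (r = 1 \/ r = 2) /\ n = u * 5 + (r + 5).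
  by exists (n %/ 5 - 1), (n %% 5); lia.
have u0 : 0 < 10 ^ u by rewrite expn_gt0.
by case: r12' => ->; rewrite -!addnBA // !fb_shift !fbE; move: u0; clear; lia.
Qed.

(** Meant for the n - 5 vertices outside the closed neighbourhood of a vertex of degree four. There
    the bound reads fb (n - 6), and fb (n - 1) + 5 fb (n - 6) = 3/2 fb (n - 1) = fb n in the
    residues 1 and 2, so it has to be strict. The degree of z decides: with degree zero or one, z
    can be split off; with degree at least two, counting the sets that contain z is enough. *)
Lemma cnt_mem2_lt A z z' : below A -> z \in A -> z' \in A -> z != z' ->
  (#|A| %% 5 == 1) || (#|A| %% 5 == 2) -> 20 * cnt A [set z; z'] < fb (#|A| - 1).
Proof.
move=> IH zA zA' ne r12.
have le1 : 20 * cnt A [set z; z'] <= 20 * cnt A [set z] by rewrite leq_mul2l cnt_leS ?orbT // sub1set set21.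
have crude := cnt_crude IH zA; have := cnt_refined IH zA.
have [t [r [r5 En]]] := residue5 #|A|.
have r12' : r = 1 \/ r = 2 by move: r12; rewrite En modnMDl; lia.
have dn := nb_card_lt zA => ref.
have A2 : 1 < #|A| by rewrite (cardsD1 z) zA (cardsD1 z') !inE eq_sym ne zA'.
have w0 : 0 < 10 ^ t by rewrite expn_gt0.
have [d0|d0] := posnP #|nb A z|.
  have cov : cnt A [set z; z'] <= cnt (A :\: clnb A [set z]) ([set z; z'] :\ z).
    apply: leq_trans (part_count A [set z] [set z; z']); apply: subset_leq_card.
    apply/subsetP => F; rewrite !inE => /andP[FM sQ]; rewrite FM sQ andbT /=.
    apply/partP; split=> [|x y /set1P-> yF ezy]; first by apply: subset_trans sQ; rewrite sub1set set21.
    have yN : y \in nb A z by rewrite inE ezy; case/MaxP: FM => /subsetP->.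
    by move/eqP: d0; rewrite cards_eq0 => /eqP E; rewrite E inE in yN.
  have zH : z' \in A :\: clnb A [set z].
    rewrite inE zA' andbT; apply/negP => /clnbP[_ [/set1P E|[x /set1P-> ezz']]].
      by rewrite E eqxx in ne.
    have : z' \in nb A z by rewrite inE zA'.
    by move/eqP: d0; rewrite cards_eq0 => /eqP->; rewrite inE.
  have := cnt_mem1_lt (below_subset IH (subsetDl _ _)) zH.
  rewrite card_Dclnb card_clnb1 // d0.
  have E2 : [set z; z'] :\ z = [set z'].
    by apply/setP => x; rewrite !inE; case: (eqVneq x z) => //= ->; rewrite (negPf ne).
  by rewrite E2 in cov; lia.
have [d1|d1] := eqVneq #|nb A z| 1; last first.
  (* The ratio 16/25 is 4 fb (n - 4) / fb n for n = 2 modulo 5, the worst case; it is below 2/3,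
     which is fb (n - 1) / fb n for both residues. *)
  suff : 25 * (20 * cnt A [set z]) <= 16 * fb #|A|.
    have : 16 * fb #|A| < 25 * fb (#|A| - 1).
      case: r12' => Er; rewrite En Er.
        by have := fb_shift t 0; rewrite addnK addn0 => ->; rewrite fb_shift !fbE; lia.
      by rewrite -addnBA // !fb_shift !fbE; lia.
    by lia.
  have big : 5 <= #|A|.
    rewrite En; case: (t) En => [|t'] En; last by lia.
    by case: r12' => E; rewrite E in En; lia.
  have [m Em] : exists m, #|A| = m + 5 by exists (#|A| - 5); lia.
  have r12m : m %% 5 = 1 \/ m %% 5 = 2 by move: r12; rewrite Em modnDr; lia.
  have [u [s [s5 Es]]] := residue5 m; rewrite Es modnMDl in r12m.
  have r12s : s = 1 \/ s = 2 by lia.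
  have w1 : 0 < 10 ^ u by rewrite expn_gt0.
  have Ek k : k < 5 -> fb (#|A| - k) = fb (s + 5 - k) * 10 ^ u.
    by move=> k5; rewrite Em Es -fb_shift; congr fb; lia.
  have EA : fb #|A| = fb (s + 5) * 10 ^ u by rewrite -[#|A|]subn0 Ek ?subn0.
  move: crude ref d0 d1 dn; move: #|nb A z| => d crude ref d0 d1 dn.
  case: d crude ref d0 d1 dn => [|[|[|d]]] // crude ref _ _ dn.
    case: (ref isT) => [c1|[n3 c1]]; rewrite ?Ek // in c1; rewrite EA;
      by case: r12s => Er; rewrite Er /= !fbE in c1 *; lia.
  have c1 := leq_trans crude (@fb_mul_sub 4 d.+4 #|A| isT dn).
  by rewrite Ek // in c1; rewrite EA; case: r12s => Er; rewrite Er /= !fbE in c1 *; lia.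
(* Degree one: a set containing z either pairs z with its only neighbour y or leaves z isolated. The
   latter needs an outer neighbour of y, and z' is then prescribed in the graph without z and y. *)
have [y Ey] : exists y, nb A z = [set y] by apply/cards1P/eqP.
have yN : y \in nb A z by rewrite Ey set11.
have [yA ezy] : y \in A /\ e z y by move: yN; rewrite inE => /andP[].
have pairF F : F \in Max A -> z \in F -> y \in F -> part F [set z; y].
  move=> /MaxP[sFA dF _] zF yF; apply/partP; rewrite subUset !sub1set zF yF; split=> // a b /set2P[]-> bF eab.
    by rewrite (dissP F dF z b y) ?inE ?eqxx ?orbT.
  by rewrite (dissP F dF y b z) ?inE ?eqxx // e_sym.
have isoF F : F \in Max A -> z \in F -> y \notin F -> part F [set z].
  move=> /MaxP[sFA dF _] zF yF; apply/partP; rewrite sub1set; split=> // a b /set1P-> bF eab.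
  have : b \in nb A z by rewrite inE eab (subsetP sFA).
  by rewrite Ey => /set1P E; rewrite -E bF in yF.
have pairB : 20 * phiS (A :\: clnb A [set z; y]) <= fb (#|A| - (2 + out A z y)).
  by apply: below_clnb => //; rewrite card_clnb2 // d1 leqnn.
have fb21 : fb (#|A| - 2) < fb (#|A| - 1).
  have [m Em] : exists m, #|A| = m + 2 by exists (#|A| - 2); rewrite subnK.
  by rewrite Em addnK -addnBA //; clear; fb_arith m.
have onlypair : (forall F, F \in Max A -> [set z; z'] \subset F -> y \in F) -> 20 * cnt A [set z; z'] < fb (#|A| - 1).
  move=> h; apply: leq_ltn_trans fb21; apply: leq_trans (leq_trans _ pairB) _; last by apply/fb_leq/leq_sub2l/leq_addr.
  rewrite leq_mul2l /=; apply: leq_trans (part_phi A [set z; y]).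
  apply: subset_leq_card; apply/subsetP => F; rewrite !inE => /andP[FM sQ]; rewrite FM /=.
  by apply: pairF => //; [apply: (subsetP sQ); rewrite set21|apply: h].
have [Eyz|nyz] := eqVneq y z'.
  by apply: onlypair => F _ /subsetP; apply; rewrite Eyz set22.
have [o0|o0] := posnP (out A z y).
  apply: onlypair => F FM /subsetP sQ; apply: contraT => yF.
  have [x xF] := iso_forced FM zA (isoF F FM (sQ z (set21 _ _)) yF) yN.
  by move/eqP: o0; rewrite cards_eq0 => /eqP->; rewrite inE.
have A3 : 3 <= #|A| by apply: leq_trans (out_card zA yN); rewrite d1 -[3]/(2 + 1) leq_add2l.
have zH : z' \in A :\: clnb A [set z].
  rewrite inE zA' andbT; apply/negP => /clnbP[_ [/set1P E|[x /set1P-> ezz']]].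
    by rewrite E eqxx in ne.
  have : z' \in nb A z by rewrite inE zA'.
  by rewrite Ey => /set1P E; rewrite E eqxx in nyz.
have := cnt_mem1_lt (below_subset IH (subsetDl _ _)) zH.
rewrite card_Dclnb card_clnb1 // d1 => f1.
have pairB' : 20 * phiS (A :\: clnb A [set z; y]) <= fb (#|A| - 3).
  by apply: leq_trans pairB _; apply/fb_leq/leq_sub2l; rewrite -[3]/(2 + 1) leq_add2l.
have cov : cnt A [set z; z'] <= cnt (A :\: clnb A [set z]) [set z'] + phiS (A :\: clnb A [set z; y]).
  rewrite /cnt -(cardsID [set F : {set T} | y \in F]) addnC leq_add //.
    have E2 : [set z; z'] :\ z = [set z'].
      by apply/setP => x; rewrite !inE; case: (eqVneq x z) => //= ->; rewrite (negPf ne).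
    have := part_count A [set z] [set z; z']; rewrite E2; apply: leq_trans.
    apply: subset_leq_card; apply/subsetP => F; rewrite !inE => /andP[yF /andP[FM sQ]].
    by rewrite FM sQ isoF // (subsetP sQ) // set21.
  apply: leq_trans (part_phi A [set z; y]).
  apply: subset_leq_card; apply/subsetP => F; rewrite !inE => /andP[/andP[FM sQ] yF].
  by rewrite FM pairF // (subsetP sQ) // set21.
have := fb_cnt_mem2 r12 A3; move: cov pairB' f1; clear; lia.
Qed.

Lemma card_setD1 A v : v \in A -> #|A :\ v| = #|A| - 1.
Proof. by move=> vA; rewrite (cardsD1 v A) vA addKn. Qed.

Lemma below_D1 A v : below A -> v \in A -> 20 * phiS (A :\ v) <= fb (#|A| - 1).
Proof.
move=> IH vA; rewrite -(card_setD1 vA); apply: bounded_le => //.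
by apply: IH; apply: proper_card; apply: properD1.
Qed.

Lemma bounded_branch A v X Y : v \in A -> 20 * phiS (A :\ v) <= X -> 20 * cnt A [set v] <= Y ->
  X + Y < fb #|A| -> bounded A.
Proof.
move=> vA h1 h2 h3; left; apply: leq_ltn_trans h3; apply: leq_trans (leq_add h1 h2).
by rewrite -mulnDr leq_mul2l phiS_branch.
Qed.

Lemma separatedD A C : (forall x y, x \in C -> y \in A -> e x y -> y \in C) -> separated C (A :\: C).
Proof. by move=> h x y xC /setDP[yA yC]; apply: contra yC; apply: h. Qed.

Lemma bounded_closed A C x : below A -> C \subset A -> x \in C ->
  (forall x y, x \in C -> y \in A -> e x y -> y \in C) -> C <> A -> bounded A.
Proof.
move=> IH sC xC /separatedD sep ne; apply: (bounded_split sC sep); apply: IH.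
  by apply: proper_card; rewrite properEneq sC andbT; apply/eqP.
by apply: proper_card; rewrite properEneq subsetDl andbT; apply/eqP => /setP/(_ x); rewrite !inE xC (subsetP sC).
Qed.

(** Two blocks would already have at least eight vertices. *)
Lemma kparts_small A a b : kparts A a b -> 0 < #|A| < 8 -> is_Kstar_on e A.
Proof.
case=> P [pP cr ks _ _] /andP[/card_gt0P[x xA] A8].
have pbP y : y \in A -> pblock P y \in P by move=> yA; rewrite pblock_mem ?(cover_partition pP).
have sub y : y \in A -> pblock P y \subset A.
  by move=> yA; rewrite -(cover_partition pP); apply: bigcup_sup (pbP y yA).
have [Kx szx] := ks _ (pbP x xA); suff <- : pblock P x = A by [].
apply/eqP; rewrite eqEsubset sub //=; apply/subsetP => y yA; apply: contraT => yn.
have [_ szy] := ks _ (pbP y yA).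
have dis : [disjoint pblock P x & pblock P y].
  case/and3P: pP => /eqP cP /trivIsetP tP _; apply: tP; rewrite ?pbP //.
  by apply: contraNneq yn => ->; rewrite mem_pblock cP.
have : #|pblock P x :|: pblock P y| <= #|A| by apply: subset_leq_card; rewrite subUset !sub.
have I0 : #|pblock P x :&: pblock P y| = 0 by apply/eqP; rewrite cards_eq0 setI_eq0.
by rewrite cardsU I0; move: szx szy A8; rewrite !inE; clear; lia.
Qed.

Lemma ext_small A : ext A -> 0 < #|A| < 8 -> is_Kstar_on e A.
Proof. by rewrite /ext; case: (#|A| %% 5) => [|[|[|[|]]]] *; apply: kparts_small; eassumption. Qed.

Lemma Kstar_ext A : is_Kstar_on e A -> #|A| \in [:: 4; 5; 6] -> ext A.
Proof.
move=> KA sz; have := kparts1 KA sz; rewrite /ext.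
by move: sz; rewrite !inE => /or3P[]/eqP->.
Qed.

Lemma nbD1 A x v : v \in A -> e x v -> #|nb A x| = (#|nb (A :\ v) x|).+1.
Proof.
move=> vA exv; rewrite (cardsD1 v (nb A x)) inE vA exv; congr (_.+1); apply: eq_card => y.
by rewrite !inE andbA.
Qed.

(** The count only meets the bound: 6 + 4 = 10 on five vertices, 10 + 5 = 15 on six. So the
    structure of [A :\ v] is needed: if it is K4* or K5*, the dominating vertex v completes it to
    K5* or K6*. *)
Lemma bounded_dominated A v : below A -> v \in A -> (forall w, w \in A -> w != v -> e v w) ->
  (#|A| == 5) || (#|A| == 6) -> bounded A.
Proof.
move=> IH vA dom A56.
have dA1 := card_setD1 vA.
have EN : nb A v = A :\ v.
  by apply/setP => w; rewrite !inE; case: (eqVneq w v) => [->|wv]; rewrite ?e_irr ?andbF //= andbC; case: (boolP (w \in A)) => [wA|]; rewrite ?andbF ?dom.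
have cl w : w \in nb A v -> phiS (A :\: clnb A [set v; w]) = 1.
  move=> wN; apply: phiS_le2 => //; apply: leq_trans (_ : 0 <= 2); rewrite // leqn0 cards_eq0 -subset0.
  apply/subsetP => x; rewrite inE clnb2E inE => /andP[h xA]; move: h; rewrite xA /=.
  by case: (eqVneq x v) => //= xv; rewrite (dom x) ?orbT.
have i0 : iso A v = 0.
  have [w wN] : exists w, w \in nb A v by apply/card_gt0P; rewrite EN dA1; lia.
  apply: (iso0 vA wN); apply/eqP; rewrite cards_eq0 -subset0; apply/subsetP => x.
  by rewrite in_setD in_setU1 EN !inE; case: (x == v); case: (x \in A); rewrite ?andbF.
have cv : cnt A [set v] <= #|A| - 1.
  apply: leq_trans (cnt_sum vA) _.
  by rewrite i0 (eq_bigr _ cl) sum1_card EN dA1.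
have br := phiS_branch vA.
have : bounded (A :\ v) by apply: IH; rewrite dA1; move: A56; lia.
case=> [lt|ex].
  left; move: lt; rewrite dA1.
  by case/orP: A56 => /eqP E; rewrite E !fbE in cv *; lia.
right; apply: Kstar_ext; last by rewrite !inE; case/orP: A56 => ->; rewrite ?orbT.
have /(KstarP) K : is_Kstar_on e (A :\ v).
  by apply: ext_small ex _; rewrite dA1; move: A56; lia.
apply/(KstarP) => x xA; case: (eqVneq x v) => [->|xv].
  by rewrite EN dA1; lia.
have := K x; rewrite !inE xv xA => /(_ isT); rewrite dA1 (nbD1 vA); first by lia.
by rewrite e_sym dom.
Qed.

(** Again the count 10 + 1 + 4 = 15 equals the bound, and K5* on [A :\ v] extends to K6* on [A]: z
    is the only vertex that v misses, and the degree of z is given. *)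
Lemma bounded_octahedron A v z : below A -> v \in A -> z \in A -> #|nb A v| = 4 -> #|nb A z| = 4 ->
  #|A| = 6 -> v != z -> ~~ e v z -> bounded A.
Proof.
move=> IH vA zA dv dz A6 vz nvz.
have dA1 := card_setD1 vA.
have cl w : w \in nb A v -> phiS (A :\: clnb A [set v; w]) = 1.
  move=> wN; rewrite phiS_le2 // card_Dclnb card_clnb2 // A6 dv.
  by lia.
have i1 : iso A v <= 1.
  apply: leq_trans (iso_le A v) _; rewrite phiS_le2 // card_Dclnb card_clnb1 //.
  by rewrite A6 dv.
have cv : cnt A [set v] <= 5.
  apply: leq_trans (cnt_sum vA) _.
  by rewrite (eq_bigr _ cl) sum1_card dv; lia.
have br := phiS_branch vA.
have : bounded (A :\ v) by apply: IH; rewrite dA1 A6.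
case=> [lt|ex].
  by left; move: lt; rewrite dA1 A6 !fbE; lia.
right; apply: Kstar_ext; last by rewrite A6.
have /(KstarP) K : is_Kstar_on e (A :\ v).
  by apply: ext_small ex _; rewrite dA1 A6.
apply/(KstarP) => x xA; case: (eqVneq x v) => [->|xv]; first by rewrite dv A6.
case: (eqVneq x z) => [->|xz]; first by rewrite dz A6.
have := K x; rewrite !inE xv xA => /(_ isT); rewrite dA1 (nbD1 vA) ?A6 //.
have vzN : [set v; z] \subset A :\: nb A v.
  by rewrite subUset !sub1set !inE e_irr vA zA (negPf nvz).
have E : A :\: nb A v = [set v; z].
  apply/esym/eqP; rewrite eqEcard vzN cards2 vz cardsD A6 (setIidPr _) ?dv //.
  by apply/subsetP => y; rewrite inE => /andP[].
have : x \notin A :\: nb A v by rewrite E !inE negb_or xv.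
by rewrite !inE xA andbT negbK e_sym => /andP[].
Qed.

(** * Degree at least four *)

(** From degree six on the crude count is strict, degree six being the worst. At degree five it is
    not: fb 5 + 6 * fb 0 = 320 exceeds fb 6 = 300. *)
Lemma bounded_degree_ge6 A v : below A -> v \in A -> 6 <= #|nb A v| -> bounded A.
Proof.
move=> IH vA d6; have dn := nb_card_lt vA.
apply: (bounded_branch vA (below_D1 IH vA) (cnt_crude IH vA)).
have h : #|nb A v|.+1 * fb (#|A| - #|nb A v|.+1) <= 7 * fb (#|A| - 7) by apply: fb_mul_sub.
apply: leq_ltn_trans (leq_add (leqnn _) h) _.
have [m ->] : exists m, #|A| = m + 7 by exists (#|A| - 7); lia.
by rewrite -addnBA // addnK; clear; fb_arith m.
Qed.

Lemma sum_out2 A v : v \in A -> let d := #|nb A v| in let u := #|[set w in nb A v | out A v w == 0]| in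
  u <= d /\
  \sum_(w in nb A v) fb (#|A| - (d.+1 + out A v w)) <=
    u * fb (#|A| - (d + 1)) + (d - u) * fb (#|A| - (d + 2)).
Proof.
move=> vA d u; have [h1 h2] := sum_out vA; split.
  by apply: leq_trans h1; apply: leq_addr.
apply: leq_trans h2 _; rewrite -addnA leq_add2l.
have c : fb (#|A| - (d + 3)) <= fb (#|A| - (d + 2)) by apply/fb_leq/leq_sub2l; rewrite leq_add2l.
apply: leq_trans (leq_add (leqnn _) (leq_mul (leqnn _) c)) _; rewrite -mulnDl leq_mul2r.
by rewrite subnKC ?leqnn ?orbT // leq_subRL //; apply: leq_trans h1; apply: leq_addr.
Qed.

Lemma nbhd_closed A v : v \in A -> (forall w, w \in nb A v -> out A v w = 0) ->
  forall x y, x \in v |: nb A v -> y \in A -> e x y -> y \in v |: nb A v.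
Proof.
move=> vA h x y /setU1P[->|xN] yA exy; first by rewrite !inE yA exy orbT.
apply: contraT => yn; have /eqP := h x xN; rewrite cards_eq0 => /eqP/setP/(_ y).
by rewrite in_setD yn in_set0 inE yA exy.
Qed.

(** N[v] is a union of components; if it is all of [A], then v dominates a graph on five or six
    vertices. *)
Lemma bounded_closed_nbhd A v : below A -> v \in A -> (#|nb A v| == 4) || (#|nb A v| == 5) ->
  (forall w, w \in nb A v -> out A v w = 0) -> bounded A.
Proof.
move=> IH vA d45 h; have cl := nbhd_closed vA h.
have sub : v |: nb A v \subset A.
  by rewrite subUset sub1set vA; apply/subsetP => x; rewrite inE => /andP[].
have [E|/eqP ne] := eqVneq (v |: nb A v) A; last exact: (bounded_closed IH sub (setU11 _ _) cl).
apply: (bounded_dominated IH vA) => [w wA wv|].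
  by move: wA; rewrite -{1}E !inE (negPf wv) => /andP[].
by rewrite -E cardsU1 inE e_irr andbF.
Qed.

Lemma iso0_count A v : v \in A -> 0 < #|[set w in nb A v | out A v w == 0]| -> iso A v = 0.
Proof. by move=> vA /card_gt0P[w]; rewrite inE => /andP[wN /eqP]; apply: iso0. Qed.

Lemma out0_dichotomy A v : v \in A -> (forall w, w \in nb A v -> out A v w = 0) \/
  #|[set w in nb A v | out A v w == 0]| < #|nb A v| /\ #|nb A v| + 2 <= #|A|.
Proof.
move=> vA; have [/forall_inP all0|/forall_inPn[w wN ow]] := boolP [forall w in nb A v, out A v w == 0].
  by left=> w /all0/eqP.
right; split; last by have := out_card vA wN; move: ow; rewrite -lt0n; lia.
apply: proper_card; apply/properP; split; first by apply/subsetP => x; rewrite inE => /andP[].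
by exists w; rewrite // inE wN.
Qed.

Lemma bounded_degree5 A v : below A -> v \in A -> #|nb A v| = 5 -> bounded A.
Proof.
move=> IH vA d5; have bnd := cnt_bound IH vA; have [_ S] := sum_out2 vA.
have iB := iso_bound IH vA; have i0 := iso0_count vA.
have [all0|[u5 n7]] := out0_dichotomy vA.
  by apply: bounded_closed_nbhd IH vA _ all0; rewrite d5.
move: u5 n7 i0 S bnd iB; rewrite d5; move: #|[set w in nb A v | out A v w == 0]| => u u5 n7 i0 S bnd iB.
apply: (bounded_branch vA (below_D1 IH vA) (leq_trans bnd (leq_add (leqnn _) S))); clear bnd S.
have [m En] : exists m, #|A| = m + 7 by exists (#|A| - 7); lia.
move: iB i0 n7; rewrite En -!addnBA //= addn0; move: (iso A v) => I iB i0 _.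
(* [ar1] is the worst case with a neighbour lacking outer neighbours, namely u = 4 and no set with v
   isolated; [ar2] is the case u = 0. *)
have ar1 : fb (m + 6) + 4 * fb (m + 1) + fb m < fb (m + 7) by clear; fb_arith m.
have ar2 : fb (m + 6) + fb (m + 1) + 5 * fb m < fb (m + 7) by clear; fb_arith m.
have mono : fb m <= fb (m + 1) by apply/fb_leq/leq_addr.
rewrite -[7 - 6]/1 -[7 - 1]/6 in iB *. case: u u5 i0 => [|u] u5 i0; first by move: iB ar2; clear; lia.
rewrite i0 //; case: u u5 {i0} => [|[|[|[|u]]]] // _; move: ar1 mono; clear; lia.
Qed.

(** The block [D] of u1 has at least five vertices and u1 misses at most one of them, so its
    neighbours in [D] are exactly the other vertices of [X]. Hence u2 lies in [D], and a vertex of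
    [D] outside [X] misses both u1 and u2, which a K* block does not allow. *)
Lemma kparts_no4 B b u1 u2 (X : {set T}) : kparts B 0 b -> u1 \in B -> u2 \in B -> u1 != u2 ->
  #|X| <= 4 -> u1 \in X -> u2 \in X -> nb B u1 \subset X -> nb B u2 \subset X -> False.
Proof.
case=> P [pP cr ks a0 _] u1B u2B ne X4 u1X u2X s1 s2.
have pbP : pblock P u1 \in P by rewrite pblock_mem ?(cover_partition pP).
set D := pblock P u1 in pbP; have u1D : u1 \in D by rewrite mem_pblock (cover_partition pP).
have [KD szD] := ks D pbP.
have D5 : 5 <= #|D|.
  suff : #|D| != 4 by move: szD; rewrite !inE; clear; lia.
  apply/negP => D4; have : D \in [set B in P | #|B| == 4] by rewrite inE pbP.
  by move/eqP: a0; rewrite /nblocks cards_eq0 => /eqP->; rewrite inE.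
have DB : D \subset B by rewrite -(cover_partition pP); apply: bigcup_sup pbP.
have /(KstarP) K := KD.
have sD x : nb D x \subset nb B x.
  by apply/subsetP => y; rewrite !inE => /andP[/(subsetP DB)->].
have n1 : nb D u1 \subset X :\ u1.
  by rewrite subsetD1 (subset_trans (sD _) s1) inE e_irr andbF.
have X1 := cardsD1 u1 X; rewrite u1X in X1.
have E1 : nb D u1 = X :\ u1.
  by apply/eqP; rewrite eqEcard n1; move: (K u1 u1D) X1 X4 D5; clear; lia.
have cD : #|nb D u1| <= 3 by rewrite E1; move: X1 X4; clear; lia.
have u2D : u2 \in D.
  have : u2 \in nb D u1 by rewrite E1 !inE eq_sym ne.
  by rewrite inE => /andP[].
have [z zD zX] : exists2 z, z \in D & z \notin X.
  by apply/subsetPn; apply/negP => /subset_leq_card; move: X4 D5; clear; lia.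
have nz u : u \in B -> nb B u \subset X -> ~~ e z u.
  move=> uB s; rewrite e_sym; apply: contra zX => euz; apply: (subsetP s).
  by rewrite inE euz (subsetP DB).
have zu u : u \in X -> u != z by move=> uX; apply: contraNneq zX => <-.
have : [set u1; u2] \subset [set y in D | (y != z) && ~~ e z y].
  by rewrite subUset !sub1set !inE u1D u2D !zu ?nz.
move/subset_leq_card; rewrite cards2 ne.
by move: (nb_nonnb zD) (K z zD); clear; lia.
Qed.

Lemma phiS_closed A C : C \subset A -> (forall x y, x \in C -> y \in A -> e x y -> y \in C) ->
  phiS A = phiS C * phiS (A :\: C).
Proof.
move=> sC /separatedD sep; rewrite -{1}(setID A C) (setIidPr sC) phiS_mul //.
by rewrite disjoint_sym disjoints_subset setDE subsetIr.
Qed.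

(** * Degree four, by the number of neighbours without outer neighbours *)

Lemma bounded_degree4_out1 A v : below A -> v \in A -> #|nb A v| = 4 ->
  #|[set w in nb A v | out A v w == 0]| = 1 -> 6 <= #|A| -> bounded A.
Proof.
move=> IH vA d4 u1 n6; have bnd := cnt_bound IH vA; have [_ S] := sum_out2 vA.
have i0 := iso0_count vA; rewrite u1 in i0 S; rewrite i0 // add0n in bnd.
apply: (bounded_branch vA (below_D1 IH vA) (leq_trans bnd S)).
have [m En] : exists m, #|A| = m + 6 by exists (#|A| - 6); rewrite subnK.
by rewrite d4 En -!addnBA //; clear; fb_arith m.
Qed.

(** The count fb (n - 1) + 2 fb (n - 5) + 2 fb (n - 6) equals fb n in the residues 1 and 2. There
    [A :\ v] would have to be extremal, of residue 0 or 1, hence without K4* block; the two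
    neighbours of v whose neighbours all lie in N[v] contradict [kparts_no4] with [X] = N(v). *)
Lemma bounded_degree4_out2 A v : below A -> v \in A -> #|nb A v| = 4 ->
  #|[set w in nb A v | out A v w == 0]| = 2 -> 6 <= #|A| -> bounded A.
Proof.
move=> IH vA d4 u2 n6; have bnd := cnt_bound IH vA; have [_ S] := sum_out2 vA.
have i0 := iso0_count vA; rewrite u2 in i0 S; rewrite i0 // add0n in bnd.
have := leq_trans bnd S; rewrite d4 => {bnd S} bnd.
have [m En] : exists m, #|A| = m + 6 by exists (#|A| - 6); rewrite subnK.
have : bounded (A :\ v) by apply: IH; apply: proper_card; apply: properD1.
case=> [lt|ex].
  apply: (bounded_branch (X := (fb (#|A| - 1)).-1) vA _ bnd).
    by rewrite -(card_setD1 vA) -ltnS prednK ?fb_gt0.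
  have : 0 < fb (#|A| - 1) := fb_gt0 _.
  rewrite En -!addnBA // -[6 - 1]/5 -[6 - (4 + 1)]/1 -[6 - (4 + 2)]/0.
  suff : fb (m + 5) + (2 * fb (m + 1) + 2 * fb m) <= fb (m + 6) by rewrite addn0 -[4 - 2]/2; clear; lia.
  by clear; fb_arith m.
have [r12|r12] := boolP ((#|A| %% 5 == 1) || (#|A| %% 5 == 2)); last first.
  apply: (bounded_branch vA (below_D1 IH vA) bnd).
  rewrite En -!addnBA // -[6 - 1]/5 -[6 - (4 + 1)]/1 -[6 - (4 + 2)]/0.
  have [t [s [s5 Es]]] := residue5 m; rewrite En Es in r12.
  have {r12} s2 : 1 < s by move: r12 s5; rewrite -addnA modnMDl; case: s {Es} => [|[|s]].
  rewrite Es -!addnA !fb_shift; have w0 : 0 < 10 ^ t by rewrite expn_gt0.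
  by case: s s5 s2 {Es} => [|[|[|[|[|s]]]]] // _ _; rewrite !fbE; move: w0; clear; lia.
exfalso; have [b kb] : exists b, kparts (A :\ v) 0 b.
  move: ex; rewrite /ext (card_setD1 vA) En -addnBA //.
  have [t [s [s5 Es]]] := residue5 m; move: r12; rewrite En Es -!addnA !modnMDl -[6 - 1]/5 modnDr.
  by case: s s5 {Es} => [|[|[|[|[|s]]]]] //= _ _ ?; [exists 0|exists 1].
pose U := [set w in nb A v | out A v w == 0].
have /cards2P[a [b' [ab EU]]] : #|U| == 2 by rewrite /U u2.
have inU x : x \in U -> [/\ x \in nb A v, x \in A :\ v & nb (A :\ v) x \subset nb A v].
  rewrite inE => /andP[xN /eqP o0]; split=> //.
    move: xN; rewrite !inE => /andP[-> evx]; rewrite andbT.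
    by apply: contraTneq evx => ->; rewrite e_irr.
  apply/subsetP => y yN; move/eqP: o0; rewrite cards_eq0 => /eqP/setP/(_ y).
  move: yN; rewrite !inE -andbA => /and3P[/negPf-> -> ->] /=.
  by rewrite andbT => /negbT; rewrite negbK.
have [aN aA sa] := inU a ltac:(by rewrite EU set21).
have [bN bA sb] := inU b' ltac:(by rewrite EU set22).
by apply: (kparts_no4 kb aA bA ab _ aN bN sa sb); rewrite d4.
Qed.

(** Plain branching at v gives 200 + 90 + 20 = 310 against fb 6 = 300. But only one neighbour w of v
    has outer neighbours, so w separates v and [U] from the rest; if w has no neighbour in [U], then
    v itself separates [U]. *)
Lemma bounded_degree4_out3 A v : below A -> v \in A -> #|nb A v| = 4 -> (forall x, x \in A -> #|nb A x| <= 4) ->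
  #|[set w in nb A v | out A v w == 0]| = 3 -> 6 <= #|A| -> bounded A.
Proof.
move=> IH vA d4 max4; set U := [set w in nb A v | out A v w == 0] => u3 n6.
have UN : U \subset nb A v by apply/subsetP => w; rewrite inE => /andP[].
have cD := cardsD (nb A v) U; rewrite (setIidPr UN) d4 u3 in cD.
have /cards1P[w Ew] : #|nb A v :\: U| == 1 by rewrite cD.
have [m En] : exists m, #|A| = m + 6 by exists (#|A| - 6); rewrite subnK.
have wNU : w \in nb A v :\: U by rewrite Ew set11.
have [wN wU] : w \in nb A v /\ w \notin U by move: wNU; rewrite inE => /andP[].
have [wA evw] : w \in A /\ e v w by move: wN; rewrite inE => /andP[].
have ow : out A v w != 0 by move: wU; rewrite inE wN.
have NE x : x \in nb A v -> x != w -> x \in U.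
  by move=> xN xw; apply: contraR xw => xU; rewrite -in_set1 -Ew inE xU.
have Uout x y : x \in U -> y \in A -> e x y -> y != v -> y \in nb A v.
  rewrite inE => /andP[xN /eqP/eqP]; rewrite cards_eq0 => /eqP/setP/(_ y) h yA exy yv.
  by move: h; rewrite in_setD in_setU1 (negPf yv) [y \in nb A x]inE yA exy in_set0 /= andbT => /negbFE.
have vU : v \notin U by rewrite inE inE e_irr andbF.
have UA : U \subset A by apply/subsetP => x /(subsetP UN); rewrite inE => /andP[].
have wv : w != v by apply: contraTneq evw => ->; rewrite e_irr.
have [/exists_inP[u uU ewu]|/exists_inPn noU] := boolP [exists u in U, e w u].
  have sV : v |: U \subset A :\ w.
    rewrite subUset sub1set !inE eq_sym wv vA /= subsetD1 UA /=.
    exact: wU.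
  have clV x y : x \in v |: U -> y \in A :\ w -> e x y -> y \in v |: U.
    move=> xV /setD1P[yw yA] exy; case: (eqVneq y v) => [->|yv]; first exact: setU11.
    case/setU1P: xV exy => [->|xU] exy; apply/setU1P; right; apply: NE => //; first by rewrite inE yA.
    exact: Uout exy yv.
  have cV : #|v |: U| = 4 by rewrite cardsU1 vU u3.
  have c1 : 20 * phiS (v |: U) <= 120.
    by rewrite -[120]/(fb 4); apply: (below_le IH); rewrite ?cV // ; apply: leq_trans n6.
  have cR : #|(A :\ w) :\: (v |: U)| = m + 1.
    by rewrite cardsD (setIidPr sV) card_setD1 // cV En; clear; lia.
  have c2 : 20 * phiS ((A :\ w) :\: (v |: U)) <= fb (m + 1).
    by apply: (below_le IH); rewrite ?cR // En ltn_add2l.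
  (* Removing N[S] leaves at most two of the three vertices of [U], since u is adjacent to w; they
     count as a factor 1. What else remains avoids N[v] and N[w], so it has at most m vertices. *)
  have c3 S : w \in S -> 20 * phiS (A :\: clnb A S) <= fb m.
    move=> wS; set R := A :\: clnb A S.
    have RA : R \subset A by apply: subsetDl.
    have nR x : x \in R -> x != w /\ ~~ e w x.
      rewrite inE => /andP[xn xA]; split.
        by apply: contraNneq xn => ->; apply/clnbP; split=> //; left.
      by apply: contra xn => ewx; apply/clnbP; split=> //; right; exists w.
    have vR : v \notin R by apply/negP => /nR[_]; rewrite e_sym evw.
    have sRU : R :&: U \subset R by apply: subsetIl.
    rewrite (phiS_closed sRU) => [|x y /setIP[xR xU] yR exy]; last first.
      rewrite inE yR; have [yw _] := nR y yR; apply: NE => //.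
      apply: Uout exy _; rewrite ?(subsetP RA) //; by apply: contraNneq vR => <-.
    rewrite phiS_le2 // => [|].
      rewrite mul1n; apply: (below_le IH); last by rewrite En -[leqLHS]addn1 leq_add2l.
      have : R :\: (R :&: U) \subset A :\: (v |: nb A v :|: clnb A [set v; w]).
        apply/subsetP => x /setDP[xR]; rewrite inE xR /= => xU.
        have [xw ewx] := nR x xR; have xA := subsetP RA x xR.
        have xv : x != v by apply: contraNneq vR => <-.
        have xN : x \notin nb A v by apply: contra xU => xN; apply: NE.
        rewrite inE xA andbT in_setU negb_or in_setU1 (negPf xv) xN /= clnb2E xA (negPf xv) (negPf xw) (negPf ewx).
        by move: xN; rewrite inE xA /= => /negPf->.
      move/subset_leq_card/leq_trans; apply.
      have -> : v |: nb A v :|: clnb A [set v; w] = clnb A [set v; w].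
        apply/setUidPr/subsetP => x; rewrite clnb2E !inE.
        by case/predU1P=> [->|/andP[-> ->]]; rewrite ?vA ?eqxx ?orbT.
      rewrite card_Dclnb card_clnb2 // d4 En; move: ow; rewrite -lt0n; clear; lia.
    apply: leq_trans (_ : #|U :\ u| <= 2); last by move: (cardsD1 u U); rewrite uU u3; clear; lia.
    apply: subset_leq_card; apply/subsetP => x /setIP[/nR[_ ewx] xU]; rewrite in_setD1 xU andbT.
    by apply: contraNneq ewx => ->.
  apply: (@bounded_branch A w (6 * fb (m + 1)) (5 * fb m)) => //.
  - rewrite (phiS_closed sV clV); move: c1 c2; clear.
    set a := phiS _; set b := phiS _; move=> c1 c2.
    have a6 : a <= 6 by lia.
    by rewrite mulnCA; apply: leq_mul.
  - apply: leq_trans (leq_mul (leqnn 20) (cnt_sum wA)) _.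
    rewrite mulnDr -[5]/(1 + 4) mulnDl mul1n leq_add //.
      by apply: leq_trans (leq_mul (leqnn 20) (iso_le A w)) (c3 _ _); rewrite set11.
    apply: leq_trans (_ : #|nb A w| * fb m <= _); last by rewrite leq_mul2r max4 ?orbT.
    by rewrite big_distrr -sum_nat_const; apply: leq_sum => y _; apply: c3; rewrite set21.
  by rewrite En; clear; fb_arith m.
have sU : U \subset A :\ v by rewrite subsetD1 UA.
have clU x y : x \in U -> y \in A :\ v -> e x y -> y \in U.
  move=> xU /setD1P[yv yA] exy; apply: NE; first exact: Uout exy yv.
  by apply: contraNneq (noU x xU) => <-; rewrite e_sym.
have c1 : 20 * phiS U <= 72.
  by rewrite -[72]/(fb 3); apply: (below_le IH); rewrite ?u3 //; apply: leq_trans n6.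
have cR : #|(A :\ v) :\: U| = m + 2.
  by rewrite cardsD (setIidPr sU) card_setD1 // u3 En; clear; lia.
have c2 : 20 * phiS ((A :\ v) :\: U) <= fb (m + 2).
  by apply: (below_le IH); rewrite ?cR // En ltn_add2l.
have bnd := cnt_bound IH vA; have [_ S] := sum_out2 vA.
have i0 := iso0_count vA; rewrite u3 in i0 S; rewrite i0 // add0n in bnd.
apply: (@bounded_branch A v (3 * fb (m + 2)) _ vA _ (leq_trans bnd S)).
  rewrite (phiS_closed sU clU); move: c1 c2; clear.
  set a := phiS _; set b := phiS _; move=> c1 c2.
  have a3 : a <= 3 by lia.
  by rewrite mulnCA; apply: leq_mul.
by rewrite d4 En -!addnBA //; clear; fb_arith m.
Qed.

(** All four neighbours of v are adjacent to z, which has degree at most four, so z has the same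
    neighbours as v. These six vertices are closed under adjacency: either a proper union of
    components or the octahedral case. *)
Lemma bounded_shared_outer A v z : below A -> v \in A -> z \in A -> #|nb A v| = 4 -> #|nb A z| <= 4 ->
  (forall w, w \in nb A v -> nb A w :\: (v |: nb A v) = [set z]) -> bounded A.
Proof.
move=> IH vA zA d4 z4 h.
have [w0 w0N] : exists w, w \in nb A v by apply/card_gt0P; rewrite d4.
have znN : z \notin v |: nb A v.
  have : z \in nb A w0 :\: (v |: nb A v) by rewrite h ?set11.
  by rewrite in_setD => /andP[].
have zv : v != z by apply: contraNneq znN => <-; rewrite setU11.
have nvz : ~~ e v z by apply: contra znN => evz; rewrite !inE zA evz orbT.
have Nz : nb A z = nb A v.
  apply/esym/eqP; rewrite eqEcard d4 z4 andbT; apply/subsetP => w wN.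
  have : z \in nb A w :\: (v |: nb A v) by rewrite h ?set11.
  by rewrite in_setD => /andP[_]; move: wN; rewrite !inE => /andP[-> _] /andP[_]; rewrite e_sym.
pose C := z |: (v |: nb A v).
have sC : C \subset A.
  by rewrite !subUset !sub1set zA vA; apply/subsetP => x; rewrite inE => /andP[].
have clC x y : x \in C -> y \in A -> e x y -> y \in C.
  move=> /setU1P[->|/setU1P[->|xN]] yA exy.
  - have yN : y \in nb A z by rewrite inE yA.
    by rewrite Nz in yN; rewrite !in_setU1 yN !orbT.
  - by rewrite !inE yA exy !orbT.
  - have [yc|yc] := boolP (y \in v |: nb A v); first by rewrite in_setU1 yc orbT.
    have : y \in nb A x :\: (v |: nb A v) by rewrite in_setD yc inE yA.
    by rewrite h // => /set1P->; rewrite setU11.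
have [E|/eqP ne] := eqVneq C A; last exact: (bounded_closed IH sC (setU11 _ _) clC).
apply: (bounded_octahedron IH vA zA) => //; first by rewrite Nz.
by rewrite -E cardsU1 znN cardsU1 inE e_irr andbF d4.
Qed.

(** Outside the residues 1 and 2 the plain count suffices. In them, let [W] be the set of neighbours
    of v with exactly one outer neighbour. For |W| <= 2 the second outer neighbours of the others
    are gain enough. For |W| = 3 a set with v isolated has one prescribed vertex. For |W| = 4 it has
    two, unless one outer neighbour is common to all four. *)
Lemma bounded_degree4_out0 A v : below A -> v \in A -> #|nb A v| = 4 -> (forall x, x \in A -> #|nb A x| <= 4) ->
  #|[set w in nb A v | out A v w == 0]| = 0 -> 6 <= #|A| -> bounded A.
Proof.
move=> IH vA d4 max4 u0 n6.
have bnd := cnt_bound IH vA; have iB := iso_bound IH vA.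
rewrite d4 in bnd iB; have [_] := sum_out2 vA; have [] := sum_out vA; rewrite u0 d4 !mul0n !add0n !subn0.
set S := \sum_(w in _) _ in bnd *; set W := [set w in _ | _ == 1] => W4 S3 S2.
have [r12|r12] := boolP ((#|A| %% 5 == 1) || (#|A| %% 5 == 2)); last first.
  apply: (bounded_branch vA (below_D1 IH vA) (leq_trans bnd (leq_add iB S2))).
  have [m En] : exists m, #|A| = m + 6 by exists (#|A| - 6); rewrite subnK.
  rewrite En -!addnBA // -[6 - 1]/5 -[6 - 5]/1 -[6 - (4 + 2)]/0.
  have [t [s [s5 Es]]] := residue5 m; rewrite En Es in r12.
  have {r12} s2 : 1 < s by move: r12 s5; rewrite -addnA modnMDl; case: s {Es} => [|[|s]].
  rewrite Es -!addnA !fb_shift; have w0 : 0 < 10 ^ t by rewrite expn_gt0.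
  by case: s s5 s2 {Es} => [|[|[|[|[|s]]]]] // _ _; rewrite !fbE; move: w0; clear; lia.
have no0 w : w \in nb A v -> out A v w != 0.
  move=> wN; apply/negP => o0; move/eqP: u0; rewrite cards_eq0 => /eqP/setP/(_ w).
  by rewrite in_set0 inE wN o0.
have zprop w : w \in W -> exists2 z, nb A w :\: (v |: nb A v) = [set z] &
    [/\ z \in A, z != v & z \in A :\: clnb A [set v]].
  rewrite inE => /andP[wN /cards1P[z Ez]]; exists z => //.
  have : z \in nb A w :\: (v |: nb A v) by rewrite Ez set11.
  rewrite !inE negb_or => /andP[/andP[zv zn] /andP[zA ewz]]; rewrite zA in zn *.
  split=> //; rewrite andbT (negPf zv) /=; apply: contra zn => /exists_inP[x /set1P->].
  by move->.
have forced w z : w \in W -> nb A w :\: (v |: nb A v) = [set z] -> forall F, F \in Max A -> part F [set v] -> z \in F.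
  move=> wW Ez F FM pF; have wN : w \in nb A v by move: wW; rewrite inE => /andP[].
  by have [x xF] := iso_forced FM vA pF wN; rewrite Ez => /set1P <-.
have cH : #|A :\: clnb A [set v]| = #|A| - 5 by rewrite card_Dclnb card_clnb1 // d4.
have IHH : below (A :\: clnb A [set v]) := below_subset IH (subsetDl _ _).
have [w2|w3] := leqP #|W| 2.
  have n7 : 7 <= #|A|.
    have [w wN wW] : exists2 w, w \in nb A v & w \notin W.
      by apply/subsetPn; apply/negP => /subset_leq_card; rewrite d4; move: w2; clear; lia.
    have := no0 w wN; move: wW; rewrite inE wN /= => o1 o0.
    by have := out_card vA wN; rewrite d4; move: o0 o1; clear; lia.
  apply: (bounded_branch vA (below_D1 IH vA) (leq_trans bnd (leq_add iB S3))).
  have [m En] : exists m, #|A| = m + 7 by exists (#|A| - 7); rewrite subnK.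
  rewrite En -!addnBA // -[7 - 1]/6 -[7 - 5]/2 -[7 - (4 + 2)]/1 -[7 - (4 + 3)]/0 addn0.
  have ar : fb (m + 6) + fb (m + 2) + 2 * fb (m + 1) + 2 * fb m < fb (m + 7) by clear; fb_arith m.
  have mono : fb m <= fb (m + 1) by apply/fb_leq/leq_addr.
  move: w2 ar mono; case: #|W| => [|[|[|k]]] // _; clear; lia.
have [w wW] : exists w, w \in W by apply/card_gt0P; apply: leq_trans w3.
have [z Ez [zA zv zH]] := zprop w wW.
move: W4; rewrite leq_eqVlt => /orP[/eqP W4|W4]; last first.
  have E3 : #|W| = 3 by apply/eqP; rewrite eqn_leq w3 andbT.
  have n7 : 7 <= #|A|.
    have [w' wN wW'] : exists2 w, w \in nb A v & w \notin W.
      by apply/subsetPn; apply/negP => /subset_leq_card; rewrite d4 E3.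
    have := no0 w' wN; move: wW'; rewrite inE wN /= => o1 o0.
    by have := out_card vA wN; rewrite d4; move: o0 o1; clear; lia.
  have f1 := cnt_mem1_lt IHH zH; rewrite cH in f1.
  have i1 : iso A v <= cnt (A :\: clnb A [set v]) [set z].
    have Z : [set z] :\ v = [set z] by apply/setDidPl; rewrite disjoints1 inE.
    by rewrite -Z; apply: iso_cnt => // F FM pF; rewrite sub1set; exact: (forced w).
  apply: (bounded_branch vA (below_D1 IH vA) (leq_trans bnd (leq_add (leqnn _) S3))).
  have [m En] : exists m, #|A| = m + 7 by exists (#|A| - 7); rewrite subnK.
  move: f1 i1; rewrite E3 En -!addnBA // -[7 - 1]/6 -[7 - 5]/2 -[7 - (4 + 2)]/1 -[7 - (4 + 3)]/0 addn0.
  have ar : 9 * fb (m + 6) + 8 * fb (m + 2) + 27 * fb (m + 1) + 9 * fb m <= 9 * fb (m + 7) by clear; fb_arith m.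
  move: ar; clear; lia.
have EW : W = nb A v.
  by apply/eqP; rewrite eqEcard W4 d4 andbT; apply/subsetP => x; rewrite inE => /andP[].
have [/forall_inP same|/forall_inPn[w' w'W ne]] := boolP [forall w' in W, nb A w' :\: (v |: nb A v) == [set z]].
  by apply: (bounded_shared_outer IH vA zA d4 (max4 z zA)) => x xN; apply/eqP/same; rewrite EW.
have [z' Ez' [zA' zv' zH']] := zprop w' w'W.
have zz : z != z' by apply: contraNneq ne => ->; rewrite Ez'.
have r12H : (#|A :\: clnb A [set v]| %% 5 == 1) || (#|A :\: clnb A [set v]| %% 5 == 2).
  by move: r12; rewrite cH -{1 2}(subnK (ltnW n6)) modnDr.
have f2 := cnt_mem2_lt IHH zH zH' zz r12H; rewrite cH in f2.
have i2 : iso A v <= cnt (A :\: clnb A [set v]) [set z; z'].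
  have Z : [set z; z'] :\ v = [set z; z'].
    by apply/setDidPl; rewrite disjoint_sym disjoints1 !inE negb_or !(eq_sym v) zv.
  rewrite -[leqRHS]/(cnt _ [set z; z']) -Z; apply: iso_cnt => // F FM pF; rewrite subUset !sub1set.
  by rewrite (forced _ _ wW Ez F FM pF) (forced _ _ w'W Ez' F FM pF).
apply: (bounded_branch vA (below_D1 IH vA) (leq_trans bnd (leq_add (leqnn _) S2))).
have [m En] : exists m, #|A| = m + 6 by exists (#|A| - 6); rewrite subnK.
have e6 : #|A| - 5 - 1 = m by rewrite En -subnDA addnK.
rewrite e6 in f2; move: f2 i2 r12; rewrite En -!addnBA // -[6 - 1]/5 -[6 - (4 + 2)]/0 addn0.
have [t [s [s5 Es]]] := residue5 m; rewrite Es -!addnA modnMDl => f2 i2 r12.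
have s2 : s < 2 by move: r12 s5; case: s {Es f2} => [|[|[|[|[|s]]]]].
have w0 : 0 < 10 ^ t by rewrite expn_gt0.
move: f2; rewrite !fb_shift; move: i2 w0.
by case: s s5 s2 {Es r12} => [|[|s]] // _ _; rewrite !fbE; clear; lia.
Qed.

Lemma bounded_degree4 A v : below A -> v \in A -> #|nb A v| = 4 -> (forall x, x \in A -> #|nb A x| <= 4) ->
  bounded A.
Proof.
move=> IH vA d4 max4; have [all0|] := out0_dichotomy vA.
  by apply: (bounded_closed_nbhd IH vA _ all0); rewrite d4.
rewrite d4 => -[]; case Eu : #|_| => [|[|[|[|u]]]] // _ n6.
- exact: bounded_degree4_out0 IH vA d4 max4 Eu n6.
- exact: bounded_degree4_out1 A v IH vA d4 Eu n6.
- exact: bounded_degree4_out2 A v IH vA d4 Eu n6.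
- exact: bounded_degree4_out3 A v IH vA d4 max4 Eu n6.
Qed.

(** * Degree at most three *)

(** Lists instead of sets, so that membership in a pattern and the size of a certificate reduce by
    computation. *)
Definition partl F s := part F [set x in s].

(* s' is a certificate for |N[s]| >= size s'. *)
Definition dominates A s s' : bool :=
  [&& uniq s', 0 < size s' & all (fun x => (x \in A) && ((x \in s) || has (e^~ x) s)) s'].

Lemma dominates_card A s s' : dominates A s s' -> 0 < size s' <= #|clnb A [set x in s]|.
Proof.
case/and3P=> us -> /allP h; rewrite -(card_uniqP us); apply: subset_leq_card.
apply/subsetP => x /h /andP[xA] /orP[xs|/hasP[y ys eyx]]; apply/clnbP; split=> //.
  by left; rewrite inE.
by right; exists y; rewrite ?inE.
Qed.

Lemma cover_lists A (L : seq (seq T * seq T)) : below A ->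
  (forall F, F \in Max A -> has (fun p => partl F p.1) L) ->
  all (fun p => dominates A p.1 p.2) L ->
  20 * phiS A <= \sum_(p <- L) fb (#|A| - size p.2).
Proof.
move=> IH cov /allP dom.
have := @cover_bound A [seq ([set x in p.1], size p.2) | p <- L] IH.
rewrite big_map; apply=> [F /cov|]; first by rewrite has_map.
by rewrite all_map; apply/allP => p /dom /dominates_card.
Qed.

(** Naming all neighbours of v turns non-adjacency to v into non-membership in an explicit list. *)
Definition nbl A v s := [/\ v \in A, uniq s, all (mem A) s & forall x, x \in A -> e v x = (x \in s)].

Lemma nbl_nb A v s : nbl A v s -> nb A v =i s.
Proof.
case=> vA us /allP sA h x; rewrite inE; case: (boolP (x \in A)) => [/h //|xA].
by apply/esym/negbTE; apply: contra xA => /sA.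
Qed.

Lemma nbl_ex A v s : v \in A -> uniq s -> all (fun x => (x \in A) && e v x) s ->
  exists s', nbl A v (s ++ s') /\ size s + size s' = #|nb A v|.
Proof.
move=> vA us /allP hs; exists [seq x <- enum (nb A v) | x \notin s].
set s' := filter _ _.
have ms' x : (x \in s') = (x \notin s) && (x \in nb A v) by rewrite mem_filter mem_enum.
have eq : nb A v =i s ++ s'.
  move=> x; rewrite mem_cat ms'; case: (boolP (x \in s)) => //= /hs.
  by rewrite inE.
have us' : uniq (s ++ s').
  rewrite cat_uniq us filter_uniq ?enum_uniq // andbT; apply/hasPn => x; rewrite ms'.
  by case/andP.
split; last by rewrite -size_cat -(card_uniqP us'); apply/esym/eq_card.
split=> //; first by apply/allP => x; rewrite -eq inE => /andP[].
by move=> x xA; rewrite -eq inE xA.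
Qed.

Lemma partl_swap F x y : partl F [:: x; y] -> partl F [:: y; x].
Proof.
rewrite /partl; have -> // : [set z in [:: x; y]] = [set z in [:: y; x]].
by apply/setP => z; rewrite !inE orbC.
Qed.

Lemma partl1 F x : partl F [:: x] = part F [set x].
Proof. by congr part; apply/setP => z; rewrite !inE. Qed.

Lemma partl2 F x y : partl F [:: x; y] = part F [set x; y].
Proof. by congr part; apply/setP => z; rewrite !inE. Qed.

(** Lengthens a pattern: when isolation of v forces a further vertex into F, the component of that
    vertex is joined to [[:: v]]. *)
Lemma partl_cat F s s' : partl F s -> partl F s' -> partl F (s ++ s').
Proof.
move=> /partP[h1 h2] /partP[h1' h2']; apply/partP; split.
  by apply/subsetP => x; rewrite inE mem_cat => /orP[]xs; [apply: (subsetP h1)|apply: (subsetP h1')]; rewrite inE.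
move=> x y; rewrite !inE !mem_cat => /orP[xs|xs] yF exy.
  by have := h2 x y; rewrite !inE => ->.
by have := h2' x y; rewrite !inE => ->; rewrite ?orbT.
Qed.

Lemma partl_nb F s x y : partl F s -> x \in s -> y \in F -> e x y -> y \in s.
Proof. by case/partP=> _ h xs yF exy; have := h x y; rewrite !inE; apply. Qed.

Lemma woodl A v s F : F \in Max A -> nbl A v s ->
  [\/ partl F [:: v] /\ (forall w, w \in s -> exists2 x, x \in F & (x != v) && e w x),
      exists2 w, w \in s & partl F [:: v; w],
      v \notin F /\ exists w z, [/\ w \in s, z \in nb A w, z != v & partl F [:: w; z]] |
      v \notin F /\ exists w w', [/\ w \in s, w' \in s, w != w', ~~ e w w' & partl F [:: w; w']]].
Proof.
move=> FM Ns; have Nb := nbl_nb Ns; have [vA _ _ _] := Ns.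
case: (wood FM vA) => [[pF h]|[w wN pF]|[vF [w [z [wN zN zv pF]]]]|[vF [w [w' [wN wN' ne n pF]]]]].
- by constructor 1; rewrite partl1; split=> // w; rewrite -Nb; apply: h.
- by constructor 2; exists w; rewrite ?partl2 -?Nb.
- by constructor 3; split=> //; exists w, z; rewrite partl2 -Nb.
- by constructor 4; split=> //; exists w, w'; rewrite partl2 -!Nb.
Qed.

Lemma woodl_in A v s F : F \in Max A -> nbl A v s -> v \in F ->
  partl F [:: v] \/ exists2 w, w \in s & partl F [:: v; w].
Proof.
move=> FM Ns vF; case: (woodl FM Ns) => [[]|[w]|[]|[]]; rewrite ?vF //; [by left|by right; exists w].
Qed.

Lemma card_ge_seq A s : uniq s -> all (mem A) s -> size s <= #|A|.
Proof. by move=> us /allP sA; rewrite -(card_uniqP us); apply/subset_leq_card/subsetP. Qed.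

Lemma edge x y : e x y -> [/\ e x y, e y x & (x == y) = false].
Proof. by move=> exy; rewrite (e_sym y) exy; split=> //; apply: contraTF exy => /eqP->; rewrite e_irr. Qed.

(** Two vertices are told apart by a third one adjacent to only one of them; many distinctness facts
    behind the certificates arise this way. *)
Lemma neqe x y z : e x y -> e x z = false -> (y == z) = false.
Proof. by move=> exy exz; apply: contraTF exy => /eqP->; rewrite exz. Qed.

(** Reads facts on adjacency and distinctness in either orientation. *)
Ltac known_step :=
  match goal with
  | H : is_true ?P |- context [?P] => rewrite H
  | H : ?P = false |- context [?P] => rewrite H
  | H : is_true (e ?x ?y) |- context [e ?y ?x] => rewrite (e_sym y x) H
  | H : e ?x ?y = false |- context [e ?y ?x] => rewrite (e_sym y x) H
  | H : (?x == ?y) = false |- context [?y == ?x] => rewrite (eq_sym y x) H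
  end.
Ltac known :=
  rewrite /= ?inE /= ?eqxx ?orbT ?andbT ?orbF;
  repeat (known_step; rewrite /= ?orbT ?andbT ?orbF); try done.

Ltac certify := rewrite /dominates /=; repeat (apply/andP; split); known.

(** Finds in the list the pattern that a disjunct of [wood2] or [wood3] provides, up to the order of
    a pair. *)
Ltac patterns :=
  match goal with
  | |- is_true (_ || _) -> _ => case/orP; patterns
  | |- is_true (_ && _) -> _ => case/andP; patterns
  | |- is_true (partl _ _) -> _ =>
      let pF := fresh "pF" in move=> pF; rewrite /= ?pF ?(partl_swap pF) ?orbT; done
  | |- is_true (~~ ?b) -> _ => let n := fresh "n" in move=> n; patterns
  | |- is_true false -> _ => done
  end.

(** [k] is the size of the largest certificate; since [cover_strict] lets it be assumed to fit into
    the graph, n = m + k and all subtractions become exact. *)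
Ltac fb_close n k :=
  let h := fresh "h" in let m := fresh "m" in let Em := fresh "Em" in
  move=> /= h; (have {}h : k <= n by move: h; clear; lia);
  (have [m Em] : exists m, n = m + k by exists (n - k); rewrite subnK);
  rewrite ?(big_cons, big_nil) /= Em -?addnBA //; clear; fb_arith m.

Lemma cover_strict A (L : seq (seq T * seq T)) : below A ->
  (forall F, F \in Max A -> has (fun p => partl F p.1) L) ->
  all (fun p => dominates A p.1 p.2) L ->
  (all (fun p => size p.2 <= #|A|) L -> \sum_(p <- L) fb (#|A| - size p.2) < fb #|A|) ->
  bounded A.
Proof.
move=> IH cov dom lt; left; apply: leq_ltn_trans (cover_lists IH cov dom) (lt _).
apply/allP => p /(allP dom)/dominates_card/andP[_ h]; apply: leq_trans h _.
by apply/subset_leq_card/clnb_sub.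
Qed.

Lemma nbl2P A v a b : nbl A v [:: a; b] ->
  [/\ v \in A, a \in A, b \in A, (e v a) && (e v b) &
      [/\ (a == b) = false, (v == a) = false & (v == b) = false]].
Proof.
case=> vA /= /andP[ab _] /and3P[aA bA _] h.
have [eva evb] : e v a /\ e v b by rewrite !h ?inE ?eqxx ?orbT.
rewrite inE in ab; rewrite eva evb (negPf ab).
by have [_ _ ->] := edge eva; have [_ _ ->] := edge evb.
Qed.

Lemma nbl3P A v a b c : nbl A v [:: a; b; c] ->
  [/\ v \in A, [/\ a \in A, b \in A & c \in A], [/\ e v a, e v b & e v c],
      [/\ (a == b) = false, (a == c) = false & (b == c) = false] &
      [/\ (v == a) = false, (v == b) = false & (v == c) = false]].
Proof.
case=> vA /= /and3P[ab bc _] /and4P[aA bA cA _] h.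
have [eva evb evc] : [/\ e v a, e v b & e v c] by rewrite !h ?inE ?eqxx ?orbT.
move: ab bc; rewrite !inE negb_or => /andP[/negPf-> /negPf->] /negPf->; split=> //.
have [_ _ ->] := edge eva; have [_ _ ->] := edge evb.
by have [_ _ ->] := edge evc.
Qed.

Lemma nblN A v s x : nbl A v s -> x \in A -> x \notin s -> e v x = false.
Proof. by case=> _ _ _ h xA /negPf xs; rewrite h. Qed.

(** The alternatives of [wood] with all neighbours named, ready for [patterns]. If v is isolated in
    F, both lists of further neighbours meet F; the callers use this to exclude the pattern [[:: v]]
    or to refine it. *)
Lemma wood2 A v a b sa sb F : F \in Max A ->
  nbl A v [:: a; b] -> nbl A a (v :: sa) -> nbl A b (v :: sb) ->
  [\/ [/\ partl F [:: v], has (mem F) sa & has (mem F) sb],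
      has (partl F) ([:: [:: v; a]; [:: v; b]] ++ [seq [:: a; z] | z <- sa] ++ [seq [:: b; z] | z <- sb]) |
      ~~ e a b && partl F [:: a; b]].
Proof.
move=> FM Nv Na Nb.
have nbr w sw : nbl A w (v :: sw) -> forall z, z \in nb A w -> z != v -> z \in sw.
  by move=> Nw z; rewrite (nbl_nb Nw) inE => /orP[->|].
have inF w sw : nbl A w (v :: sw) -> (exists2 x, x \in F & (x != v) && e w x) -> has (mem F) sw.
  move=> Nw [x xF /andP[xv ewx]]; apply/hasP; exists x => //; apply: (nbr _ _ Nw) xv.
  by rewrite inE ewx; case/MaxP: FM => /subsetP->.
rewrite !has_cat !has_map /=.
case: (woodl FM Nv) => [[pF hF]|[w ws pF]|[vF [w [z [ws zN zv pF]]]]|[vF [w [w' [ws ws' ne nn pF]]]]].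
- constructor 1; split=> //; [apply: (inF a)|apply: (inF b)] => //; apply: hF; by rewrite !inE eqxx ?orbT.
- by constructor 2; move: ws; rewrite !inE => /orP[]/eqP E; rewrite E in pF; rewrite pF ?orbT.
- constructor 2; move: ws; rewrite !inE => /orP[]/eqP E; rewrite E in pF zN.
    by rewrite (introT hasP (ex_intro2 _ _ z (nbr _ _ Na z zN zv) pF)) !orbT.
  by rewrite (introT hasP (ex_intro2 _ _ z (nbr _ _ Nb z zN zv) pF)) !orbT.
constructor 3; move: ws ws' ne nn; rewrite !inE => /orP[]/eqP E /orP[]/eqP E'; rewrite E E' ?eqxx // => _ nn.
  by rewrite nn -E -E'.
by rewrite e_sym nn; apply: partl_swap; rewrite -E -E'.
Qed.

Lemma wood3 A v a b c sa sb sc F : F \in Max A -> nbl A v [:: a; b; c] ->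
  nbl A a (v :: sa) -> nbl A b (v :: sb) -> nbl A c (v :: sc) ->
  [\/ [/\ partl F [:: v], has (mem F) sa, has (mem F) sb & has (mem F) sc],
      has (partl F) ([:: [:: v; a]; [:: v; b]; [:: v; c]] ++ [seq [:: a; z] | z <- sa] ++
        [seq [:: b; z] | z <- sb] ++ [seq [:: c; z] | z <- sc]) |
      [|| ~~ e a b && partl F [:: a; b], ~~ e a c && partl F [:: a; c] | ~~ e b c && partl F [:: b; c]]].
Proof.
move=> FM Nv Na Nb Nc.
have nbr w sw : nbl A w (v :: sw) -> forall z, z \in nb A w -> z != v -> z \in sw.
  by move=> Nw z; rewrite (nbl_nb Nw) inE => /orP[->|].
have inF w sw : nbl A w (v :: sw) -> (exists2 x, x \in F & (x != v) && e w x) -> has (mem F) sw.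
  move=> Nw [x xF /andP[xv ewx]]; apply/hasP; exists x => //; apply: (nbr _ _ Nw) xv.
  by rewrite inE ewx; case/MaxP: FM => /subsetP->.
rewrite !has_cat !has_map /=.
case: (woodl FM Nv) => [[pF hF]|[w ws pF]|[vF [w [z [ws zN zv pF]]]]|[vF [w [w' [ws ws' ne nn pF]]]]].
- constructor 1; split=> //; [apply: (inF a)|apply: (inF b)|apply: (inF c)] => //; apply: hF; by rewrite !inE eqxx ?orbT.
- by constructor 2; move: ws; rewrite !inE => /or3P[]/eqP E; rewrite E in pF; rewrite pF ?orbT.
- constructor 2; move: ws; rewrite !inE => /or3P[]/eqP E; rewrite E in pF zN.
  + by rewrite (introT hasP (ex_intro2 _ _ z (nbr _ _ Na z zN zv) pF)) !orbT.
  + by rewrite (introT hasP (ex_intro2 _ _ z (nbr _ _ Nb z zN zv) pF)) !orbT.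
  + by rewrite (introT hasP (ex_intro2 _ _ z (nbr _ _ Nc z zN zv) pF)) !orbT.
constructor 3; move: ws ws' ne nn pF; rewrite !inE.
by move=> /or3P[]/eqP-> /or3P[]/eqP->; rewrite ?eqxx // => _ nn pF;
  rewrite ?nn ?pF ?orbT //; rewrite e_sym in nn; rewrite nn (partl_swap pF) ?orbT.
Qed.

(** * Pattern lists at a vertex of degree at most two *)

Lemma bounded_degree0 A v : below A -> nbl A v [::] -> bounded A.
Proof.
move=> IH Nv; have [vA _ _ _] := Nv.
have := cover_lists (L := [:: ([:: v], [:: v])]) IH.
rewrite big_seq1 => h; left; apply: leq_ltn_trans (h _ _) _ => [F FM||].
- case: (woodl FM Nv) => [[pF _]|[w]|[_ [w [z []]]]|[_ [w [w' []]]]] //=.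
  by rewrite pF.
- by rewrite /= /dominates; known.
have n1 : 0 < #|A| by apply/card_gt0P; exists v.
have [m ->] : exists m, #|A| = m + 1 by exists (#|A| - 1); rewrite subnK.
by rewrite addnK; clear; fb_arith m.
Qed.

(** Every pattern except [[:: v]] contains w and so dominates N[w]. *)
Lemma bounded_leaf A v w s : below A -> nbl A v [:: w] -> nbl A w (v :: s) -> size s <= 2 -> bounded A.
Proof.
move=> IH Nv Nw s2; have [vA _ /= /andP[wA _] ev] := Nv; have [_ uw sA ew] := Nw.
have [evw ewv nvw] : [/\ e v w, e w v & (v == w) = false] by apply: edge => //; rewrite ev ?inE.
pose L := ([:: v], [:: v; w]) :: ([:: v; w], w :: v :: s) :: [seq ([:: w; z], w :: v :: s) | z <- s].
have esw x : x \in s -> [/\ x \in A, e w x & (w == x) = false].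
  move=> xs; have xA : x \in A by move: sA => /= /andP[_ /allP]; apply.
  have ewx : e w x by rewrite ew // inE xs orbT.
  by have [] := edge ewx.
have uws : uniq (w :: v :: s).
  rewrite cons_uniq uw andbT inE (eq_sym w v) nvw /=; apply/negP => /esw[_ _].
  by rewrite eqxx.
have dom (S : seq T) : w \in S -> dominates A S (w :: v :: s).
  move=> wS; rewrite /dominates uws /= wA wS vA; apply/and3P; split=> //.
    by apply/orP; right; apply/hasP; exists w.
  apply/allP => x /esw[-> ewx _] /=; apply/orP; right; apply/hasP; by exists w.
have := cover_lists (L := L) IH.
rewrite /L !big_cons big_map => h; left; apply: leq_ltn_trans (h _ _) _ => [F FM||].
- rewrite /= has_map; case: (woodl FM Nv) => [[pF _]|[w']|[_ [w' [z []]]]|[_ [w' [w'' []]]]].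
  + by rewrite pF.
  + by rewrite inE => /eqP-> ->; rewrite orbT.
  + rewrite inE => /eqP->; rewrite (nbl_nb Nw) inE => /orP[->|zs _ pF] //.
    by apply/orP; right; apply/orP; right; apply/hasP; exists z.
  + by rewrite !inE => /eqP-> /eqP->; rewrite eqxx.
- rewrite /= dom ?inE ?eqxx ?orbT // all_map /=; apply/andP; split; first by certify.
  by apply/allP => z _ /=; apply: dom; rewrite inE eqxx.
have nA : size (w :: v :: s) <= #|A|.
  by apply: (card_ge_seq uws); rewrite /= wA vA; move: sA => /= /andP[_ ->].
case: s s2 nA {Nw uw sA ew L esw uws dom h} => [|z1 [|z2 [|z3 s]]] //= _ nA; rewrite !(big_cons, big_nil) /=.
- have [m ->] : exists m, #|A| = m + 2 by exists (#|A| - 2); rewrite subnK.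
  by rewrite -!addnBA //; clear; fb_arith m.
- have [m ->] : exists m, #|A| = m + 3 by exists (#|A| - 3); rewrite subnK.
  by rewrite -!addnBA //; clear; fb_arith m.
- have [m ->] : exists m, #|A| = m + 4 by exists (#|A| - 4); rewrite subnK.
  by rewrite -!addnBA //; clear; fb_arith m.
Qed.

(** Here v is never isolated in F: this would put b, the only neighbour of a besides v, into F, but
    b is adjacent to v. *)
Lemma bounded_triangle22 A v a b : below A ->
  nbl A v [:: a; b] -> nbl A a [:: v; b] -> nbl A b [:: v; a] -> bounded A.
Proof.
move=> IH Nv Na Nb.
have [vA aA bA /andP[eva evb] [ab va vb]] := nbl2P Nv.
have [_ _ _ /andP[_ eab] _] := nbl2P Na.
pose w3 := [:: v; a; b].
apply: (@cover_strict A [:: ([:: v; a], w3); ([:: v; b], w3); ([:: a; b], w3)]) => // [F FM||].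
- case: (wood2 FM Nv Na Nb) => [[pF /= bF _]||]; last by rewrite eab.
    by move: bF; rewrite orbF => bF; have := partl_nb pF (mem_head _ _) bF evb; rewrite inE eq_sym vb.
  by rewrite /=; patterns.
- by certify.
fb_close #|A| 3.
Qed.

Lemma bounded_triangle23 A v a b b' : below A ->
  nbl A v [:: a; b] -> nbl A a [:: v; b] -> nbl A b [:: v; a; b'] -> bounded A.
Proof.
move=> IH Nv Na Nb.
have [vA aA bA /andP[eva evb] [ab va vb]] := nbl2P Nv.
have [_ _ _ /andP[_ eab] _] := nbl2P Na.
have [_ [_ _ bA'] [_ _ ebb'] [_ vb' ab'] [_ _ bb']] := nbl3P Nb.
pose w3 := [:: v; a; b]; pose w4 := [:: v; a; b; b'].
apply: (@cover_strict A [:: ([:: v; a], w3); ([:: v; b], w4); ([:: a; b], w4); ([:: b; b'], w4)]) => // [F FM||].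
- case: (wood2 FM Nv Na Nb) => [[pF /= bF _]||]; last by rewrite eab.
    by move: bF; rewrite orbF => bF; have := partl_nb pF (mem_head _ _) bF evb; rewrite inE eq_sym vb.
  by rewrite /=; patterns.
- by certify.
fb_close #|A| 4.
Qed.

(** The witnesses c and d raise the certificates of [[:: a; a']] and [[:: b; b']] to five vertices;
    with four, the count at n = 7 would be 120 + 5 * 72 = 480 against 450. *)
Lemma bounded_triangle33 A v a b a' b' c d : below A ->
  nbl A v [:: a; b] -> nbl A a [:: v; b; a'] -> nbl A b [:: v; a; b'] ->
  c \in A -> c \notin [:: v; a; b; a'] -> e a' c ->
  d \in A -> d \notin [:: v; a; b; b'] -> e b' d -> bounded A.
Proof.
move=> IH Nv Na Nb cA cn ea'c dA dn eb'd.
have [vA aA bA /andP[eva evb] [ab va vb]] := nbl2P Nv.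
have [_ [_ _ a'A] [_ eab eaa'] [_ va' ba'] [_ _ aa']] := nbl3P Na.
have [_ [_ _ b'A] [_ _ ebb'] [_ vb' ab'] [_ _ bb']] := nbl3P Nb.
move: cn; rewrite !inE !negb_or => /and4P[/negPf cv /negPf ca /negPf cb /negPf ca'].
move: dn; rewrite !inE !negb_or => /and4P[/negPf dv /negPf da /negPf db /negPf db'].
pose w3 := [:: v; a; b].
apply: (@cover_strict A [:: ([:: v], w3); ([:: v; a], a' :: w3); ([:: v; b], b' :: w3); ([:: a; b], a' :: w3);
  ([:: a; a'], c :: a' :: w3); ([:: b; b'], d :: b' :: w3)]) => // [F FM||].
- case: (wood2 FM Nv Na Nb) => [[pF _ _]||]; last by rewrite eab.
    by rewrite /= pF.
  by rewrite /=; patterns.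
- by certify.
fb_close #|A| 5.
Qed.

Lemma nblNs A v s x : nbl A v s -> x \in A -> x \notin s -> e x v = false.
Proof. by move=> Nv xA xs; rewrite e_sym (nblN Nv). Qed.

(** The cycle v a c b is attached to the rest only by the edge from c to z. A set with v isolated
    contains c, the only further neighbour of a; hence the patterns [[:: c]] and [[:: c; z]] replace
    [[:: v]]. *)
Lemma bounded_square A v a b c z y : below A ->
  nbl A v [:: a; b] -> nbl A a [:: v; c] -> nbl A b [:: v; c] -> nbl A c [:: a; b; z] ->
  y \in A -> e z y -> (y == c) = false -> bounded A.
Proof.
move=> IH Nv Na Nb Nc yA ezy yc.
have [vA aA bA /andP[eva evb] [ab va vb]] := nbl2P Nv.
have [_ _ cA /andP[_ eac] [vc _ ac]] := nbl2P Na.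
have [_ _ _ /andP[_ ebc] [_ _ bc]] := nbl2P Nb.
have [_ [_ _ zA] [eca ecb ecz] [_ az bz] [_ _ cz]] := nbl3P Nc.
have ncv : e c v = false by apply: (nblNs Nv) => //; known.
have vz : (v == z) = false by rewrite eq_sym; apply: neqe ecz ncv.
have nza : e z a = false by apply: (nblNs Na) => //; known.
have nzb : e z b = false by apply: (nblNs Nb) => //; known.
have ya := neqe ezy nza; have yb := neqe ezy nzb.
have [_ _ zy] := edge ezy.
have nab : e a b = false by apply: (nblN Na) => //; known.
pose w4 := [:: v; a; b; c].
apply: (@cover_strict A [:: ([:: c], [:: c; a; b; z]); ([:: c; z], [:: c; a; b; z; y]);
  ([:: v; a], w4); ([:: v; b], w4); ([:: a; c], z :: w4); ([:: b; c], z :: w4); ([:: a; b], w4)]) => // [F FM||].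
- case: (wood2 FM Nv Na Nb) => [[pF /= cF _]||].
  + move: cF; rewrite orbF => cF; have [pc|[w ws]] := woodl_in FM Nc cF; first by rewrite pc.
    by move: ws; rewrite !inE => /or3P[]/eqP->; rewrite /=; patterns.
  + by rewrite /=; patterns.
  + by rewrite /=; patterns.
- by certify.
fb_close #|A| 5.
Qed.

(** If v is isolated in F, then a', the only further neighbour of a, lies in F, so [[:: v]] is
    joined with the component of a'. With [[:: v]] alone the count at n = 7 would be 120 + 4 * 72 +
    45 = 453 against 450. *)
Lemma bounded_path22_2 A v a b a' b' c d : below A -> e a b = false ->
  nbl A v [:: a; b] -> nbl A a [:: v; a'] -> nbl A b [:: v; b'] -> (a' == b') = false ->
  nbl A a' [:: a; c] -> d \in A -> e b' d -> (d == b) = false -> bounded A.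
Proof.
move=> IH nab Nv Na Nb ab' Na' dA eb'd db.
have [vA aA bA /andP[eva evb] [ab va vb]] := nbl2P Nv.
have [_ _ a'A /andP[_ eaa'] [va' _ aa']] := nbl2P Na.
have [_ _ b'A /andP[_ ebb'] [vb' _ bb']] := nbl2P Nb.
have [_ _ cA /andP[_ ea'c] [ac _ a'c]] := nbl2P Na'.
have ba' : (b == a') = false by rewrite eq_sym; apply: neqe eaa' nab.
have abb : (a == b') = false by rewrite eq_sym; apply: (neqe ebb'); rewrite e_sym.
have na'v : e a' v = false by apply: (nblNs Nv) => //; known.
have nb'v : e b' v = false by apply: (nblNs Nv) => //; known.
have na'b : e a' b = false by apply: (nblNs Nb) => //; known.
have cv := neqe ea'c na'v; have cb := neqe ea'c na'b; have dv := neqe eb'd nb'v.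
have [_ _ b'd] := edge eb'd.
pose w5 := [:: v; a; b; a'; c].
apply: (@cover_strict A [:: ([:: v; a'], w5); ([:: v; a'; c], w5);
  ([:: v; a], [:: v; a; b; a']); ([:: v; b], [:: v; a; b; b']); ([:: a; a'], [:: a; a'; v; c]);
  ([:: b; b'], [:: b; b'; v; d]); ([:: a; b], [:: v; a; b; a'; b'])]) => // [F FM||].
- case: (wood2 FM Nv Na Nb) => [[pF /= cF _]||].
  + move: cF; rewrite orbF => cF; have [pc|[w ws pc]] := woodl_in FM Na' cF.
      by have := partl_cat pF pc; rewrite /=; patterns.
    have := partl_cat pF pc; move: ws pc; rewrite !inE => /orP[]/eqP-> /=.
      (* If a' is paired with a, the listed pattern [[:: a; a']] already covers F. *)
      by move=> pc _; move: pc; patterns.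
    by move=> _ pc; rewrite pc ?orbT.
  + by rewrite /=; patterns.
  + by rewrite /=; patterns.
- by certify.
fb_close #|A| 5.
Qed.

Lemma bounded_path22_3 A v a b a' b' c c' d : below A -> e a b = false ->
  nbl A v [:: a; b] -> nbl A a [:: v; a'] -> nbl A b [:: v; b'] -> (a' == b') = false ->
  nbl A a' [:: a; c; c'] -> d \in A -> e b' d -> (d == b) = false -> bounded A.
Proof.
move=> IH nab Nv Na Nb ab' Na' dA eb'd db.
have [vA aA bA /andP[eva evb] [ab va vb]] := nbl2P Nv.
have [_ _ a'A /andP[_ eaa'] [va' _ aa']] := nbl2P Na.
have [_ _ b'A /andP[_ ebb'] [vb' _ bb']] := nbl2P Nb.
have [_ [_ cA c'A] [_ ea'c ea'c'] [ac ac' cc'] [_ a'c a'c']] := nbl3P Na'.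
have ba' : (b == a') = false by rewrite eq_sym; apply: neqe eaa' nab.
have abb : (a == b') = false by rewrite eq_sym; apply: (neqe ebb'); rewrite e_sym.
have na'v : e a' v = false by apply: (nblNs Nv) => //; known.
have nb'v : e b' v = false by apply: (nblNs Nv) => //; known.
have na'b : e a' b = false by apply: (nblNs Nb) => //; known.
have cv := neqe ea'c na'v; have cb := neqe ea'c na'b; have dv := neqe eb'd nb'v.
have c'v := neqe ea'c' na'v; have c'b := neqe ea'c' na'b.
have [_ _ b'd] := edge eb'd.
pose w6 := [:: v; a; b; a'; c; c'].
apply: (@cover_strict A [:: ([:: v; a'], w6); ([:: v; a'; c], w6); ([:: v; a'; c'], w6);
  ([:: v; a], [:: v; a; b; a']); ([:: v; b], [:: v; a; b; b']); ([:: a; a'], [:: a; a'; v; c]);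
  ([:: b; b'], [:: b; b'; v; d]); ([:: a; b], [:: v; a; b; a'; b'])]) => // [F FM||].
- case: (wood2 FM Nv Na Nb) => [[pF /= cF _]||].
  + move: cF; rewrite orbF => cF; have [pc|[w ws pc]] := woodl_in FM Na' cF.
      by have := partl_cat pF pc; rewrite /=; patterns.
    have := partl_cat pF pc; move: ws pc; rewrite !inE => /or3P[]/eqP-> /=.
    * by move=> pc _; move: pc; patterns.
    * by move=> _ pc; rewrite pc ?orbT.
    * by move=> _ pc; rewrite pc ?orbT.
  + by rewrite /=; patterns.
  + by rewrite /=; patterns.
- by certify.
fb_close #|A| 6.
Qed.

Lemma bounded_path23_far A v a b a' b1 b2 c c' y1 y2 : below A -> e a b = false ->
  nbl A v [:: a; b] -> nbl A a [:: v; a'] -> nbl A b [:: v; b1; b2] -> e a' b = false ->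
  nbl A a' [:: a; c; c'] -> y1 \in A -> e b1 y1 -> y1 \notin [:: b; b2] ->
  y2 \in A -> e b2 y2 -> y2 \notin [:: b; b1] -> bounded A.
Proof.
move=> IH nab Nv Na Nb na'b Na' y1A eb1y n1 y2A eb2y n2.
have [vA aA bA /andP[eva evb] [ab va vb]] := nbl2P Nv.
have [_ _ a'A /andP[_ eaa'] [va' _ aa']] := nbl2P Na.
have [_ [_ b1A b2A] [_ ebb1 ebb2] [vb1 vb2 b12] [_ bb1 bb2]] := nbl3P Nb.
have [_ [_ cA c'A] [_ ea'c ea'c'] [ac ac' cc'] [_ a'c a'c']] := nbl3P Na'.
have ba' : (b == a') = false by rewrite eq_sym; apply: neqe eaa' nab.
have nba : e b a = false by rewrite e_sym.
have nba' : e b a' = false by rewrite e_sym.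
have b1a := neqe ebb1 nba; have b2a := neqe ebb2 nba.
have b1a' := neqe ebb1 nba'; have b2a' := neqe ebb2 nba'.
have na'v : e a' v = false by apply: (nblNs Nv) => //; known.
have nb1v : e b1 v = false by apply: (nblNs Nv) => //; known.
have nb2v : e b2 v = false by apply: (nblNs Nv) => //; known.
have cv := neqe ea'c na'v; have cb := neqe ea'c na'b.
have c'v := neqe ea'c' na'v; have c'b := neqe ea'c' na'b.
have y1v := neqe eb1y nb1v; have y2v := neqe eb2y nb2v.
have [_ _ b1y] := edge eb1y; have [_ _ b2y] := edge eb2y.
move: n1 n2; rewrite !inE !negb_or => /andP[/negPf y1b /negPf y1b2] /andP[/negPf y2b /negPf y2b1].
pose w6 := [:: v; a; b; a'; c; c'].
apply: (@cover_strict A [:: ([:: v; a'], w6); ([:: v; a'; c], w6); ([:: v; a'; c'], w6);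
  ([:: v; a], [:: v; a; b; a']); ([:: v; b], [:: v; a; b; b1; b2]); ([:: a; a'], [:: a; a'; v; c; c']);
  ([:: b; b1], [:: b; b1; v; b2; y1]); ([:: b; b2], [:: b; b1; v; b2; y2]);
  ([:: a; b], [:: v; a; b; a'; b1; b2])]) => // [F FM||].
- case: (wood2 FM Nv Na Nb) => [[pF /= cF _]||].
  + move: cF; rewrite orbF => cF; have [pc|[w ws pc]] := woodl_in FM Na' cF.
      by have := partl_cat pF pc; rewrite /=; patterns.
    have := partl_cat pF pc; move: ws pc; rewrite !inE => /or3P[]/eqP-> /=.
    * by move=> pc _; move: pc; patterns.
    * by move=> _ pc; rewrite pc ?orbT.
    * by move=> _ pc; rewrite pc ?orbT.
  + by rewrite /=; patterns.
  + by rewrite /=; patterns.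
- by certify.
fb_close #|A| 6.
Qed.

(** Here a' is also adjacent to b, so v, a, a', b form a four-cycle. *)
Lemma bounded_path23_near A v a b a' b2 c y2 : below A -> e a b = false ->
  nbl A v [:: a; b] -> nbl A a [:: v; a'] -> nbl A b [:: v; a'; b2] ->
  nbl A a' [:: a; b; c] ->
  y2 \in A -> e b2 y2 -> y2 \notin [:: b; a'] -> bounded A.
Proof.
move=> IH nab Nv Na Nb Na' y2A eb2y n2.
have [vA aA bA /andP[eva evb] [ab va vb]] := nbl2P Nv.
have [_ _ a'A /andP[_ eaa'] [va' _ aa']] := nbl2P Na.
have [_ [_ _ b2A] [_ eba' ebb2] [_ vb2 a'b2] [_ ba' bb2]] := nbl3P Nb.
have [_ [_ _ cA] [_ _ ea'c] [_ ac bc] [_ _ a'c]] := nbl3P Na'.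
have nba : e b a = false by rewrite e_sym.
have b2a := neqe ebb2 nba.
have na'v : e a' v = false by apply: (nblNs Nv) => //; known.
have nb2v : e b2 v = false by apply: (nblNs Nv) => //; known.
have cv := neqe ea'c na'v; have y2v := neqe eb2y nb2v.
have [_ _ b2y] := edge eb2y.
move: n2; rewrite !inE !negb_or => /andP[/negPf y2b /negPf y2a'].
pose w5 := [:: v; a; b; a'; c].
apply: (@cover_strict A [:: ([:: v; a'], w5); ([:: v; a'; c], w5);
  ([:: v; a], [:: v; a; b; a']); ([:: v; b], [:: v; a; b; a'; b2]); ([:: a; a'], w5);
  ([:: b; a'], w5); ([:: b; b2], [:: b; b2; v; a'; y2]);
  ([:: a; b], [:: v; a; b; a'; b2])]) => // [F FM||].
- case: (wood2 FM Nv Na Nb) => [[pF /= cF _]||].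
  + move: cF; rewrite orbF => cF; have [pc|[w ws pc]] := woodl_in FM Na' cF.
      by have := partl_cat pF pc; rewrite /=; patterns.
    have := partl_cat pF pc; move: ws pc; rewrite !inE => /or3P[]/eqP-> /=.
    * by move=> pc _; move: pc; patterns.
    * by move=> pc _; move: pc; patterns.
    * by move=> _ pc; rewrite pc ?orbT.
  + by rewrite /=; patterns.
  + by rewrite /=; patterns.
- by certify.
fb_close #|A| 5.
Qed.

(** With the four further vertices x1, x2, y1, y2 all patterns but [[:: v]] dominate five vertices,
    and [[:: v]] needs no refinement: 120 + 7 * 45 = 435 against 450 at n = 7. *)
Lemma bounded_path33 A v a b a1 a2 b1 b2 x1 x2 y1 y2 : below A -> e a b = false ->
  nbl A v [:: a; b] -> nbl A a [:: v; a1; a2] -> nbl A b [:: v; b1; b2] ->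
  x1 \in A -> e a1 x1 -> x1 \notin [:: a; a2] -> x2 \in A -> e a2 x2 -> x2 \notin [:: a; a1] ->
  y1 \in A -> e b1 y1 -> y1 \notin [:: b; b2] -> y2 \in A -> e b2 y2 -> y2 \notin [:: b; b1] -> bounded A.
Proof.
move=> IH nab Nv Na Nb x1A ea1x m1 x2A ea2x m2 y1A eb1y n1 y2A eb2y n2.
have [vA aA bA /andP[eva evb] [ab va vb]] := nbl2P Nv.
have [_ [_ a1A a2A] [_ eaa1 eaa2] [va1 va2 a12] [_ aa1 aa2]] := nbl3P Na.
have [_ [_ b1A b2A] [_ ebb1 ebb2] [vb1 vb2 b12] [_ bb1 bb2]] := nbl3P Nb.
have nba : e b a = false by rewrite e_sym.
have b1a := neqe ebb1 nba; have b2a := neqe ebb2 nba.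
have a1b := neqe eaa1 nab; have a2b := neqe eaa2 nab.
have na1v : e a1 v = false by apply: (nblNs Nv) => //; known.
have na2v : e a2 v = false by apply: (nblNs Nv) => //; known.
have nb1v : e b1 v = false by apply: (nblNs Nv) => //; known.
have nb2v : e b2 v = false by apply: (nblNs Nv) => //; known.
have y1v := neqe eb1y nb1v; have y2v := neqe eb2y nb2v.
have x1v := neqe ea1x na1v; have x2v := neqe ea2x na2v.
have [_ _ b1y] := edge eb1y; have [_ _ b2y] := edge eb2y.
have [_ _ a1x] := edge ea1x; have [_ _ a2x] := edge ea2x.
move: n1 n2; rewrite !inE !negb_or => /andP[/negPf y1b /negPf y1b2] /andP[/negPf y2b /negPf y2b1].
move: m1 m2; rewrite !inE !negb_or => /andP[/negPf x1a /negPf x1a2] /andP[/negPf x2a /negPf x2a1].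
pose wa := [:: v; a; b; a1; a2].
apply: (@cover_strict A [:: ([:: v], [:: v; a; b]);
  ([:: v; a], wa); ([:: v; b], [:: v; a; b; b1; b2]);
  ([:: a; a1], [:: a; a1; v; a2; x1]); ([:: a; a2], [:: a; a1; v; a2; x2]);
  ([:: b; b1], [:: b; b1; v; b2; y1]); ([:: b; b2], [:: b; b1; v; b2; y2]);
  ([:: a; b], wa)]) => // [F FM||].
- case: (wood2 FM Nv Na Nb) => [[pF _ _]||].
  + by rewrite /= pF.
  + by rewrite /=; patterns.
  + by rewrite /=; patterns.
- by certify.
fb_close #|A| 5.
Qed.

(** * Pattern lists in cubic graphs *)

Lemma bounded_diamond A v u w1 w2 z1 z2 y1 y2 : below A -> e w1 w2 = false ->
  nbl A v [:: u; w1; w2] -> nbl A u [:: v; w1; w2] ->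
  nbl A w1 [:: v; u; z1] -> nbl A w2 [:: v; u; z2] ->
  y1 \in A -> e z1 y1 -> (y1 == w1) = false -> y2 \in A -> e z2 y2 -> (y2 == w2) = false ->
  bounded A.
Proof.
move=> IH nw Nv Nu Nw1 Nw2 y1A ez1y y1w y2A ez2y y2w.
have [vA [uA w1A w2A] [evu evw1 evw2] [uw1 uw2 w12] [vu vw1 vw2]] := nbl3P Nv.
have [_ _ [_ euw1 euw2] _ _] := nbl3P Nu.
have [_ [_ _ z1A] [_ _ ew1z] [_ vz1 uz1] [_ _ w1z]] := nbl3P Nw1.
have [_ [_ _ z2A] [_ _ ew2z] [_ vz2 uz2] [_ _ w2z]] := nbl3P Nw2.
have z1w2 := neqe ew1z nw.
have nw' : e w2 w1 = false by rewrite e_sym.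
have z2w1 := neqe ew2z nw'.
have nz1v : e z1 v = false by apply: (nblNs Nv) => //; known.
have nz1u : e z1 u = false by apply: (nblNs Nu) => //; known.
have nz2v : e z2 v = false by apply: (nblNs Nv) => //; known.
have nz2u : e z2 u = false by apply: (nblNs Nu) => //; known.
have y1v := neqe ez1y nz1v; have y1u := neqe ez1y nz1u.
have y2v := neqe ez2y nz2v; have y2u := neqe ez2y nz2u.
have [_ _ z1y] := edge ez1y; have [_ _ z2y] := edge ez2y.
pose w4 := [:: v; u; w1; w2].
apply: (@cover_strict A [:: ([:: v; u], w4); ([:: v; w1], z1 :: w4); ([:: v; w2], z2 :: w4);
  ([:: u; w1], z1 :: w4); ([:: u; w2], z2 :: w4); ([:: w1; z1], [:: v; u; w1; z1; y1]);
  ([:: w2; z2], [:: v; u; w2; z2; y2]); ([:: w1; w2], z1 :: w4)]) => // [F FM||].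
(* A set with v isolated would have to contain w1 or w2, the other neighbours of u, but both are
   adjacent to v. *)
- case: (wood3 FM Nv Nu Nw1 Nw2) => [[pF /= + _ _]||].
  + rewrite orbF => /orP[] wF.
      by have := partl_nb pF (mem_head _ _) wF evw1; rewrite inE eq_sym vw1.
    by have := partl_nb pF (mem_head _ _) wF evw2; rewrite inE eq_sym vw2.
  + by rewrite /=; patterns.
  + by rewrite euw1 euw2 /=; patterns.
- by certify.
fb_close #|A| 5.
Qed.

(** The hypotheses exclude a second triangle on an edge of the triangle v a b, so the third
    neighbours c, a', b' of its vertices are distinct. *)
Lemma bounded_triangle_cubic A v a b c a' b' c1 c2 p p' q q' y1 y2 : below A ->
  nbl A v [:: a; b; c] -> nbl A a [:: v; b; a'] -> nbl A b [:: v; a; b'] -> nbl A c [:: v; c1; c2] ->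
  (a' == b') = false -> e a c = false -> e b c = false ->
  nbl A a' [:: a; p; p'] -> nbl A b' [:: b; q; q'] ->
  y1 \in A -> e c1 y1 -> y1 \notin [:: c; c2] -> y2 \in A -> e c2 y2 -> y2 \notin [:: c; c1] ->
  bounded A.
Proof.
move=> IH Nv Na Nb Nc ab' nac nbc Na' Nb' y1A ec1y n1 y2A ec2y n2.
have [vA [aA bA cA] [eva evb evc] [ab ac bc] [va vb vc]] := nbl3P Nv.
have [_ [_ _ a'A] [_ eab eaa'] [_ va' ba'] [_ _ aa']] := nbl3P Na.
have [_ [_ _ b'A] [_ _ ebb'] [_ vb' abb'] [_ _ bb']] := nbl3P Nb.
have [_ [_ c1A c2A] [_ ecc1 ecc2] [vc1 vc2 c12] [_ cc1 cc2]] := nbl3P Nc.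
have [_ [_ pA p'A] [_ ea'p ea'p'] [ap ap' pp'] [_ a'p a'p']] := nbl3P Na'.
have [_ [_ qA q'A] [_ eb'q eb'q'] [bq bq' qq'] [_ b'q b'q']] := nbl3P Nb'.
have ca' : (c == a') = false by rewrite eq_sym; apply: neqe eaa' nac.
have cb' : (c == b') = false by rewrite eq_sym; apply: neqe ebb' nbc.
have na'v : e a' v = false by apply: (nblNs Nv) => //; known.
have nb'v : e b' v = false by apply: (nblNs Nv) => //; known.
have na'b : e a' b = false by apply: (nblNs Nb) => //; known.
have nb'a : e b' a = false by apply: (nblNs Na) => //; known.
have nca : e c a = false by rewrite e_sym.
have ncb : e c b = false by rewrite e_sym.
have c1a := neqe ecc1 nca; have c2a := neqe ecc2 nca.
have c1b := neqe ecc1 ncb; have c2b := neqe ecc2 ncb.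
have nc1v : e c1 v = false by apply: (nblNs Nv) => //; known.
have nc2v : e c2 v = false by apply: (nblNs Nv) => //; known.
have pv := neqe ea'p na'v; have p'v := neqe ea'p' na'v.
have pb := neqe ea'p na'b; have p'b := neqe ea'p' na'b.
have qv := neqe eb'q nb'v; have q'v := neqe eb'q' nb'v.
have qa := neqe eb'q nb'a; have q'a := neqe eb'q' nb'a.
have y1v := neqe ec1y nc1v; have y2v := neqe ec2y nc2v.
have [_ _ c1y] := edge ec1y; have [_ _ c2y] := edge ec2y.
move: n1 n2; rewrite !inE !negb_or => /andP[/negPf y1c /negPf y1c2] /andP[/negPf y2c /negPf y2c1].
pose w4 := [:: v; a; b; c]; pose w6 := [:: v; a; b; c; c1; c2].
apply: (@cover_strict A [:: ([:: v], w4); ([:: v; a], a' :: w4); ([:: v; b], b' :: w4);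
  ([:: v; c], w6); ([:: a; b], [:: v; a; b; a'; b']); ([:: a; a'], [:: v; a; b; a'; p; p']);
  ([:: b; b'], [:: v; a; b; b'; q; q']); ([:: c; c1], [:: c; v; c1; c2; y1]); ([:: c; c2], [:: c; v; c1; c2; y2]);
  ([:: a; c], w6); ([:: b; c], w6)]) => // [F FM||].
- case: (wood3 FM Nv Na Nb Nc) => [[pF _ _ _]||].
  + by rewrite /= pF.
  + by rewrite /=; patterns.
  + by rewrite /=; patterns.
- by certify.
fb_close #|A| 6.
Qed.

Section TriangleFree.
Variables (A : {set T}) (v a b c a1 a2 b1 b2 c1 c2 : T).
Hypotheses (IH : below A) (Nv : nbl A v [:: a; b; c]).
Hypotheses (Na : nbl A a [:: v; a1; a2]) (Nb : nbl A b [:: v; b1; b2]) (Nc : nbl A c [:: v; c1; c2]).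
Hypothesis cubic : forall x, x \in A -> #|nb A x| = 3.
Hypothesis tri_free : forall x y z, x \in A -> y \in A -> z \in A -> e x y -> e x z -> e y z = false.

(** Without triangles the ends of an edge have disjoint neighbourhoods, so in a cubic graph an edge
    dominates six vertices. *)
Lemma edge_witness x y p q : nbl A x [:: v; p; q] -> e v x -> y \in [:: p; q] ->
  exists s, dominates A [:: x; y] s && (size s == 6).
Proof.
move=> Nx evx yN; have [xA [vA pA qA] [exv exp exq] [vp vq pq] [xv xp xq]] := nbl3P Nx.
have [yA exy] : y \in A /\ e x y by move: yN; rewrite !inE => /orP[]/eqP->.
have eyx : e y x by rewrite e_sym.
have [|r [Ny]] := @nbl_ex A y [:: x] yA isT; first by rewrite /= xA eyx.
rewrite cubic // => /eqP; case: r Ny => [|r [|r' [|]]] //= Ny _.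
have [_ [_ rA r'A] [_ eyr eyr'] [xr xr' rr'] [_ yr yr']] := nbl3P Ny.
have nxr : e x r = false by apply: (tri_free yA xA rA).
have nxr' : e x r' = false by apply: (tri_free yA xA r'A).
have vr : (v == r) = false by apply: neqe exv nxr.
have vr' : (v == r') = false by apply: neqe exv nxr'.
have pr : (p == r) = false by apply: neqe exp nxr.
have pr' : (p == r') = false by apply: neqe exp nxr'.
have qr : (q == r) = false by apply: neqe exq nxr.
have qr' : (q == r') = false by apply: neqe exq nxr'.
by exists [:: x; v; p; q; r; r']; rewrite andbT; certify.
Qed.

(** Of the 13 patterns, [[:: v]] dominates four vertices, the nine edges at a, b, c dominate six
    each, and the three pairs of neighbours of v five or more. The count is strict once two pairs
    dominate six: at n = 6 it is 45 + 11 * 20 + 30 = 295 against 300. A pair stays at five only if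
    both have the same neighbours, and two such pairs force K_{3,3}. *)
Lemma bounded_triangle_free_cubic : bounded A.
Proof.
have [vA [aA bA cA] [eva evb evc] [ab ac bc] [va vb vc]] := nbl3P Nv.
have [_ [_ a1A a2A] [_ eaa1 eaa2] [va1 va2 a12] [_ aa1 aa2]] := nbl3P Na.
have [_ [_ b1A b2A] [_ ebb1 ebb2] [vb1 vb2 b12] [_ bb1 bb2]] := nbl3P Nb.
have [_ [_ c1A c2A] [_ ecc1 ecc2] [vc1 vc2 c12] [_ cc1 cc2]] := nbl3P Nc.
have nab : e a b = false by apply: (tri_free vA).
have nac : e a c = false by apply: (tri_free vA).
have nbc : e b c = false by apply: (tri_free vA).
have nba : e b a = false by rewrite e_sym.
have nca : e c a = false by rewrite e_sym.
have ncb : e c b = false by rewrite e_sym.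
have a1b := neqe eaa1 nab; have a2b := neqe eaa2 nab; have a1c := neqe eaa1 nac; have a2c := neqe eaa2 nac.
have b1a := neqe ebb1 nba; have b2a := neqe ebb2 nba; have b1c := neqe ebb1 nbc; have b2c := neqe ebb2 nbc.
have c1a := neqe ecc1 nca; have c2a := neqe ecc2 nca; have c1b := neqe ecc1 ncb; have c2b := neqe ecc2 ncb.
have [s1 /andP[d1 /eqP e1]] := edge_witness Na eva (mem_head a1 [:: a2]).
have [s2 /andP[d2 /eqP e2]] := @edge_witness a a2 _ _ Na eva ltac:(by rewrite !inE eqxx orbT).
have [s3 /andP[d3 /eqP e3]] := edge_witness Nb evb (mem_head b1 [:: b2]).
have [s4 /andP[d4 /eqP e4]] := @edge_witness b b2 _ _ Nb evb ltac:(by rewrite !inE eqxx orbT).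
have [s5 /andP[d5 /eqP e5]] := edge_witness Nc evc (mem_head c1 [:: c2]).
have [s6 /andP[d6 /eqP e6]] := @edge_witness c c2 _ _ Nc evc ltac:(by rewrite !inE eqxx orbT).
pose w4 := [:: v; a; b; c].
pose L sab sac sbc := [:: ([:: v], w4); ([:: v; a], a1 :: a2 :: w4); ([:: v; b], b1 :: b2 :: w4);
  ([:: v; c], c1 :: c2 :: w4); ([:: a; a1], s1); ([:: a; a2], s2); ([:: b; b1], s3); ([:: b; b2], s4);
  ([:: c; c1], s5); ([:: c; c2], s6); ([:: a; b], sab); ([:: a; c], sac); ([:: b; c], sbc)].
have cov sab sac sbc F : F \in Max A -> has (fun p => partl F p.1) (L sab sac sbc).
  move=> FM; case: (wood3 FM Nv Na Nb Nc) => [[pF _ _ _]||].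
  - by rewrite /= pF.
  - by rewrite /=; patterns.
  - by rewrite /=; patterns.
have dom sab sac sbc : dominates A [:: a; b] sab -> dominates A [:: a; c] sac ->
    dominates A [:: b; c] sbc -> all (fun p => dominates A p.1 p.2) (L sab sac sbc).
  move=> h1 h2 h3; rewrite /= d1 d2 d3 d4 d5 d6 h1 h2 h3 !andbT; certify.
have wab : dominates A [:: a; b] [:: v; a; b; a1; a2] by certify.
have wac : dominates A [:: a; c] [:: v; a; c; a1; a2] by certify.
have wbc : dominates A [:: b; c] [:: v; b; c; b1; b2] by certify.
have good x y p q r : x \in A -> y \in A -> p \in A -> q \in A -> r \in A -> (x == y) = false ->
    nbl A x [:: v; p; q] -> e y v -> e x y = false -> e y r -> (v == r) = false -> e x r = false ->
    dominates A [:: x; y] [:: v; x; y; p; q; r].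
  move=> xA yA pA qA rA xy Nx eyv nxy eyr vr nxr.
  have [_ _ [exv exp exq] [vp vq pq] [xv xp xq]] := nbl3P Nx.
  have yv : (y == v) = false by have [] := edge eyv.
  have yp : (p == y) = false by apply: neqe exp nxy.
  have yq : (q == y) = false by apply: neqe exq nxy.
  have yr : (y == r) = false by have [] := edge eyr.
  have pr : (p == r) = false by apply: neqe exp nxr.
  have qr : (q == r) = false by apply: neqe exq nxr.
  have xr : (x == r) = false by rewrite eq_sym; apply: (neqe eyr); rewrite e_sym.
  by certify.
(* Each of the 13 patterns leaves at most two of the six vertices, hence a single maximal set: 13 is
   below 15. *)
have six : #|A| = 6 -> bounded A.
  move=> A6; left; rewrite A6 fbE.
  pose K := L [:: v; a; b; a1; a2] [:: v; a; c; a1; a2] [:: v; b; c; b1; b2].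
  have cov' F : F \in Max A -> has (part F) [seq [set x in p.1] | p <- K].
    by move=> FM; rewrite has_map; apply: cov.
  have one p : p \in K -> phiS (A :\: clnb A [set x in p.1]) = 1.
    move=> pK; apply: phiS_le2 => //; rewrite card_Dclnb A6.
    have /dominates_card/andP[_] := allP (dom _ _ _ wab wac wbc) p pK.
    have : all (fun p => 3 < size p.2) K by rewrite /= e1 e2 e3 e4 e5 e6.
    by move/allP/(_ p pK) => /=; clear; lia.
  have := cover_seq cov'; rewrite big_map (eq_big_seq _ one) big_const_seq count_predT iter_addn_0.
  by rewrite /= mul1n; clear; lia.
have inN x p q y : nbl A x [:: v; p; q] -> y \in A -> (v == y) = false -> e x y -> y \in [:: p; q].
  by move=> [_ _ _ h] yA vy; rewrite h // inE eq_sym vy.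
have sub2 (p q r r' : T) : (r == r') = false -> r \in [:: p; q] -> r' \in [:: p; q] -> [:: p; q] =i [:: r; r'].
  move=> ne; rewrite !inE => /orP[]/eqP Er /orP[]/eqP Er' x; move: ne; rewrite Er Er' !inE ?eqxx //.
  by rewrite orbC.
have adj x p q y : nbl A x [:: v; p; q] -> y \in [:: p; q] -> e x y.
  case=> _ _ /and4P[_ pA qA _] h yN.
  have yA : y \in A by move: yN; rewrite !inE => /orP[]/eqP->.
  by rewrite h // inE yN orbT.
(* This is K_{3,3} with parts {v, a1, a2} and {a, b, c}: closed under adjacency, hence a proper
   union of components or the whole graph. *)
have all_same : e a b1 -> e a b2 -> e a c1 -> e a c2 -> bounded A.
  move=> ab1 ab2 ac1 ac2.
  have Eb := sub2 _ _ _ _ b12 (inN _ _ _ _ Na b1A vb1 ab1) (inN _ _ _ _ Na b2A vb2 ab2).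
  have Ec := sub2 _ _ _ _ c12 (inN _ _ _ _ Na c1A vc1 ac1) (inN _ _ _ _ Na c2A vc2 ac2).
  pose C := [set x in [:: v; a; b; c; a1; a2]].
  have CA : C \subset A by apply/subsetP => x; rewrite !inE => /or4P[|||/or3P[]]/eqP->.
  have Ny y : y \in [:: a1; a2] -> nbl A y [:: a; b; c].
    move=> yN; have yA : y \in A by move: yN; rewrite !inE => /orP[]/eqP->.
    have eya : e y a by rewrite e_sym (adj _ _ _ _ Na).
    have eyb : e y b by rewrite e_sym (adj _ _ _ _ Nb) -?Eb.
    have eyc : e y c by rewrite e_sym (adj _ _ _ _ Nc) -?Ec.
    have [| |s [Ns]] := @nbl_ex A y [:: a; b; c] yA; first by known.
      by rewrite /= aA bA cA eya eyb eyc.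
    by rewrite cubic // => /eqP; case: s Ns.
  have clC x y : x \in C -> y \in A -> e x y -> y \in C.
    have st w s : nbl A w s -> {subset s <= C} -> y \in A -> e w y -> y \in C.
      by move=> [_ _ _ h] sC yA; rewrite h // => /sC.
    rewrite [x \in C]inE -[x \in _]/(x \in [:: v; a; b; c] ++ [:: a1; a2]) mem_cat => /orP[xm|/Ny N] yA exy.
      rewrite !inE in xm; case/or4P: xm exy => /eqP-> exy.
      + by apply: (st _ _ Nv _ yA exy) => z; rewrite !inE => /or3P[]->; rewrite ?orbT.
      + by apply: (st _ _ Na _ yA exy) => z; rewrite !inE => /or3P[]->; rewrite ?orbT.
      + by apply: (st _ _ Nb _ yA exy) => z; rewrite inE -Eb !inE => /or3P[]->; rewrite ?orbT.
      + by apply: (st _ _ Nc _ yA exy) => z; rewrite inE -Ec !inE => /or3P[]->; rewrite ?orbT.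
    by apply: (st _ _ N _ yA exy) => z; rewrite !inE => /or3P[]->; rewrite ?orbT.
  have [E|/eqP ne] := eqVneq C A.
    apply: six; rewrite -E cardsE; apply/eqP.
    by rewrite -[6]/(size [:: v; a; b; c; a1; a2]); apply/eqP/card_uniqP; known.
  by apply: (bounded_closed IH CA (x := v)) => //; rewrite !inE eqxx.
have evb' : e b v by rewrite e_sym.
have evc' : e c v by rewrite e_sym.
have gab : (e a b1 && e a b2) = false -> exists2 s, dominates A [:: a; b] s & size s = 6.
  move/negbT; rewrite negb_and => /orP[]/negPf n.
    by exists [:: v; a; b; a1; a2; b1] => //; apply: good.
  by exists [:: v; a; b; a1; a2; b2] => //; apply: good.
have gac : (e a c1 && e a c2) = false -> exists2 s, dominates A [:: a; c] s & size s = 6.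
  move/negbT; rewrite negb_and => /orP[]/negPf n.
    by exists [:: v; a; c; a1; a2; c1] => //; apply: good.
  by exists [:: v; a; c; a1; a2; c2] => //; apply: good.
have gbc : (e b c1 && e b c2) = false -> exists2 s, dominates A [:: b; c] s & size s = 6.
  move/negbT; rewrite negb_and => /orP[]/negPf n.
    by exists [:: v; b; c; b1; b2; c1] => //; apply: good.
  by exists [:: v; b; c; b1; b2; c2] => //; apply: good.
(* Having the same neighbours is transitive, so unless all three of a, b, c agree, at most one pair
   does. *)
case Bab: (e a b1 && e a b2); case Bac: (e a c1 && e a c2).
- by case/andP: Bab => ? ?; case/andP: Bac => ? ?; apply: all_same.
- have [s8 d8 e8] := gac Bac.
  have [|s9 d9 e9] := gbc.
    apply/negP => /andP[bc1 bc2]; case/andP: Bab => ab1 ab2; case/negP: Bac.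
    have Eb := sub2 _ _ _ _ b12 (inN _ _ _ _ Na b1A vb1 ab1) (inN _ _ _ _ Na b2A vb2 ab2).
    by rewrite !(adj _ _ _ _ Na) // Eb; [apply: inN Nb _ _ bc2|apply: inN Nb _ _ bc1].
  apply: (cover_strict IH (cov _ _ _) (dom _ _ _ wab d8 d9)).
  rewrite /L !(big_cons, big_nil) /= e1 e2 e3 e4 e5 e6 e8 e9.
  fb_close #|A| 6.
- have [s7 d7 e7] := gab Bab.
  have [|s9 d9 e9] := gbc.
    apply/negP => /andP[bc1 bc2]; case/andP: Bac => ac1 ac2; case/negP: Bab.
    have Ea := sub2 _ _ _ _ c12 (inN _ _ _ _ Na c1A vc1 ac1) (inN _ _ _ _ Na c2A vc2 ac2).
    have Eb := sub2 _ _ _ _ c12 (inN _ _ _ _ Nb c1A vc1 bc1) (inN _ _ _ _ Nb c2A vc2 bc2).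
    by rewrite !(adj _ _ _ _ Na) // Ea -Eb !inE eqxx ?orbT.
  apply: (cover_strict IH (cov _ _ _) (dom _ _ _ d7 wac d9)).
  rewrite /L !(big_cons, big_nil) /= e1 e2 e3 e4 e5 e6 e7 e9.
  fb_close #|A| 6.
have [s7 d7 e7] := gab Bab; have [s8 d8 e8] := gac Bac.
apply: (cover_strict IH (cov _ _ _) (dom _ _ _ d7 d8 wbc)).
rewrite /L !(big_cons, big_nil) /= e1 e2 e3 e4 e5 e6 e7 e8.
fb_close #|A| 6.
Qed.

End TriangleFree.

(** * Finding one of the configurations *)

Lemma nbl_perm A v s s' : perm_eq s s' -> nbl A v s -> nbl A v s'.
Proof.
move=> ps [vA us sA h]; split; rewrite -?(perm_uniq ps) -?(perm_all _ ps) //.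
by move=> x xA; rewrite -(perm_mem ps) h.
Qed.

Lemma nbl_size A v s : nbl A v s -> #|nb A v| = size s.
Proof. by move=> N; rewrite (eq_card (nbl_nb N)); apply/card_uniqP; case: N. Qed.

Section Core.
Variable A : {set T}.
Hypotheses (IH : below A) (deg23 : forall x, x \in A -> 1 < #|nb A x| <= 3).

(** On four vertices, minimum degree two already means K4*, which is extremal, so no strict count
    can settle this case. *)
Lemma bounded_closed4 s : size s = 4 -> uniq s -> all (mem A) s ->
  (forall x y, x \in s -> y \in A -> e x y -> y \in s) -> bounded A.
Proof.
move=> s4 us /allP sA cl; pose C := [set x in s].
have CA : C \subset A by apply/subsetP => x; rewrite inE => /sA.
have [x xs] : exists x, x \in s by case: s s4 {us sA cl C CA} => [|x s] // _; exists x; apply: mem_head.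
have [E|/eqP ne] := eqVneq C A; last first.
  apply: (bounded_closed IH CA (x := x)) ne; first by rewrite inE.
  by move=> y z; rewrite !inE; apply: cl.
have A4 : #|A| = 4 by rewrite -E cardsE -s4; apply/card_uniqP.
right; apply: Kstar_ext; rewrite ?A4 //; apply/(KstarP) => y yA.
by rewrite A4 -[4]/(2 + 2) leq_add2r; case/andP: (deg23 yA).
Qed.

Lemma nb1 w u : w \in A -> u \in A -> e w u ->
  (exists p, nbl A w [:: u; p]) \/ (exists p q, nbl A w [:: u; p; q]).
Proof.
move=> wA uA ewu; have [|s [N]] := @nbl_ex A w [:: u] wA isT; first by rewrite /= uA ewu.
have := deg23 wA; case: s N => [|p [|q [|r s]]] N dw /= E; rewrite -E // in dw.
  by left; exists p.
by right; exists p, q.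
Qed.

Lemma nb2 w u u' : w \in A -> u \in A -> u' \in A -> (u == u') = false -> e w u -> e w u' ->
  nbl A w [:: u; u'] \/ (exists p, nbl A w [:: u; u'; p]).
Proof.
move=> wA uA uA' ne ewu ewu'; have [||s [N]] := @nbl_ex A w [:: u; u'] wA.
- by rewrite /= inE ne.
- by rewrite /= uA ewu uA' ewu'.
have := deg23 wA; case: s N => [|p [|q s]] N dw /= E; rewrite -E // in dw; first by left.
by right; exists p.
Qed.

Lemma other w u : w \in A -> exists y, [/\ y \in A, e w y & (y == u) = false].
Proof.
move=> wA; have [/exists_inP[y]|n] := boolP [exists y in nb A w, y != u].
  by rewrite inE => /andP[yA ewy] /negPf; exists y.
case/andP: (deg23 wA) => d _; exfalso.
suff : #|nb A w| <= #|[set u]| by rewrite cards1; move: d; clear; lia.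
apply: subset_leq_card; apply/subsetP => y yN; rewrite inE.
by move/exists_inPn: n => /(_ y yN); rewrite negbK.
Qed.

(** If a' has no neighbour besides a and b, minimum degree two makes it adjacent to both, so a' = b'
    and the four vertices are closed under adjacency. *)
Lemma outer_apex v a b a' b' : nbl A v [:: a; b] -> nbl A a [:: v; b; a'] -> nbl A b [:: v; a; b'] ->
  bounded A \/ exists c, [/\ c \in A, c \notin [:: v; a; b; a'] & e a' c].
Proof.
move=> Nv Na Nb.
have [vA aA bA /andP[eva evb] [ab va vb]] := nbl2P Nv.
have [_ [_ _ a'A] [_ eab eaa'] [_ va' ba'] [_ _ aa']] := nbl3P Na.
have [/exists_inP[c]|/exists_inPn n] := boolP [exists c in nb A a', c \notin [:: a; b]].
  rewrite !inE negb_or => /andP[cA ea'c] /andP[ca cb]; right; exists c; rewrite cA ea'c; split=> //.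
  have na'v : e a' v = false by apply: (nblNs Nv) => //; known.
  have [_ _ a'c] := edge ea'c.
  by rewrite !inE !negb_or ca cb (neqe ea'c na'v) (eq_sym c a') a'c.
left; have sub y : y \in A -> e a' y -> y \in [:: a; b].
  by move=> yA ea'y; have := n y; rewrite inE yA ea'y negbK; apply.
have ea'b : e a' b.
  have [y [yA ea'y ya]] := other a a'A.
  by have := sub y yA ea'y; rewrite !inE ya /= => /eqP <-.
have a'b' : a' = b'.
  have [_ _ _ /(_ a' a'A)] := Nb; rewrite e_sym ea'b !inE (eq_sym a' v) va' (eq_sym a' a) aa' /=.
  by move/esym/eqP.
subst b'; apply: (@bounded_closed4 [:: v; a; b; a']) => //; first by known.
  by rewrite /= vA aA bA a'A.
have st w s y : nbl A w s -> {subset s <= [:: v; a; b; a']} -> y \in A -> e w y -> y \in [:: v; a; b; a'].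
  by move=> [_ _ _ h] sC yA; rewrite h // => /sC.
move=> x y xm yA exy; rewrite !inE in xm; case/or4P: xm exy => /eqP-> exy.
- by apply: (st _ _ _ Nv _ yA exy) => z; rewrite !inE => /orP[]->; rewrite ?orbT.
- by apply: (st _ _ _ Na _ yA exy) => z; rewrite !inE => /or3P[]->; rewrite ?orbT.
- by apply: (st _ _ _ Nb _ yA exy) => z; rewrite !inE => /or3P[]->; rewrite ?orbT.
- by have := sub y yA exy; rewrite !inE => /orP[]->; rewrite ?orbT.
Qed.

Lemma bounded_triangle_case v a b : nbl A v [:: a; b] -> e a b -> bounded A.
Proof.
move=> Nv eab; have [vA aA bA /andP[eva evb] [ab va vb]] := nbl2P Nv.
have Nv' : nbl A v [:: b; a] by apply: nbl_perm Nv; rewrite (perm_catC [:: a] [:: b]).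
have eba : e b a by rewrite e_sym.
have eav : e a v by rewrite e_sym.
have ebv : e b v by rewrite e_sym.
have [Na|[a' Na]] := nb2 aA vA bA vb eav eab; have [Nb|[b' Nb]] := nb2 bA vA aA va ebv eba.
- exact: bounded_triangle22 _ _ _ _ IH Nv Na Nb.
- exact: bounded_triangle23 _ _ _ _ _ IH Nv Na Nb.
- exact: bounded_triangle23 _ _ _ _ _ IH Nv' Nb Na.
have [//|[c [cA cn ea'c]]] := outer_apex Nv Na Nb.
have [//|[d [dA dn eb'd]]] := outer_apex Nv' Nb Na.
have dn' : d \notin [:: v; a; b; b'] by move: dn; rewrite !inE !negb_or => /and4P[-> -> -> ->].
exact: (bounded_triangle33 IH Nv Na Nb cA cn ea'c dA dn' eb'd).
Qed.

(** If all neighbours of b1 lie in {b, b2}, then b1 has degree two and lies in a triangle, a case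
    already settled. *)
Lemma outer_nb v b b1 b2 : nbl A b [:: v; b1; b2] ->
  bounded A \/ exists y, [/\ y \in A, e b1 y & y \notin [:: b; b2]].
Proof.
move=> Nb; have [bA [vA b1A b2A] [ebv ebb1 ebb2] [vb1 vb2 b12] [_ bb1 bb2]] := nbl3P Nb.
have [/exists_inP[y]|/exists_inPn n] := boolP [exists y in nb A b1, y \notin [:: b; b2]].
  by rewrite inE => /andP[yA eb1y] yn; right; exists y.
have sub y : y \in A -> e b1 y -> y \in [:: b; b2].
  by move=> yA ey; have := n y; rewrite inE yA ey negbK; apply.
have eb1b : e b1 b by rewrite e_sym.
have [y [yA ey yb]] := other b b1A.
have := sub y yA ey; rewrite !inE yb /= => /eqP Ey; rewrite Ey in ey.
left; have [N|[p N]] := nb2 b1A bA b2A bb2 eb1b ey; first exact: bounded_triangle_case N ebb2.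
have [_ [_ _ pA] [_ _ ep] [_ bp b2p] _] := nbl3P N.
by have := sub p pA ep; rewrite !inE eq_sym bp eq_sym b2p.
Qed.

Lemma bounded_degree2_22 v a b a' b' : nbl A v [:: a; b] -> nbl A a [:: v; a'] -> nbl A b [:: v; b'] -> bounded A.
Proof.
move=> Nv Na Nb; case nab: (e a b); first exact: bounded_triangle_case Nv nab.
have [vA aA bA /andP[eva evb] [ab va vb]] := nbl2P Nv.
have [_ _ a'A /andP[_ eaa'] [va' _ aa']] := nbl2P Na.
have [_ _ b'A /andP[_ ebb'] [vb' _ bb']] := nbl2P Nb.
have ea'a : e a' a by rewrite e_sym.
have eb'b : e b' b by rewrite e_sym.
case ab': (a' == b').
  (* A common outer neighbour closes a four-cycle, which is itself a K4* if the fourth vertex has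
     degree two as well. *)
  move/eqP: ab' => E; subst b'.
  have [Nc|[z Nc]] := nb2 a'A aA bA ab ea'a eb'b; last first.
    have [_ [_ _ zA] _ _ _] := nbl3P Nc.
    have [y [yA ezy yc]] := other a' zA.
    exact: bounded_square _ _ _ _ _ _ _ IH Nv Na Nb Nc yA ezy yc.
  apply: (@bounded_closed4 [:: v; a; b; a']) => //; first by known.
    by rewrite /= vA aA bA a'A.
  have st w s y : nbl A w s -> {subset s <= [:: v; a; b; a']} -> y \in A -> e w y -> y \in [:: v; a; b; a'].
    by move=> [_ _ _ h] sC yA; rewrite h // => /sC.
  move=> x y xm yA exy; rewrite !inE in xm; case/or4P: xm exy => /eqP-> exy.
  - by apply: (st _ _ _ Nv _ yA exy) => z; rewrite !inE => /orP[]->; rewrite ?orbT.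
  - by apply: (st _ _ _ Na _ yA exy) => z; rewrite !inE => /orP[]->; rewrite ?orbT.
  - by apply: (st _ _ _ Nb _ yA exy) => z; rewrite !inE => /orP[]->; rewrite ?orbT.
  - by apply: (st _ _ _ Nc _ yA exy) => z; rewrite !inE => /orP[]->; rewrite ?orbT.
have [d [dA eb'd db]] := other b b'A.
have [[c Nc]|[c [c' Nc]]] := nb1 a'A aA ea'a.
  exact: bounded_path22_2 _ _ _ _ _ _ _ _ IH nab Nv Na Nb ab' Nc dA eb'd db.
exact: bounded_path22_3 _ _ _ _ _ _ _ _ _ IH nab Nv Na Nb ab' Nc dA eb'd db.
Qed.

Lemma nbl_swap v x p q : nbl A v [:: x; p; q] -> nbl A v [:: x; q; p].
Proof. by apply: nbl_perm; rewrite perm_cons (perm_catC [:: p] [:: q]). Qed.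

Lemma bounded_degree2_23 v a b a' b1 b2 : nbl A v [:: a; b] -> nbl A a [:: v; a'] -> nbl A b [:: v; b1; b2] -> bounded A.
Proof.
move=> Nv Na Nb; case nab: (e a b); first exact: bounded_triangle_case Nv nab.
have [vA aA bA /andP[eva evb] [ab va vb]] := nbl2P Nv.
have [_ _ a'A /andP[_ eaa'] [va' _ aa']] := nbl2P Na.
have ea'a : e a' a by rewrite e_sym.
(* If a' has degree two, then both neighbours v and a' of a have degree two, and the previous lemma
   applies at a. *)
have [[p Np]|[c [c' Nc]]] := nb1 a'A aA ea'a; first exact: bounded_degree2_22 Na Nv Np.
have [//|[y1 [y1A ey1 n1]]] := outer_nb Nb.
have [//|[y2 [y2A ey2 n2]]] := outer_nb (nbl_swap Nb).
case ea'b: (e a' b); last first.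
  exact: bounded_path23_far _ _ _ _ _ _ _ _ _ _ _ IH nab Nv Na Nb ea'b Nc y1A ey1 n1 y2A ey2 n2.
have [N|[d N]] := nb2 a'A aA bA ab ea'a ea'b.
  by have := nbl_size N; rewrite (nbl_size Nc).
have := Nb; case=> _ _ _ /(_ a' a'A); rewrite e_sym ea'b !inE (eq_sym a' v) va' /=.
move/esym/orP=> [/eqP E|/eqP E]; subst a'.
  exact: bounded_path23_near _ _ _ _ _ _ _ _ IH nab Nv Na Nb N y2A ey2 n2.
exact: bounded_path23_near _ _ _ _ _ _ _ _ IH nab Nv Na (nbl_swap Nb) N y1A ey1 n1.
Qed.

Lemma bounded_degree2_case v : v \in A -> #|nb A v| = 2 -> bounded A.
Proof.
move=> vA d2; have [|s [Nv]] := @nbl_ex A v [::] vA isT; first by [].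
rewrite d2; case: s Nv => [|a [|b [|]]] //= Nv _.
have [_ aA bA /andP[eva evb] [ab va vb]] := nbl2P Nv.
have Nv' : nbl A v [:: b; a] by apply: nbl_perm Nv; rewrite (perm_catC [:: a] [:: b]).
have eav : e a v by rewrite e_sym.
have ebv : e b v by rewrite e_sym.
have [[a' Na]|[a1 [a2 Na]]] := nb1 aA vA eav; have [[b' Nb]|[b1 [b2 Nb]]] := nb1 bA vA ebv.
- exact: bounded_degree2_22 Nv Na Nb.
- exact: bounded_degree2_23 Nv Na Nb.
- exact: bounded_degree2_23 Nv' Nb Na.
case nab: (e a b); first exact: bounded_triangle_case Nv nab.
have [//|[y1 [y1A ey1 n1]]] := outer_nb Nb.
have [//|[y2 [y2A ey2 n2]]] := outer_nb (nbl_swap Nb).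
have [//|[x1 [x1A ex1 m1]]] := outer_nb Na.
have [//|[x2 [x2A ex2 m2]]] := outer_nb (nbl_swap Na).
exact: bounded_path33 _ _ _ _ _ _ _ _ _ _ _ _ IH nab Nv Na Nb x1A ex1 m1 x2A ex2 m2 y1A ey1 n1 y2A ey2 n2.
Qed.

Hypothesis cubic : forall x, x \in A -> #|nb A x| = 3.

Lemma cubic1 w u : w \in A -> u \in A -> e w u -> exists p q, nbl A w [:: u; p; q].
Proof.
move=> wA uA ewu; have [[p N]|//] := nb1 wA uA ewu.
by have := nbl_size N; rewrite cubic.
Qed.

Lemma cubic2 w u u' : w \in A -> u \in A -> u' \in A -> (u == u') = false -> e w u -> e w u' ->
  exists p, nbl A w [:: u; u'; p].
Proof.
move=> wA uA uA' ne ewu ewu'; have [N|//] := nb2 wA uA uA' ne ewu ewu'.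
by have := nbl_size N; rewrite cubic.
Qed.

Lemma other2 w u u' : w \in A -> exists y, [/\ y \in A, e w y & y \notin [:: u; u']].
Proof.
move=> wA; have [/exists_inP[y]|n] := boolP [exists y in nb A w, y \notin [:: u; u']].
  by rewrite inE => /andP[yA ewy] yn; exists y.
suff : #|nb A w| <= 2 by rewrite cubic.
apply: leq_trans (_ : #|[set u; u']| <= 2); last by rewrite cards2; case: (_ != _).
apply: subset_leq_card; apply/subsetP => y yN.
by move/exists_inPn: n => /(_ y yN); rewrite negbK !inE.
Qed.

(** If w1 and w2 are adjacent as well, the four vertices form a K4 closed under adjacency. *)
Lemma bounded_diamond_case v u w1 w2 : nbl A v [:: u; w1; w2] -> e u w1 -> e u w2 -> bounded A.
Proof.
move=> Nv euw1 euw2; have [vA [uA w1A w2A] [evu evw1 evw2] [uw1 uw2 w12] [vu vw1 vw2]] := nbl3P Nv.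
have euv : e u v by rewrite e_sym.
have ew1v : e w1 v by rewrite e_sym.
have ew2v : e w2 v by rewrite e_sym.
have ew1u : e w1 u by rewrite e_sym.
have ew2u : e w2 u by rewrite e_sym.
have Nu : nbl A u [:: v; w1; w2].
  have [||s [N]] := @nbl_ex A u [:: v; w1; w2] uA; first by known.
    by rewrite /= vA w1A w2A euv euw1 euw2.
  by rewrite cubic // => /eqP; case: s N.
have [z1 Nw1] := cubic2 w1A vA uA vu ew1v ew1u.
have [z2 Nw2] := cubic2 w2A vA uA vu ew2v ew2u.
have [_ [_ _ z1A] _ [_ vz1 uz1] [_ _ wz1]] := nbl3P Nw1.
have [_ [_ _ z2A] _ [_ vz2 uz2] [_ _ wz2]] := nbl3P Nw2.
case ew: (e w1 w2); last first.
  have [y1 [y1A ey1 n1]] := other w1 z1A; have [y2 [y2A ey2 n2]] := other w2 z2A.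
  exact: bounded_diamond _ _ _ _ _ _ _ _ _ IH ew Nv Nu Nw1 Nw2 y1A ey1 n1 y2A ey2 n2.
have E1 : w2 = z1.
  by have := Nw1; case=> _ _ _ /(_ w2 w2A); rewrite ew !inE eq_sym vw2 eq_sym uw2 => /esym/eqP.
have E2 : w1 = z2.
  by have := Nw2; case=> _ _ _ /(_ w1 w1A); rewrite e_sym ew !inE eq_sym vw1 eq_sym uw1 => /esym/eqP.
subst z1 z2.
apply: (@bounded_closed4 [:: v; u; w1; w2]) => //; first by known.
  by rewrite /= vA uA w1A w2A.
have st w s y : nbl A w s -> {subset s <= [:: v; u; w1; w2]} -> y \in A -> e w y -> y \in [:: v; u; w1; w2].
  by move=> [_ _ _ h] sC yA; rewrite h // => /sC.
move=> x y xm yA exy; rewrite !inE in xm; case/or4P: xm exy => /eqP-> exy.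
- by apply: (st _ _ _ Nv _ yA exy) => z; rewrite !inE => /or3P[]->; rewrite ?orbT.
- by apply: (st _ _ _ Nu _ yA exy) => z; rewrite !inE => /or3P[]->; rewrite ?orbT.
- by apply: (st _ _ _ Nw1 _ yA exy) => z; rewrite !inE => /or3P[]->; rewrite ?orbT.
- by apply: (st _ _ _ Nw2 _ yA exy) => z; rewrite !inE => /or3P[]->; rewrite ?orbT.
Qed.

(** A second triangle on an edge of the triangle v a b gives a diamond; otherwise the hypotheses of
    [bounded_triangle_cubic] hold. *)
Lemma bounded_triangle_cubic_case v a b c : nbl A v [:: a; b; c] -> e a b -> bounded A.
Proof.
move=> Nv eab; have [vA [aA bA cA] [eva evb evc] [ab ac bc] [va vb vc]] := nbl3P Nv.
have eba : e b a by rewrite e_sym.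
have eav : e a v by rewrite e_sym.
have ebv : e b v by rewrite e_sym.
have ecv : e c v by rewrite e_sym.
case nac: (e a c); first exact: bounded_diamond_case Nv eab nac.
case nbc: (e b c).
  by apply: (@bounded_diamond_case v b a c) => //; apply: nbl_perm Nv; rewrite (perm_cat2r [:: c] [:: a; b] [:: b; a]) (perm_catC [:: a] [:: b]).
have [a' Na] := cubic2 aA vA bA vb eav eab.
have [b' Nb] := cubic2 bA vA aA va ebv eba.
have [_ [_ _ a'A] [_ _ eaa'] _ _] := nbl3P Na.
have [_ [_ _ b'A] [_ _ ebb'] _ _] := nbl3P Nb.
case ab': (a' == b').
  move/eqP: ab' => E; subst b'.
  by apply: (@bounded_diamond_case a b v a') => //; apply: nbl_perm Na; rewrite (perm_cat2r [:: a'] [:: v; b] [:: b; v]) (perm_catC [:: v] [:: b]).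
have [c1 [c2 Nc]] := cubic1 cA vA ecv.
have [_ [_ c1A c2A] _ _ _] := nbl3P Nc.
have ea'a : e a' a by rewrite e_sym.
have eb'b : e b' b by rewrite e_sym.
have [p [p' Np]] := cubic1 a'A aA ea'a; have [q [q' Nq]] := cubic1 b'A bA eb'b.
have [y1 [y1A ey1 n1]] := other2 c c2 c1A; have [y2 [y2A ey2 n2]] := other2 c c1 c2A.
exact: bounded_triangle_cubic _ _ _ _ _ _ _ _ _ _ _ _ _ _ _ IH Nv Na Nb Nc ab' nac nbc Np Nq y1A ey1 n1 y2A ey2 n2.
Qed.

Lemma bounded_cubic_case v : v \in A -> bounded A.
Proof.
move=> vA.
have [/existsP[x /existsP[y /existsP[z /and5P[xA yA zA /andP[exy exz] eyz]]]]|tf] :=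
    boolP [exists x, exists y, exists z, [&& x \in A, y \in A, z \in A, e x y && e x z & e y z]].
  have [_ _ yz] := edge eyz.
  have [p Nx] := cubic2 xA yA zA yz exy exz.
  exact: bounded_triangle_cubic_case Nx eyz.
have tri x y z : x \in A -> y \in A -> z \in A -> e x y -> e x z -> e y z = false.
  move=> xA yA zA exy exz; apply/negP => eyz; case/negP: tf.
  by apply/existsP; exists x; apply/existsP; exists y; apply/existsP; exists z; rewrite xA yA zA exy exz eyz.
have [|s [Nv]] := @nbl_ex A v [::] vA isT; first by [].
rewrite cubic //; case: s Nv => [|a [|b [|c [|]]]] //= Nv _.
have [_ [aA bA cA] [eva evb evc] _ _] := nbl3P Nv.
have eav : e a v by rewrite e_sym.
have ebv : e b v by rewrite e_sym.
have ecv : e c v by rewrite e_sym.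
have [a1 [a2 Na]] := cubic1 aA vA eav; have [b1 [b2 Nb]] := cubic1 bA vA ebv.
have [c1 [c2 Nc]] := cubic1 cA vA ecv.
by apply: (bounded_triangle_free_cubic IH Nv Na Nb Nc).
Qed.

End Core.

Lemma bounded_subcubic A v : below A -> v \in A -> (forall x, x \in A -> #|nb A x| <= 3) -> bounded A.
Proof.
move=> IH vA max3.
have [/exists_inP[x xA /eqP d0]|n0] := boolP [exists x in A, #|nb A x| == 0].
  have [|s [N]] := @nbl_ex A x [::] xA isT; first by [].
  by rewrite d0; case: s N => // N _; apply: bounded_degree0 _ _ IH N.
have [/exists_inP[x xA /eqP d1]|n1] := boolP [exists x in A, #|nb A x| == 1].
  have [|s [N]] := @nbl_ex A x [::] xA isT; first by [].
  rewrite d1; case: s N => [|w [|]] //= N _.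
  have [_ _ /andP[wA _] h] := N.
  have ewx : e w x by rewrite e_sym h ?inE.
  have [|s [N' sz]] := @nbl_ex A w [:: x] wA isT; first by rewrite /= xA ewx.
  apply: (bounded_leaf IH N N'); have := max3 w wA; rewrite -sz /=; clear; lia.
have deg23 x : x \in A -> 1 < #|nb A x| <= 3.
  move=> xA; rewrite max3 // andbT; move/exists_inPn: n0 => /(_ x xA); move/exists_inPn: n1 => /(_ x xA).
  by clear; lia.
have [/exists_inP[x xA /eqP d2]|n2] := boolP [exists x in A, #|nb A x| == 2].
  exact: (bounded_degree2_case IH deg23 xA d2).
apply: (bounded_cubic_case IH deg23 _ vA) => x xA.
by have := deg23 x xA; move/exists_inPn: n2 => /(_ x xA); clear; lia.
Qed.

(** * The induction and the theorem *)

Lemma all_bounded A : bounded A.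
Proof.
have [n] := ubnP #|A|; elim: n A => // n IHn A An.
have IH : below A by move=> B BA; apply: IHn; apply: leq_trans BA An.
have [->|[x xA]] := set_0Vmem A; first by right; rewrite /ext cards0; apply: kparts0.
case: (@arg_maxnP _ x (mem A) (fun v => #|nb A v|) xA) => v vA vmax.
have [d6|] := leqP 6 #|nb A v|; first exact: bounded_degree_ge6 _ _ IH vA d6.
rewrite leq_eqVlt => /orP[/eqP[d5]|]; first exact: bounded_degree5 _ _ IH vA d5.
rewrite ltnS leq_eqVlt => /orP[/eqP[d4]|d3].
  by apply: (bounded_degree4 IH vA d4) => y yA; rewrite -d4; apply: vmax.
by apply: (bounded_subcubic IH vA) => y yA; apply: leq_trans (vmax y yA) _.
Qed.

Lemma ext_setT : ext [set: T] <-> union_of_Kstars e (extremal_shape (#|T| %% 5) (T := T)).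
Proof.
rewrite /ext cardsT; split.
  have conv a b : kparts [set: T] a b -> exists P : {set {set T}},
      [/\ partition P [set: T],
        (forall B1 B2 x y, B1 \in P -> B2 \in P -> x \in B1 -> y \in B2 -> e x y -> B1 = B2),
        (forall B, B \in P -> is_Kstar_on e B) &
        [/\ [forall B in P, #|B| \in [:: 4; 5; 6]], nblocks P 4 = a & nblocks P 6 = b]].
    case=> P [pP cr ks na nb6]; exists P; split=> // [B /ks[]//|]; split=> //.
    by apply/forall_inP => B /ks[].
  rewrite /union_of_Kstars /extremal_shape.
  by case: (#|T| %% 5) => [|[|[|[|r]]]] /conv[P [pP cr ks [sz na nb6]]]; exists P; split=> //;
    rewrite /= ?na ?nb6 sz.
case=> P [pP cr ks]; rewrite /extremal_shape => /andP[/forall_inP sz].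
have kp : kparts [set: T] (nblocks P 4) (nblocks P 6).
  by exists P; split=> // B BP; split; [apply: ks|apply: sz].
by case: (#|T| %% 5) => [|[|[|[|r]]]] /= /andP[/eqP E4 /eqP E6]; rewrite E4 E6 in kp.
Qed.

Lemma phi_phiS : phi e = phiS [set: T].
Proof.
apply: eq_card => F; rewrite inE MaxE /maximal_dissociation.
apply/maxsetP/maxsetP => -[dF mF].
  by split=> [|X /andP[_ dX]]; [rewrite subsetT|apply: mF].
by case/andP: dF => _ dF; split=> // X dX; apply: mF; rewrite subsetT.
Qed.

End MaximalDissociationSets.

Theorem theorem5p1 (T : finType) (e : rel T)
  (e_sym : symmetric e) (e_irr : irreflexive e) (hn : 8 <= #|T|) :
  let t := #|T| %/ 5 in let r := #|T| %% 5 in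
  phi e <= phi_bound t r /\
  (phi e = phi_bound t r <-> union_of_Kstars e (extremal_shape r (T:=T))).
Proof.
move=> t r; have bnd := all_bounded e_sym e_irr [set: T].
have E : fb #|[set: T]| = 20 * phi_bound t r by rewrite cardsT; apply: fb_phi_bound.
rewrite (phi_phiS e); split.
  by rewrite -(leq_pmul2l (isT : 0 < 20)) -E; apply: bounded_le.
rewrite -(ext_setT e); split=> [eq|ex].
  by case: bnd => //; rewrite E eq ltnn.
apply/eqP; rewrite -(eqn_pmul2l (isT : 0 < 20)) -E; apply/eqP; exact: ext_eq.
Qed.
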